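(* Let $\varphi : M^2 \to N^4 (\epsilon)$ be a non-CMC biconservative W-surface with flat normal bundle. Assume that $3 f^2 + K - \epsilon \neq 0$, $\nabla^\perp E_3 \neq 0$, $A_4 \neq 0$ and $\nabla_{E_2} E_2 \neq 0$ at any point. Then $M$ satisfies $A_3 (\operatorname{grad} f) = 2 f \operatorname{grad} f$ if and only if, locally, \[ b_1 = - \frac{3 c^3 \dot f}{f^3},\qquad a_2=\frac32\frac{\dot f}{f},\qquad \alpha=c^{-3}f^3,\qquad k_2=0, \] where $c$ is a positive constant and the mean curvature function $f=f(s)$ is a positive solution of \[ \ddot f f - \frac 5 2 \dot f^2 - \frac 2 3 \epsilon f^2 + \frac 2 3 c^{-6} f^8 = 0 \] such that $\dot f > 0$.
   Context: $N^4(\epsilon)$, $\epsilon\in\mathbb R$, is the 4-dimensional space form (complete, simply connected) of constant sectional curvature $\epsilon$. Manifolds are connected and immersions are isometric. For a surface $\varphi:M^2\to N^4(\epsilon)$: $B$ is the second fundamental form, $A_\eta$ the shape operator in the normal direction $\eta$, $\nabla$ the Levi-Civita connection, $\nabla^\perp$ the normal connection, $H=\frac12\operatorname{trace}B$, $f=|H|$ the mean curvature function, $K$ the Gaussian curvature. The surface has flat normal bundle if the curvature of $\nabla^\perp$ vanishes. It is biconservative if $2\operatorname{trace}A_{\nabla^\perp_{(\cdot)}H}(\cdot)+\operatorname{grad}|H|^2=0$. It is a W-surface if there is a smooth $W:\mathbb R^2\to\mathbb R$ with nowhere zero gradient such that $W(f,K)=0$ on $M$. ''Non-CMC biconservative''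 means biconservative with $H\neq0$, $\operatorname{grad}f\neq0$ and $A_{H/f}\neq f\,\mathrm{Id}$ at every point. Frame (all results are local; $M$ is taken to be a connected domain where the following is defined): $E_3=H/f$, $E_4$ is a unit normal section orthogonal to $E_3$, $A_3=A_{E_3}$, $A_4=A_{E_4}$, and $\{E_1,E_2\}$ is an orthonormal tangent frame with $A_3E_1=k_1E_1$, $A_3E_2=k_2E_2$. Flatness of the normal bundle gives $A_4E_1=\alpha E_1$, $A_4E_2=-\alpha E_2$ for a smooth function $\alpha$. The functions $a_i,b_i$ are defined by $\nabla_{E_1}E_1=-a_1E_2$, $\nabla_{E_2}E_2=a_2E_1$ and $b_i=\langle\nabla^\perp_{E_i}E_3,E_4\rangle$, $i=1,2$. Labelling convention: when $b_1b_2=0$ on $M$ and $\nabla^\perp E_3\neq0$ at every point (the first condition is automatic for the surfaces considered here), $E_1,E_2$ are labelled so that $b_1\neq0$ everywhere and $b_2=0$ on $M$. Sign convention: the signs of $E_1$ and $E_4$ are chosen so that $E_1(f)>0$ and $\alpha>0$ (then $E_1=\operatorname{grad}f/|\operatorname{grad}f|$). ''Locally'' means: around any point, in local coordinates $(s,t)$ in which the metric is $ds^2+g_{22}(s)dt^2$, $E_1=\partial/\partial s$, $E_2=g_{22}^{-1/2}\partial/\partial t$, and $f,k_1,k_2,\alpha,a_2,b_1,K$ depend only on $s$ (such coordinates exist for the surfaces considered here). The dot denotes $d/ds$. *)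

(* Defs.v *)
From HB Require Import structures.
From mathcomp Require Import all_boot all_order all_algebra.
From mathcomp Require Import all_classical all_reals all_analysis.
Set Implicit Arguments.
Unset Strict Implicit.
Unset Printing Implicit Defensive.
Import Order.TTheory GRing.Theory Num.Theory.
Import numFieldNormedType.Exports.
Local Open Scope classical_set_scope.
Local Open Scope ring_scope.

Definition e_ {R : realType} (i : 'I_2) : 'rV[R]_2 := delta_mx 0 i.

Fixpoint Ck {R : realType} {n : nat} {V : normedModType R} (k : nat)
    (A : set 'rV[R]_n.+1) (u : 'rV[R]_n.+1 -> V) : Prop :=
  match k with
  | 0%N => forall x, A x -> {for x, continuous u}
  | k'.+1 => (forall x, A x -> differentiable u x) /\
             (forall v, Ck k' A (fun x => 'D_v u x))
  end.

(* C^oo on A; only used for open A. *)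
Definition smooth {R : realType} {n : nat} {V : normedModType R}
    (A : set 'rV[R]_n.+1) (u : 'rV[R]_n.+1 -> V) : Prop :=
  forall k, Ck k A u.

(** * Smooth surfaces *)

(* [cmap] is meaningful on [cdom] only, [cinv] on [cimg] only. *)
Record chart (R : realType) (M : topologicalType) := Chart {
  cdom : set M;
  cmap : M -> 'rV[R]_2;
  cinv : 'rV[R]_2 -> M }.

Definition cimg (R : realType) (M : topologicalType) (c : chart R M) :
  set 'rV[R]_2 := cmap c @` cdom c.

Definition is_chart (R : realType) (M : topologicalType) (c : chart R M) :=
  [/\ open (cdom c), open (cimg c),
      forall q, cdom c q -> {for q, continuous (cmap c)},
      forall x, cimg c x -> {for x, continuous (cinv c)} &
      forall q, cdom c q -> cinv c (cmap c q) = q].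

Definition compatible (R : realType) (M : topologicalType) (c c' : chart R M) :=
  smooth (cmap c @` (cdom c `&` cdom c')) (cmap c' \o cinv c) /\
  smooth (cmap c' @` (cdom c `&` cdom c')) (cmap c \o cinv c').

(* The atlas is the family of the [chart_at p]. *)
Record surface (R : realType) := Surface {
  carrier :> topologicalType;
  chart_at : carrier -> chart R carrier;
  chart_atP : forall p, is_chart (chart_at p);
  mem_chart_at : forall p, cdom (chart_at p) p;
  chart_at_compatible : forall p q, compatible (chart_at p) (chart_at q);
  surface_hausdorff : hausdorff_space carrier;
  surface_second_countable : @second_countable carrier;
  surface_connected : connected [set: carrier] }.
Arguments chart_at {R s}.

Definition in_max_atlas (R : realType) (M : surface R) (c : chart R M) :=
  is_chart c /\ forall p : M, compatible (chart_at p) c.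

(* Local expression of u in the chart at p. *)
Definition loc {R : realType} {M : surface R} {V : Type} (p : M) (u : M -> V) :
  'rV[R]_2 -> V := u \o cinv (chart_at p).

Definition pt {R : realType} {M : surface R} (p : M) : 'rV[R]_2 :=
  cmap (chart_at p) p.

(* T_pM is identified with 'rV_2 by the chart at p; a vector field is thus a
   map M -> 'rV_2, and Dsurf u p v is the derivative of u along v in T_pM. *)
Definition Dsurf {R : realType} {M : surface R} {V : normedModType R}
  (u : M -> V) (p : M) (v : 'rV[R]_2) : V := 'D_v (loc p u) (pt p).

Definition smooth_on_surface {R : realType} {M : surface R}
    {V : normedModType R} (u : M -> V) :=
  forall p : M, smooth (cimg (chart_at p)) (loc p u).

(* Components, in the chart c, of the vector field X. *)
Definition components {R : realType} {M : surface R} (c : chart R M)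
  (X : M -> 'rV[R]_2) (q : M) : 'rV[R]_2 := Dsurf (cmap c) q (X q).

Definition smooth_field {R : realType} {M : surface R} (X : M -> 'rV[R]_2) :=
  forall p : M, smooth (cimg (chart_at p)) (loc p (components (chart_at p) X)).

(** * Metrics on open subsets of the plane, G being the matrix (g_ij) *)

Section Metric.
Context {R : realType} (G : 'rV[R]_2 -> 'M[R]_2).

(* The components Gamma^k_ij, k < 2. *)
Definition christoffel (i j : 'I_2) (x : 'rV[R]_2) : 'rV[R]_2 :=
  2^-1 *: ((\row_l ('D_(e_ i) (fun y => G y j l) x
                  + 'D_(e_ j) (fun y => G y i l) x
                  - 'D_(e_ l) (fun y => G y i j) x)) *m invmx (G x)).

(* Levi-Civita connection: nabla_v Y at x. *)
Definition levi_civita (Y : 'rV[R]_2 -> 'rV[R]_2) (v x : 'rV[R]_2) : 'rV[R]_2 :=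
  'D_v Y x + \sum_i \sum_j (v 0 i * Y x 0 j) *: christoffel i j x.

(* <R(d_0, d_1) d_1, d_0> / det G; the coordinate fields commute. *)
Definition gauss_curvature (x : 'rV[R]_2) : R :=
  let Rm := levi_civita (levi_civita (fun=> e_ 1) (e_ 1)) (e_ 0) x
          - levi_civita (levi_civita (fun=> e_ 1) (e_ 0)) (e_ 1) x in
  (Rm *m G x) 0 0 / \det (G x).

Definition gradient (u : 'rV[R]_2 -> R) (x : 'rV[R]_2) : 'rV[R]_2 :=
  (\row_j 'D_(e_ j) u x) *m invmx (G x).

Definition metric_trace {V : lmodType R} (T : 'rV[R]_2 -> 'rV[R]_2 -> V)
  (x : 'rV[R]_2) : V := \sum_i \sum_j invmx (G x) i j *: T (e_ i) (e_ j).

End Metric.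

(** * The space form N^4(eps) *)

(* The Euclidean product of R^5 if eps >= 0, the Lorentzian one if eps < 0. *)
Definition dot {R : realType} (eps : R) (u v : 'rV[R]_5) : R :=
  \sum_i (if (eps < 0) && (i == 0) then -1 else 1) * (u 0 i * v 0 i).

(* Round sphere of radius eps^(-1/2), hyperplane x_0 = 0, or upper sheet of
   the hyperboloid <x, x> = 1 / eps. *)
Definition N4 {R : realType} (eps : R) : set 'rV[R]_5 :=
  [set x : 'rV[R]_5 | if eps == 0 then x 0 0 = 0
           else dot eps x x = eps^-1 /\ (eps < 0 -> 0 < x 0 0)].

Definition tangent_N4 {R : realType} (eps : R) (x w : 'rV[R]_5) : Prop :=
  if eps == 0 then w 0 0 = 0 else dot eps w x = 0.

(* Orthogonal projection on T_x N^4(eps) of the derivative of a map into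
   N^4(eps) or of a section of its tangent bundle. For eps <> 0 the vector x is
   normal to N^4(eps) at x and <x, x> = 1 / eps; for eps = 0 such derivatives
   are already tangent. *)
Definition proj_N4 {R : realType} (eps : R) (x w : 'rV[R]_5) : 'rV[R]_5 :=
  w - (eps * dot eps w x) *: x.

(** * Parametrized surfaces psi in N^4(eps)

   Tangent vectors are elements of 'rV_2, sections along psi are maps
   'rV_2 -> 'rV_5. *)

Section Parametrized.
Context {R : realType} (eps : R) (psi : 'rV[R]_2 -> 'rV[R]_5).

Definition first_form (x : 'rV[R]_2) : 'M[R]_2 :=
  \matrix_(i, j) dot eps ('D_(e_ i) psi x) ('D_(e_ j) psi x).

(* Levi-Civita connection of N^4(eps) along psi. *)
Definition ambient_conn (Z : 'rV[R]_2 -> 'rV[R]_5) (v x : 'rV[R]_2) :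
  'rV[R]_5 := proj_N4 eps (psi x) ('D_v Z x).

Definition tangent_part (x : 'rV[R]_2) (w : 'rV[R]_5) : 'rV[R]_2 :=
  (\row_j dot eps w ('D_(e_ j) psi x)) *m invmx (first_form x).

Definition normal_part (x : 'rV[R]_2) (w : 'rV[R]_5) : 'rV[R]_5 :=
  w - 'D_(tangent_part x w) psi x.

Definition second_form (v w x : 'rV[R]_2) : 'rV[R]_5 :=
  normal_part x (ambient_conn (fun y => 'D_w psi y) v x).

(* The solution of <A_eta v, w> = <B(v, w), eta> for all w. *)
Definition shape_op (eta : 'rV[R]_5) (v x : 'rV[R]_2) : 'rV[R]_2 :=
  (\row_j dot eps (second_form v (e_ j) x) eta) *m invmx (first_form x).

Definition normal_conn (Z : 'rV[R]_2 -> 'rV[R]_5) (v x : 'rV[R]_2) :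
  'rV[R]_5 := normal_part x (ambient_conn Z v x).

Definition normal_section (A : set 'rV[R]_2) (Z : 'rV[R]_2 -> 'rV[R]_5) :=
  smooth A Z /\
  forall x, A x -> tangent_N4 eps (psi x) (Z x) /\
                   forall v, dot eps (Z x) ('D_v psi x) = 0.

(* Constant fields v, w commute, so that there is no bracket term. *)
Definition flat_normal_conn (A : set 'rV[R]_2) :=
  forall Z, normal_section A Z -> forall v w x, A x ->
    normal_conn (normal_conn Z w) v x - normal_conn (normal_conn Z v) w x = 0.

End Parametrized.

(** * Immersed surfaces in N^4(eps) *)

Section Immersed.
Context {R : realType} (eps : R) {M : surface R} (phi : M -> 'rV[R]_5).

(* M carries the metric induced by phi, so that phi is isometric. *)
Definition immersion_in_N4 :=
  [/\ smooth_on_surface phi, forall p, N4 eps (phi p) &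
      forall p v, Dsurf phi p v = 0 -> v = 0].

Definition metric (p : M) : 'rV[R]_2 -> 'M[R]_2 := first_form eps (loc p phi).

Definition inner (p : M) (v w : 'rV[R]_2) : R := (v *m metric p (pt p) *m w^T) 0 0.

Definition gradM (u : M -> R) (p : M) : 'rV[R]_2 :=
  gradient (metric p) (loc p u) (pt p).

(* nabla_v Y, for v in T_pM *)
Definition nabla (Y : M -> 'rV[R]_2) (p : M) (v : 'rV[R]_2) : 'rV[R]_2 :=
  levi_civita (metric p) (loc p (components (chart_at p) Y)) v (pt p).

Definition gaussK (p : M) : R := gauss_curvature (metric p) (pt p).

Definition secondB (p : M) (v w : 'rV[R]_2) : 'rV[R]_5 :=
  second_form eps (loc p phi) v w (pt p).

Definition shapeA (p : M) (eta : 'rV[R]_5) (v : 'rV[R]_2) : 'rV[R]_2 :=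
  shape_op eps (loc p phi) eta v (pt p).

Definition nabla_perp (Z : M -> 'rV[R]_5) (p : M) (v : 'rV[R]_2) : 'rV[R]_5 :=
  normal_conn eps (loc p phi) (loc p Z) v (pt p).

Definition meanH (p : M) : 'rV[R]_5 := 2^-1 *: metric_trace (metric p) (secondB p) (pt p).

Definition meanf (p : M) : R := Num.sqrt (dot eps (meanH p) (meanH p)).

Definition E3 (p : M) : 'rV[R]_5 := (meanf p)^-1 *: meanH p.

Definition biconservative :=
  forall p, 2 *: metric_trace (metric p)
                   (fun v w => shapeA p (nabla_perp meanH p v) w) (pt p)
            + gradM (fun q => meanf q ^+ 2) p = 0.

Definition non_CMC_biconservative :=
  biconservative /\
  forall p, [/\ meanH p != 0, gradM meanf p != 0 &
                exists v, shapeA p (E3 p) v != meanf p *: v].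

Definition W_surface :=
  exists W : 'rV[R]_2 -> R,
    [/\ smooth setT W,
        forall x, (\row_j 'D_(e_ j) W x) != 0 &
        forall p, W (meanf p *: e_ 0 + gaussK p *: e_ 1) = 0].

Definition flat_normal_bundle :=
  forall p, flat_normal_conn eps (loc p phi) (cimg (chart_at p)).

(* E_3 is H / f; k_i, alpha, a_i are determined by the equations they satisfy. *)
Record adapted_frame (E1 E2 : M -> 'rV[R]_2) (E4 : M -> 'rV[R]_5)
    (k1 k2 alpha a1 a2 b1 b2 : M -> R) : Prop := AdaptedFrame {
  frame_smooth1 : smooth_field E1;
  frame_smooth2 : smooth_field E2;
  frame_orthonormal : forall p, [/\ inner p (E1 p) (E1 p) = 1,
    inner p (E2 p) (E2 p) = 1 & inner p (E1 p) (E2 p) = 0];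
  frame_smooth4 : smooth_on_surface E4;
  frame_normal4 : forall p, tangent_N4 eps (phi p) (E4 p) /\
    forall v, dot eps (E4 p) (Dsurf phi p v) = 0;
  frame_unit4 : forall p, dot eps (E4 p) (E4 p) = 1;
  frame_orth34 : forall p, dot eps (E3 p) (E4 p) = 0;
  frame_k1 : forall p, shapeA p (E3 p) (E1 p) = k1 p *: E1 p;
  frame_k2 : forall p, shapeA p (E3 p) (E2 p) = k2 p *: E2 p;
  frame_alpha1 : forall p, shapeA p (E4 p) (E1 p) = alpha p *: E1 p;
  frame_alpha2 : forall p, shapeA p (E4 p) (E2 p) = - alpha p *: E2 p;
  frame_a1 : forall p, nabla E1 p (E1 p) = - a1 p *: E2 p;
  frame_a2 : forall p, nabla E2 p (E2 p) = a2 p *: E1 p;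
  frame_b1 : forall p, b1 p = dot eps (nabla_perp E3 p (E1 p)) (E4 p);
  frame_b2 : forall p, b2 p = dot eps (nabla_perp E3 p (E2 p)) (E4 p) }.

Definition frame_labelling (b1 b2 : M -> R) := forall p, b1 p != 0 /\ b2 p = 0.

Definition frame_signs (E1 : M -> 'rV[R]_2) (alpha : M -> R) :=
  forall p, 0 < Dsurf meanf p (E1 p) /\ 0 < alpha p.

Definition depends_only_on_s (c : chart R M) (u : M -> R) :=
  exists U : R -> R, forall q, cdom c q -> u q = U (cmap c q 0 0).

(* cmap c = (s, t), the metric is ds^2 + g22(s) dt^2, E_1 = d/ds and
   E_2 = g22^(-1/2) d/dt. *)
Definition st_coordinates (E1 E2 : M -> 'rV[R]_2)
    (k1 k2 alpha a2 b1 : M -> R) (c : chart R M) :=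
  [/\ in_max_atlas c,
      exists g22 : R -> R, forall q, cdom c q ->
        let s := cmap c q 0 0 in
        [/\ 0 < g22 s,
            first_form eps (phi \o cinv c) (cmap c q) =
              diag_mx (e_ 0 + g22 s *: e_ 1),
            components c E1 q = e_ 0 &
            components c E2 q = (Num.sqrt (g22 s))^-1 *: e_ 1],
      [/\ depends_only_on_s c meanf, depends_only_on_s c k1 &
          depends_only_on_s c k2] &
      [/\ depends_only_on_s c alpha, depends_only_on_s c a2,
          depends_only_on_s c b1 & depends_only_on_s c gaussK]].

End Immersed.

(* Main.v *)
Require Import Defs.
From HB Require Import structures.
From mathcomp Require Import all_boot all_order all_algebra.
From mathcomp Require Import all_classical all_reals all_analysis.
From mathcomp Require Import ring lra.
Import Order.TTheory GRing.Theory Num.Theory.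
Import numFieldNormedType.Exports.
Local Open Scope classical_set_scope.
Local Open Scope ring_scope.

Set Implicit Arguments.
Unset Strict Implicit.
Unset Printing Implicit Defensive.

(** Why the theorem is true. The surface lies in a linear space of dimension 5,
   Euclidean or Lorentzian, in which E1, E2, E3, E4 and the position vector phi form an
   orthogonal frame (for eps = 0, phi is replaced by the unit normal of the hyperplane).
   All invariants are components of the derivatives of this frame, and the Codazzi and
   Gauss equations are components of the commutator relation
   E1 E2 - E2 E1 = a1 E1 + a2 E2 of the two tangent fields, applied to the frame.

   If A_3 (grad f) = 2 f grad f, then E1 f > 0 forces k1 = 2 f, and k1 + k2 = 2 f gives
   k2 = 0 ([gradM_eigenvector]). As b2 = 0, the biconservative equation becomes
   E2 f = 0 and alpha b1 = - 3 E1 f, the Codazzi equations become a1 = 0, E2 alpha = 0,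
   a2 f = 3/2 E1 f and E1 alpha = 2 a2 alpha, and the Gauss equation becomes
   E1 a2 = a2^2 - alpha^2 + eps. These equations say that alpha / f^3 has zero
   derivative; it is the constant c^-3 ([proportional_cube], [alpha_cube]); the
   Gauss equation turns into the differential equation of f ([meanf_ode]).

   The coordinates s and t are found without the theorem on commuting fields and without
   solving differential equations. The function a2^2 + alpha^2 + eps is a constant
   multiple of f^3 as well, which makes (E1 f)^2 a polynomial in f
   ([derE1_meanf_sqr]); hence s is a primitive of 1 / sqrt of it, composed with f. The
   integral curves of E2 lie in planes, and the component h of E2 in a fixed direction
   is constant along E1 and conserves an energy along E2 ([height_energy]), so that
   (E2 h)^2 is f^3 times a polynomial in h; hence t is a primitive of 1 / sqrt of that
   polynomial, composed with h. Then E1 s = 1, E1 t = E2 s = 0 and E2 t = f^(3/2), and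
   the inverse function theorem ([inverse_function], [chart_of_map]) makes (s, t) a chart
   of the maximal atlas ([chart_of_quadratures], [st_chart]). In it g22 = f^-3, and f is
   a function of s because E2 f = 0 ([st_chart_solution]).

   Conversely, k2 = 0 and b2 = 0 in the biconservative equation give E2 f = 0. Hence
   grad f = (E1 f) E1 is an eigenvector of A_3 for the eigenvalue k1 = 2 f
   ([gradM_eigenvector_of_k2]). *)

(** * Differentials and directional derivatives *)

Section Differentiability.
Context {R : realType}.

(** The difference g - f vanishes near x, so that it is differentiable there. *)
Lemma near_eq_differentiable {V W : normedModType R} (f g : V -> W) x :
  (\near x, f x = g x) -> differentiable f x -> differentiable g x.
Proof.
move=> fg df.
pose h := g - f.
have hE : h \o shift x = cst (h x) + (0 : V -> W) +o_ 0 id.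
  apply/eqaddoP => _/posnumP[e].
  have : \forall y \near 0, f (y + x) = g (y + x).
    have := fg; rewrite (near_shift 0) /=; apply: filterS => y.
    by rewrite /= subr0.
  apply: filterS => y /= fgy.
  rewrite /h !fctE /= fgy (nbhs_singleton fg) !subrr addr0 subrr normr0.
  by rewrite mulr_ge0.
have c0 : continuous (0 : V -> W) by apply: cst_continuous.
have dh := diff_unique (df := (\0 : {linear V -> W})%R) c0 hE.
have dfh : differentiable h x.
  by apply/diff_locallyP; rewrite dh; split.
by have := differentiableD df dfh; rewrite /h addrC subrK.
Qed.

Lemma deriveZvar {V W : normedModType R} (f : V -> W) x v a :
  differentiable f x -> 'D_(a *: v) f x = a *: 'D_v f x.
Proof. by move=> df; rewrite !deriveE // linearZ. Qed.

Lemma deriveDvar {V W : normedModType R} (f : V -> W) x v w :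
  differentiable f x -> 'D_(v + w) f x = 'D_v f x + 'D_w f x.
Proof. by move=> df; rewrite !deriveE // linearD. Qed.

Lemma derive_sumvar n {W : normedModType R} (f : 'rV[R]_n -> W) x v :
  differentiable f x ->
  'D_v f x = \sum_j v 0 j *: 'D_(delta_mx 0 j) f x.
Proof.
move=> df; rewrite {1}[v]row_sum_delta deriveE // linear_sum.
by apply: eq_bigr => j _; rewrite linearZ deriveE.
Qed.

Lemma differentiable_rowP n {V : normedModType R} (u : V -> 'rV[R]_n) x :
  differentiable u x <-> forall j, differentiable (fun y => u y 0 j) x.
Proof.
split=> [du j|du].
  exact: (differentiable_comp du (differentiable_coord _ 0 j)).
rewrite (_ : u = \sum_(j < n) (fun y => u y 0 j *: delta_mx 0 j)).
  by apply: differentiable_sum => j; apply: differentiableZl.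
by apply/funext => y; rewrite {1}[u y]row_sum_delta fct_sumE.
Qed.

Lemma derive_row n {V : normedModType R} (u : V -> 'rV[R]_n) x v j :
  differentiable u x -> ('D_v u x) 0 j = 'D_v (fun y => u y 0 j) x.
Proof. by move=> du; rewrite derive_mx ?mxE//; apply: diff_derivable. Qed.

Lemma derive_comp {U V W : normedModType R} (f : U -> V) (g : V -> W) x v :
  differentiable f x -> differentiable g (f x) ->
  'D_v (g \o f) x = 'D_('D_v f x) g (f x).
Proof.
move=> df dg; have dgf := differentiable_comp df dg.
by rewrite (deriveE _ dgf) (deriveE _ dg) (deriveE _ df) diff_comp.
Qed.

(** The difference quotient definition of the differential, in the form in
   which one checks it for an inverse function. *)
Lemma differentiable_lim {V W : normedModType R} (f : V -> W)
    (L : {linear V -> W}) x :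
  continuous L ->
  (forall e, 0 < e ->
     \forall h \near 0, `|f (h + x) - f x - L h| <= e * `|h|) ->
  differentiable f x /\ forall v, 'D_v f x = L v.
Proof.
move=> cL fL.
have fE : f \o shift x = cst (f x) + (L : V -> W) +o_ 0 id.
  apply/eqaddoP => e e0; have := fL e e0; apply: filterS => h /=.
  by rewrite /= !fctE /= opprD addrA.
have dL := diff_unique cL fE.
have df : differentiable f x by apply/diff_locallyP; rewrite dL; split.
by split => // v; rewrite deriveE // dL.
Qed.

End Differentiability.

(** * Calculus of smooth functions *)

Section CkCalculus.
Context {R : realType} {n : nat}.
Local Notation E := 'rV[R]_n.+1.
Implicit Types (A : set E).

Lemma open_near_eq A {T : Type} (u w : E -> T) x :
  open A -> (forall x, A x -> u x = w x) -> A x -> \near x, u x = w x.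
Proof.
move=> oA uw Ax; apply: filterS (open_nbhs_nbhs (conj oA Ax)) => y; exact: uw.
Qed.

Lemma Ck_eq {V : normedModType R} k A (u w : E -> V) :
  open A -> (forall x, A x -> u x = w x) -> Ck k A u -> Ck k A w.
Proof.
move=> oA; elim: k u w => [|k IH] u w uw /=.
  move=> cu x Ax; rewrite /prop_for /continuous_at -(uw x) //.
  have uwx := open_near_eq oA uw Ax.
  by apply: cvg_trans (cu x Ax); exact: (near_eq_cvg uwx).
move=> [du Du]; split=> [x Ax|v].
  by apply: near_eq_differentiable (du x Ax); exact: open_near_eq oA uw Ax.
apply: IH (Du v) => x Ax.
by apply: near_eq_derive; exact: open_near_eq oA uw Ax.
Qed.

Lemma Ck_sub {V : normedModType R} k A A' (u : E -> V) :
  A' `<=` A -> Ck k A u -> Ck k A' u.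
Proof.
move=> AA; elim: k u => [|k IH] u /=; first by move=> cu x /AA; exact: cu.
by move=> [du Du]; split=> [x /AA|v]; [exact: du|exact: IH].
Qed.

Lemma Ck_pred {V : normedModType R} k A (u : E -> V) : Ck k.+1 A u -> Ck k A u.
Proof.
elim: k u => [|k IH] u.
  by case=> du _ x Ax; apply: differentiable_continuous (du x Ax).
by case=> du Du; split=> // v; apply: IH.
Qed.

Lemma Ck_cst {V : normedModType R} k A (a : V) : Ck k A (fun=> a).
Proof.
elim: k a => [|k IH] a /=; first by move=> x _; exact: cst_continuous.
split=> [x _|v]; first exact: differentiable_cst.
suff -> : (fun x => 'D_v (fun=> a) x) = (fun=> 0 : V) by [].
by apply/funext => x; exact: derive_cst.
Qed.

Lemma CkD {V : normedModType R} k A (u w : E -> V) : open A ->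
  Ck k A u -> Ck k A w -> Ck k A (fun x => u x + w x).
Proof.
move=> oA; elim: k u w => [|k IH] u w /=.
  by move=> cu cw x Ax; apply: continuousD; [exact: cu|exact: cw].
move=> [du Du] [dw Dw]; split=> [x Ax|v].
  by apply: differentiableD; [exact: du|exact: dw].
apply: Ck_eq (IH _ _ (Du v) (Dw v)) => // x Ax.
by rewrite deriveD //; apply: diff_derivable; [exact: du|exact: dw].
Qed.

Lemma Ck_sum {V : normedModType R} k A (I : Type) (r : seq I) (u : I -> E -> V) :
  open A -> (forall i, Ck k A (u i)) -> Ck k A (fun x => \sum_(i <- r) u i x).
Proof.
move=> oA cu; elim: r => [|i r IH].
  by apply: Ck_eq (Ck_cst k A 0) => // x _; rewrite big_nil.
by apply: Ck_eq (CkD oA (cu i) IH) => // x _; rewrite big_cons.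
Qed.

Lemma CkM k A (u w : E -> R) : open A ->
  Ck k A u -> Ck k A w -> Ck k A (fun x => u x * w x).
Proof.
move=> oA; elim: k u w => [|k IH] u w.
  by move=> cu cw x Ax; apply: continuousM; [exact: cu|exact: cw].
move=> cu cw; have [du Du] := cu; have [dw Dw] := cw; split=> [x Ax|v].
  by apply: differentiableM; [exact: du|exact: dw].
have cu' := Ck_pred cu; have cw' := Ck_pred cw.
apply: Ck_eq (CkD oA (IH _ _ cu' (Dw v)) (IH _ _ cw' (Du v))) => // x Ax.
rewrite deriveM //.
  by apply: diff_derivable; exact: du.
by apply: diff_derivable; exact: dw.
Qed.

Lemma CkV k A (u : E -> R) : open A -> (forall x, A x -> u x != 0) ->
  Ck k A u -> Ck k A (fun x => (u x)^-1).
Proof.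
move=> oA u0; elim: k u u0 => [|k IH] u u0.
  by move=> cu x Ax; apply: continuousV; [exact: u0|exact: cu].
move=> cu; have [du Du] := cu; split=> [x Ax|v].
  by apply: differentiableV; [exact: du|exact: u0].
have cV := IH _ u0 (Ck_pred cu).
apply: Ck_eq (CkM oA (Ck_cst k A (-1 : R)) (CkM oA (CkM oA cV cV) (Du v))) => // x Ax.
rewrite deriveV ?u0 //; last first.
  by apply: diff_derivable; exact: du.
by rewrite expr2 invfM scaleNr mulN1r.
Qed.

(** The derivative of the square root only involves its inverse, so that the induction
   raises the class by one. *)
Lemma Ck_sqrt k A (u : E -> R) : open A -> (forall x, A x -> 0 < u x) ->
  Ck k A u -> Ck k A (fun x => Num.sqrt (u x)).
Proof.
move=> oA u0; elim: k u u0 => [|k IH] u u0.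
  move=> cu x Ax; apply: (continuous_comp (cu x Ax)); exact: sqrt_continuous.
move=> cu; have [du Du] := cu.
have dS x : A x -> differentiable (@Num.sqrt R) (u x) /\
    forall r, 'D_r (@Num.sqrt R) (u x) = r * (2 * Num.sqrt (u x))^-1.
  move=> Ax; have hd := is_derive1_sqrt (u0 x Ax).
  have d1 : differentiable (@Num.sqrt R) (u x) by apply/derivable1_diffP.
  split => // r; have <- : 'D_1 (@Num.sqrt R) (u x) = (2 * Num.sqrt (u x))^-1.
    exact: derive_val.
  by rewrite -[in LHS](mulr1 r) deriveZvar.
split=> [x Ax|v].
  by apply: differentiable_comp; [exact: du|case: (dS x Ax)].
have cS := IH _ u0 (Ck_pred cu).
have c2S := CkM oA (Ck_cst k A (2 : R)) cS.
have {}c2S : Ck k A (fun x => (2 * Num.sqrt (u x))^-1).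
  apply: CkV c2S => // x Ax.
  by rewrite mulf_neq0 ?pnatr_eq0 // gt_eqF ?sqrtr_gt0 // u0.
apply: Ck_eq (CkM oA (Du v) c2S) => // x Ax.
have [d1 d2] := dS x Ax.
by rewrite -[RHS]/('D_v (Num.sqrt \o u) x) (derive_comp _ (du x Ax) d1) d2.
Qed.

Lemma Ck_rowP k A m (u : E -> 'rV[R]_m) : open A ->
  Ck k A u <-> forall j, Ck k A (fun x => u x 0 j).
Proof.
move=> oA; elim: k u => [|k IH] u; split.
- move=> cu j x Ax; apply: (@continuous_comp _ _ _ u (fun w => w 0 j)).
    exact: cu.
  exact: coord_continuous.
- move=> cu x Ax; apply/(@cvgrPdist_le _ _ _ (nbhs x)) => /= e e0.
  near=> y; rewrite /Num.Def.normr/= mx_normrE (bigmax_le _ (ltW e0))//= => i _.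
  rewrite !mxE (ord1 i.1); move: (i.2); near: y; apply: filter_forall => /= j.
  exact: ((@cvgrPdist_le _ _ _ (nbhs x) _ _ _).1 (cu j x Ax) e e0).
- move=> [du Du] j; split=> [x Ax|v].
    by have /differentiable_rowP := du x Ax; exact.
  move/IH: (Du v) => /(_ j); apply: Ck_eq => // x Ax.
  by rewrite derive_row //; exact: du.
- move=> cu; have du x : A x -> differentiable u x.
    by move=> Ax; apply/differentiable_rowP => j; case: (cu j) => + _; exact.
  split=> // v; apply/IH => j; case: (cu j) => _ /(_ v).
  by apply: Ck_eq => // x Ax; rewrite derive_row //; exact: du.
Unshelve. all: by end_near. Qed.

End CkCalculus.

(** By the chain rule, a derivative of the composite is a combination of partial
   derivatives of w composed with u, to which the induction hypothesis applies. *)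
Lemma Ck_comp {R : realType} {n m : nat} k (A : set 'rV[R]_n.+1)
    (B : set 'rV[R]_m.+1) (u : 'rV[R]_n.+1 -> 'rV[R]_m.+1)
    (w : 'rV[R]_m.+1 -> R) :
  open A -> (forall x, A x -> B (u x)) ->
  Ck k A u -> Ck k B w -> Ck k A (w \o u).
Proof.
move=> oA uAB; elim: k w => [|k IH] w.
  move=> cu cw x Ax; apply: (continuous_comp (cu x Ax)).
  exact: cw (uAB x Ax).
move=> cu [dw Dw]; have [du Du] := cu; split=> [x Ax|v].
  by apply: differentiable_comp; [exact: du|apply: dw; exact: uAB].
have cs j : Ck k A (fun x => 'D_v u x 0 j * ('D_(delta_mx 0 j) w \o u) x).
  apply: CkM => //; first by move/(Ck_rowP _ _ oA): (Du v); exact.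
  by apply: IH (Ck_pred cu) (Dw _).
apply: Ck_eq (Ck_sum (index_enum _) oA cs) => // x Ax.
have dwu := dw _ (uAB x Ax).
by rewrite (derive_comp _ (du x Ax) dwu) (derive_sumvar _ dwu).
Qed.

Section SmoothCalculus.
Context {R : realType} {n : nat}.
Local Notation E := 'rV[R]_n.+1.
Context (A : set E).
Hypothesis oA : open A.

Lemma smooth_eq {V : normedModType R} (u w : E -> V) :
  (forall x, A x -> u x = w x) -> smooth A u -> smooth A w.
Proof. by move=> uw su k; exact: Ck_eq oA uw (su k). Qed.

Lemma smooth_sub {V : normedModType R} A' (u : E -> V) :
  A' `<=` A -> smooth A u -> smooth A' u.
Proof. by move=> AA su k; exact: Ck_sub AA (su k). Qed.

Lemma smooth_diff {V : normedModType R} (u : E -> V) x :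
  smooth A u -> A x -> differentiable u x.
Proof. by move=> su Ax; have [+ _] := su 1%N; exact. Qed.

Lemma smooth_cts {V : normedModType R} (u : E -> V) x :
  smooth A u -> A x -> {for x, continuous u}.
Proof. by move=> su; exact: (su 0%N). Qed.

Lemma smooth_D {V : normedModType R} (u : E -> V) v :
  smooth A u -> smooth A (fun x => 'D_v u x).
Proof. by move=> su k; have [_] := su k.+1; exact. Qed.

Lemma smooth_cst {V : normedModType R} (a : V) : smooth A (fun=> a).
Proof. by move=> k; exact: Ck_cst. Qed.

Lemma smoothD {V : normedModType R} (u w : E -> V) :
  smooth A u -> smooth A w -> smooth A (fun x => u x + w x).
Proof. by move=> su sw k; exact: CkD. Qed.

Lemma smooth_sum {V : normedModType R} (I : Type) (r : seq I) (u : I -> E -> V) :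
  (forall i, smooth A (u i)) -> smooth A (fun x => \sum_(i <- r) u i x).
Proof. by move=> su k; apply: Ck_sum => // i; exact: su. Qed.

Lemma smoothM (u w : E -> R) :
  smooth A u -> smooth A w -> smooth A (fun x => u x * w x).
Proof. by move=> su sw k; exact: CkM. Qed.

Lemma smoothX (u : E -> R) m : smooth A u -> smooth A (fun x => u x ^+ m).
Proof.
move=> su; elim: m => [|m IH]; first exact: smooth_cst.
by apply: smooth_eq (smoothM su IH) => x _; rewrite exprS.
Qed.

Lemma smoothV (u : E -> R) :
  (forall x, A x -> u x != 0) -> smooth A u -> smooth A (fun x => (u x)^-1).
Proof. by move=> u0 su k; exact: CkV. Qed.

Lemma smooth_sqrt (u : E -> R) :
  (forall x, A x -> 0 < u x) -> smooth A u -> smooth A (fun x => Num.sqrt (u x)).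
Proof. by move=> u0 su k; exact: Ck_sqrt. Qed.

Lemma smooth_rowP m (u : E -> 'rV[R]_m) :
  smooth A u <-> forall j, smooth A (fun x => u x 0 j).
Proof.
split=> [su j k|su k]; first exact: ((Ck_rowP k u oA).1 (su k) j).
by apply/(Ck_rowP k u oA) => j; exact: su.
Qed.

Lemma smoothZ m (a : E -> R) (u : E -> 'rV[R]_m) :
  smooth A a -> smooth A u -> smooth A (fun x => a x *: u x).
Proof.
move=> sa /smooth_rowP su; apply/smooth_rowP => j.
by apply: smooth_eq (smoothM sa (su j)) => x _; rewrite mxE.
Qed.

Lemma smoothN m (u : E -> 'rV[R]_m) :
  smooth A u -> smooth A (fun x => - u x).
Proof.
move=> su; have := smoothZ (smooth_cst (-1 : R)) su.
by apply: smooth_eq => x _; rewrite scaleN1r.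
Qed.

Lemma smoothB m (u w : E -> 'rV[R]_m) :
  smooth A u -> smooth A w -> smooth A (fun x => u x - w x).
Proof. by move=> su sw; apply: smoothD => //; exact: smoothN. Qed.

Lemma smooth_comp m (B : set 'rV[R]_m.+1) (u : E -> 'rV[R]_m.+1)
    (w : 'rV[R]_m.+1 -> R) :
  (forall x, A x -> B (u x)) -> smooth A u -> smooth B w -> smooth A (w \o u).
Proof. by move=> uAB su sw k; exact: Ck_comp uAB (su k) (sw k). Qed.

(** A function of one variable enters only through its derivative, so that an
   antiderivative composed with a smooth function is smooth as soon as its
   integrand is. *)
Lemma smooth_comp1 (S : R -> R) (u w : E -> R) : smooth A u -> smooth A w ->
  (forall x, A x -> is_derive (u x) 1 S (w x)) ->
  smooth A (S \o u) /\ forall x v, A x -> 'D_v (S \o u) x = 'D_v u x * w x.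
Proof.
move=> su sw dS.
have dS' x : A x -> differentiable S (u x) /\
    forall r, 'D_r S (u x) = r * w x.
  move=> Ax; have hd := dS x Ax.
  have d1 : differentiable S (u x) by apply/derivable1_diffP.
  split => // r; have <- : 'D_1 S (u x) = w x by exact: derive_val.
  by rewrite -[in LHS](mulr1 r) deriveZvar.
have dE x v : A x -> 'D_v (S \o u) x = 'D_v u x * w x.
  move=> Ax; have [d1 d2] := dS' x Ax.
  by rewrite (derive_comp _ (smooth_diff su Ax) d1) d2.
split=> // k; case: k => [|k].
  move=> x Ax; have [d1 _] := dS' x Ax.
  by apply: continuous_comp; [exact: smooth_cts|exact: differentiable_continuous].
split=> [x Ax|v].
  by apply: differentiable_comp; [exact: smooth_diff|case: (dS' x Ax)].
apply: (Ck_eq oA) (smoothM (smooth_D v su) sw k) => x Ax.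
by rewrite dE.
Qed.

End SmoothCalculus.

Lemma smooth_comp_row {R : realType} {n m p : nat} (A : set 'rV[R]_n.+1)
    (B : set 'rV[R]_m.+1) (u : 'rV[R]_n.+1 -> 'rV[R]_m.+1)
    (w : 'rV[R]_m.+1 -> 'rV[R]_p) : open A -> open B ->
  (forall x, A x -> B (u x)) -> smooth A u -> smooth B w -> smooth A (w \o u).
Proof.
move=> oA oB uAB su /(smooth_rowP oB) sw; apply/(smooth_rowP oA) => j.
exact: (smooth_comp oA uAB su (sw j)).
Qed.

Lemma cts_dist {R : realType} {T : topologicalType} {V : normedModType R}
    (f : T -> V) x e : {for x, continuous f} -> 0 < e ->
  \forall y \near x, `|f x - f y| <= e.
Proof. by move=> cf e0; exact: ((@cvgrPdist_le _ _ _ (nbhs x) _ _ _).1 cf). Qed.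

(** * Mean values and the symmetry of second derivatives *)

Section MeanValue.
Context {R : realType} {n : nat}.
Local Notation E := 'rV[R]_n.+1.
Implicit Types (u : E -> R) (x v w : E).

Lemma is_derive_line u x v t : differentiable u (x + t *: v) ->
  is_derive t 1 (fun r => u (x + r *: v)) ('D_v u (x + t *: v)).
Proof.
move=> du.
have dl : differentiable (fun r : R => x + r *: v) t by [].
have dul : differentiable (u \o (fun r : R => x + r *: v)) t.
  exact: differentiable_comp.
have Dl : 'D_1 (fun r : R => x + r *: v) t = v.
  have dz : differentiable (fun r : R => r *: v) t by [].
  have dc : differentiable (cst x) t by [].
  rewrite (_ : (fun r => _) = cst x + (fun r : R => r *: v)) //.
  rewrite (deriveD (diff_derivable dc) (diff_derivable dz)) derive_cst add0r.
  rewrite (deriveE _ dz).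
  have -> : 'd (fun r : R => r *: v) t = *:%R^~ v :> (R -> E) by exact: diff_val.
  by rewrite scale1r.
split; first exact: diff_derivable.
by rewrite -[LHS]/('D_1 (u \o (fun r : R => x + r *: v)) t) (derive_comp _ dl du) Dl.
Qed.

Lemma MVT_line u x v :
  (forall t, 0 <= t <= 1 -> differentiable u (x + t *: v)) ->
  exists2 t, 0 <= t <= 1 & u (x + v) - u x = 'D_v u (x + t *: v).
Proof.
move=> du.
have [||t] := @MVT_segment R (fun r => u (x + r *: v))
    (fun r => 'D_v u (x + r *: v)) 0 1 ler01.
- move=> t /[!in_itv]/= /andP[t0 t1]; apply: is_derive_line; apply: du.
  by rewrite !ltW.
- apply: derivable_within_continuous => t /[!in_itv]/= t01.
  by have [] := is_derive_line (du t t01).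
rewrite in_itv /= scale1r scale0r addr0 subr0 mulr1 => t01 ->.
by exists t.
Qed.

(** The mean value theorem, applied to y |-> u (y + w) - u y along v and then to the
   derivative of u along v, along w. *)
Lemma second_difference u x v w (A : set E) : smooth A u ->
  (forall s t, 0 <= s <= 1 -> 0 <= t <= 1 -> A (x + s *: v + t *: w)) ->
  exists s t, [/\ 0 <= s <= 1, 0 <= t <= 1 &
    u (x + v + w) - u (x + v) - (u (x + w) - u x)
      = 'D_w (fun y => 'D_v u y) (x + s *: v + t *: w)].
Proof.
move=> su Axy.
have du s t : 0 <= s <= 1 -> 0 <= t <= 1 ->
    differentiable u (x + s *: v + t *: w).
  by move=> s01 t01; apply: smooth_diff su _; exact: Axy.
have h0 : 0 <= (0 : R) <= 1 by rewrite lexx ler01.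
have h1 : 0 <= (1 : R) <= 1 by rewrite lexx ler01.
pose g y := u (y + w) - u y.
have ds t : differentiable (fun y : E => y + w) t by [].
have dus s : 0 <= s <= 1 -> differentiable (u \o (fun y => y + w)) (x + s *: v).
  move=> s01; apply: differentiable_comp => //.
  by have := du s 1 s01 h1; rewrite scale1r.
have dus0 s : 0 <= s <= 1 -> differentiable u (x + s *: v).
  by move=> s01; have := du s 0 s01 h0; rewrite scale0r addr0.
have [|s s01 gE] := @MVT_line g x v.
  move=> s s01; apply: differentiableB; [exact: dus|exact: dus0].
have [|t t01 DE] := @MVT_line (fun y => 'D_v u y) (x + s *: v) w.
  by move=> t t01; apply: smooth_diff (smooth_D v su) _; exact: Axy.
exists s, t; split => //; rewrite -DE -[LHS]/(g (x + v) - g x) gE.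
rewrite deriveB; [|exact/diff_derivable/dus|exact/diff_derivable/dus0].
congr (_ - _); rewrite -[LHS]/('D_v (u \o (fun y => y + w)) (x + s *: v)).
have du1 : differentiable u (x + s *: v + w).
  by have := du s 1 s01 h1; rewrite scale1r.
rewrite (derive_comp _ (ds _) du1).
by rewrite deriveD // derive_id derive_cst addr0.
Qed.

(** Both iterated derivatives are limits of the same second difference
   quotient. *)
Lemma derive_swap u (A : set E) x v w : open A -> smooth A u -> A x ->
  'D_v (fun y => 'D_w u y) x = 'D_w (fun y => 'D_v u y) x.
Proof.
move=> oA su Ax.
apply/eqP; rewrite -subr_eq0 -normr_eq0; apply/eqP.
apply/le_anti; rewrite normr_ge0 andbT; apply/ler_addgt0Pr => e e0; rewrite add0r.
have sp : smooth A (fun y => 'D_v (fun y => 'D_w u y) y).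
  by do 2!apply: smooth_D.
have sq : smooth A (fun y => 'D_w (fun y => 'D_v u y) y).
  by do 2!apply: smooth_D.
have e20 : 0 < e / 2 by rewrite divr_gt0.
have np := cts_dist (smooth_cts sp Ax) e20.
have nq := cts_dist (smooth_cts sq Ax) e20.
have nA : nbhs x A by exact: open_nbhs_nbhs.
have [d /= d0 dP] := (nbhs_ballP _ _).1 (filterI nA (filterI np nq)).
pose c := d / (`|v| + `|w| + 1).
have N0 : 0 < `|v| + `|w| + 1 by rewrite ltr_wpDl // addr_ge0.
have c0 : 0 < c / 2 by rewrite !divr_gt0.
set h := c / 2 in c0.
have hE : d = 2 * h * (`|v| + `|w| + 1) by rewrite /h /c; field; rewrite gt_eqF.
clearbody h.
have inB s t : 0 <= s <= 1 -> 0 <= t <= 1 ->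
    ball x d (x + s *: (h *: v) + t *: (h *: w)).
  move=> /andP[s0 s1] /andP[t0 t1]; rewrite -ball_normE /= -addrA opprD addNKr normrN.
  apply: (le_lt_trans (ler_normD _ _)).
  rewrite !scalerA !normrZ (gtr0_norm c0) (ger0_norm s0) (ger0_norm t0).
  apply: (@le_lt_trans _ _ (h * (`|v| + `|w|))).
    by rewrite mulrDr lerD // ler_wpM2r // ler_piMl // ltW.
  rewrite hE -mulrA mulrCA ltr_pM2l // mulrDr mulr1.
  by have := normr_ge0 v; have := normr_ge0 w; lra.
have AB s t (s01 : 0 <= s <= 1) (t01 : 0 <= t <= 1) := (dP _ (inB s t s01 t01)).1.
have [s [t [s01 t01 E1]]] := second_difference su AB.
have inB' s' t' : 0 <= s' <= 1 -> 0 <= t' <= 1 ->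
    ball x d (x + s' *: (h *: w) + t' *: (h *: v)).
  by move=> s0 t0; rewrite addrAC; exact: inB.
have AB' s' t' (s0 : 0 <= s' <= 1) (t0 : 0 <= t' <= 1) := (dP _ (inB' s' t' s0 t0)).1.
have [s' [t' [s01' t01' E2]]] := second_difference su AB'.
have Dhh y a b : A y -> 'D_(h *: a) (fun y => 'D_(h *: b) u y) y =
    h * (h * 'D_a (fun y => 'D_b u y) y).
  move=> Ay; rewrite (@near_eq_derive _ _ _ _ (fun y => h *: 'D_b u y)).
    rewrite deriveZvar; last first.
      by apply: differentiableZ; apply: smooth_diff (smooth_D b su) Ay.
    rewrite deriveZ //; apply: diff_derivable.
    exact: smooth_diff (smooth_D b su) Ay.
  apply: open_near_eq oA _ Ay => z Az; rewrite deriveZvar //.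
  exact: smooth_diff su Az.
rewrite Dhh in E1; last exact: AB.
rewrite Dhh in E2; last exact: AB'.
have := (dP _ (inB s t s01 t01)).2.2; have := (dP _ (inB' s' t' s01' t01')).2.1.
rewrite /= => P1 P2.
have hn0 : h != 0 by rewrite gt_eqF.
have PQ : 'D_v (fun y => 'D_w u y) (x + s' *: (h *: w) + t' *: (h *: v)) =
  'D_w (fun y => 'D_v u y) (x + s *: (h *: v) + t *: (h *: w)).
  have sym (a b a1 b1 : R) : a - b - (a1 - b1) = a - a1 - (b - b1) by ring.
  rewrite (addrAC x) sym in E2; have := etrans (esym E2) E1.
  by move/(mulfI hn0)/(mulfI hn0).
move: P1; rewrite PQ => P1.
move: P1 P2; move: ('D_w (fun y => 'D_v u y) (x + s *: (h *: v) + t *: (h *: w))).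
move=> r P1 P2; apply: le_trans (ler_distD r _ _) _.
by rewrite (splitr e); apply: lerD; [exact: P1|rewrite distrC; exact: P2].
Qed.

End MeanValue.

(** * The inverse function theorem *)

Section RowNorm.
Context {R : realType}.

Lemma row_norm_le n (v : 'rV[R]_n) e :
  0 <= e -> (`|v| <= e) <-> forall j, `|v 0 j| <= e.
Proof.
move=> e0; rewrite /Num.Def.normr/= mx_normrE; split=> [ve j|ve].
  apply: le_trans ve; exact: (le_bigmax _ (fun i => `|v i.1 i.2|) (ord0, j)).
by apply: bigmax_le => [|[i j] _] //=; rewrite (ord1 i); exact: ve.
Qed.

Lemma norm_coord n (v : 'rV[R]_n) j : `|v 0 j| <= `|v|.
Proof. by have [+ _] := row_norm_le v (normr_ge0 v); exact. Qed.

Lemma norm_mulmx_le n m (M : 'M[R]_(n, m)) :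
  exists2 C, 0 < C & forall v : 'rV[R]_n, `|v *m M| <= C * `|v|.
Proof.
pose C : R := \sum_i \sum_j `|M i j|.
have C0 : 0 <= C by apply: sumr_ge0 => i _; exact: sumr_ge0.
exists (C + 1); first by rewrite ltr_wpDl.
move=> v; apply: (@le_trans _ _ (C * `|v|)); last first.
  by rewrite ler_wpM2r // lerDl.
apply/row_norm_le; first by rewrite mulr_ge0.
move=> j; rewrite mxE (le_trans (ler_norm_sum _ _ _)) // mulr_suml.
apply: ler_sum => i _; rewrite normrM mulrC; apply: ler_pM => //.
  by rewrite (bigD1 j) //= lerDl sumr_ge0.
exact: norm_coord.
Qed.

Lemma mulmxr_continuous n m (M : 'M[R]_(n, m)) :
  continuous (mulmxr M : 'rV[R]_n -> 'rV[R]_m).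
Proof.
have [C C0 MC] := norm_mulmx_le M.
move=> x; apply/(@cvgrPdist_le _ _ _ (nbhs x)) => /= e e0.
have /nbhs_ballP : nbhs_ball x (ball x (e / C)).
  by exists (e / C) => //=; rewrite divr_gt0.
apply: filterS => y; rewrite -ball_normE /= => xy.
rewrite -mulmxBl (le_trans (MC _)) // mulrC -ler_pdivlMr //; exact: ltW.
Qed.

Lemma jacobianE n m (f : 'rV[R]_n -> 'rV[R]_m) x i j :
  differentiable f x -> 'J f x i j = 'D_(delta_mx 0 i) (fun y => f y 0 j) x.
Proof.
move=> df; rewrite -derive_row // deriveEjacobian //.
by rewrite -rowE [RHS]mxE.
Qed.

End RowNorm.

Lemma differentiable_near {R : realType} {V W : normedModType R} (f : V -> W) x e :
  differentiable f x -> 0 < e ->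
  \forall h \near 0, `|f (h + x) - f x - 'D_h f x| <= e * `|h|.
Proof.
move=> df e0; have := diff_locally df => /eqaddoP/(_ e e0).
apply: filterS => h /=; rewrite !fctE /= opprD addrA.
by rewrite deriveE.
Qed.

Section SmoothMatrix.
Context {R : realType} {n : nat} (A : set 'rV[R]_n.+1).
Hypothesis oA : open A.

Lemma smooth_prod (I : Type) (r : seq I) (u : I -> 'rV[R]_n.+1 -> R) :
  (forall i, smooth A (u i)) -> smooth A (fun x => \prod_(i <- r) u i x).
Proof.
move=> su; elim: r => [|i r IH].
  by apply: (smooth_eq oA) (smooth_cst A (1 : R)) => x _; rewrite big_nil.
by apply: (smooth_eq oA) (smoothM oA (su i) IH) => x _; rewrite big_cons.
Qed.

Lemma smooth_det m (M : 'rV[R]_n.+1 -> 'M[R]_m) :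
  (forall i j, smooth A (fun x => M x i j)) -> smooth A (fun x => \det (M x)).
Proof.
move=> sM; apply: smooth_sum => // s; apply: smoothM => //.
  exact: smooth_cst.
by apply: smooth_prod => i; exact: sM.
Qed.

(** By the formula of Cramer the entries are rational in those of M. *)
Lemma smooth_invmx m (M : 'rV[R]_n.+1 -> 'M[R]_m) :
  (forall x, A x -> M x \in unitmx) ->
  (forall i j, smooth A (fun x => M x i j)) ->
  forall i j, smooth A (fun x => invmx (M x) i j).
Proof.
move=> Mu sM i j.
have d0 x : A x -> \det (M x) != 0 by move=> /Mu; rewrite unitmxE unitfE.
have sadj : smooth A (fun x => cofactor (M x) j i).
  apply: smoothM => //; first exact: smooth_cst.
  apply: smooth_det => i' j'.
  by apply: (smooth_eq oA) (sM (lift j i') (lift i j')) => x _; rewrite !mxE.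
apply: (smooth_eq oA) (smoothM oA (smoothV oA d0 (smooth_det sM)) sadj) => x Ax.
by rewrite /invmx Mu // !mxE.
Qed.

End SmoothMatrix.

Section InverseFunction.
Context {R : realType} {n : nat}.
Local Notation E := 'rV[R]_n.+1.
Context (Phi : E -> E) (A : set E).
Hypotheses (oA : open A) (sPhi : smooth A Phi).

Let dPhi x : A x -> differentiable Phi x.
Proof. exact: smooth_diff sPhi. Qed.

Lemma smooth_jacobian i j : smooth A (fun x => 'J Phi x i j).
Proof.
have /(smooth_rowP oA)/(_ j) sj := sPhi.
apply: (smooth_eq oA) (smooth_D (delta_mx 0 i) sj) => x Ax.
by rewrite jacobianE //; exact: dPhi.
Qed.

(** Composed with the inverse of its differential at x0, Phi differs from the
   identity by a map with a small Lipschitz constant. *)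
Lemma expanding x0 : A x0 -> 'J Phi x0 \in unitmx ->
  exists k r, [/\ 0 < k, 0 < r, (forall x, `|x - x0| <= r -> A x) &
    forall x y, `|x - x0| <= r -> `|y - x0| <= r ->
      k * `|y - x| <= `|Phi y - Phi x|].
Proof.
move=> Ax0 J0u; set M := invmx ('J Phi x0).
have [C C0 MC] := norm_mulmx_le M.
have [K KE] : exists K, forall x, K x = 'J Phi x *m M - 1%:M.
  by exists (fun x => 'J Phi x *m M - 1%:M).
(* A matrix of n + 1 rows with entries at most d makes the
   maximum norm at most half as large. *)
pose d : R := (2 * n.+1%:R)^-1.
have d0 : 0 < d by rewrite invr_gt0 mulr_gt0 // ltr0n.
have sK i j : smooth A (fun x => K x i j).
  have s1 : smooth A (fun x => \sum_k 'J Phi x i k * M k j + - (1%:M : 'M[R]_n.+1) i j).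
    apply: smoothD => //; last exact: smooth_cst.
    apply: smooth_sum => // k; apply: smoothM => //; last exact: smooth_cst.
    exact: smooth_jacobian.
  by apply: (smooth_eq oA _ s1) => x Ax; rewrite KE !mxE.
have K0 i j : K x0 i j = 0 by rewrite KE mulmxV // subrr mxE.
have nK1 (p : 'I_n.+1 * 'I_n.+1) : \forall x \near x0, `|K x p.1 p.2| <= d.
  have := cts_dist (smooth_cts (sK p.1 p.2) Ax0) d0; apply: filterS => x.
  by rewrite K0 sub0r normrN.
have nK : nbhs x0 (fun x => forall p : 'I_n.+1 * 'I_n.+1, `|K x p.1 p.2| <= d).
  exact: (@filter_forall E _
    (fun (p : 'I_n.+1 * 'I_n.+1) x => `|K x p.1 p.2| <= d) (nbhs x0) _ nK1).
have nA : nbhs x0 A by exact: open_nbhs_nbhs.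
have [r0 /= r00 rP] := (nbhs_ballP _ _).1 (filterI nA nK).
pose r := r0 / 2.
have r_gt0 : 0 < r by rewrite divr_gt0.
have inb x : `|x - x0| <= r -> ball x0 r0 x.
  move=> xr; rewrite -ball_normE /= distrC (le_lt_trans xr) //.
  by rewrite /r ltr_pdivrMr // ltr_pMr // ltr1n.
have rA x : `|x - x0| <= r -> A x by move=> /inb/rP[].
exists (2 * C)^-1, r; split => // [|x y xr yr].
  by rewrite invr_gt0 mulr_gt0.
pose v := y - x.
have seg t : 0 <= t <= 1 -> `|x + t *: v - x0| <= r.
  move=> /andP[t0 t1].
  have -> : x + t *: v - x0 = (1 - t) *: (x - x0) + t *: (y - x0).
    rewrite /v scalerBl scale1r !scalerBr !opprB !addrA.
    apply/rowP => i; rewrite !mxE; ring.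
  apply: (le_trans (ler_normD _ _)); rewrite !normrZ !ger0_norm ?subr_ge0 //.
  have -> : r = (1 - t) * r + t * r by ring.
  by rewrite lerD // ler_wpM2l // subr_ge0.
have small j : `|((Phi y - Phi x) *m M - v) 0 j| <= `|v| / 2.
  pose psi z := (Phi z *m M - z) 0 j.
  have dpsi z : A z -> differentiable (fun z => Phi z *m M - z) z.
    move=> Az; apply: differentiableB => //.
    have dM : differentiable (mulmxr M) (Phi z).
      by apply: linear_differentiable; exact: mulmxr_continuous.
    exact: (differentiable_comp (dPhi Az) dM).
  have Dpsi z w : A z -> 'D_w psi z = (w *m K z) 0 j.
    move=> Az; rewrite -(derive_row w j (dpsi z Az)).
    have dM : differentiable (mulmxr M) (Phi z).
      by apply: linear_differentiable; exact: mulmxr_continuous.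
    have dc : differentiable (mulmxr M \o Phi) z.
      exact: (differentiable_comp (dPhi Az) dM).
    rewrite (_ : (fun z => _) = (mulmxr M \o Phi) - id) //.
    rewrite deriveB; [|exact: diff_derivable|exact: diff_derivable].
    rewrite derive_id (derive_comp _ (dPhi Az) dM) (deriveE _ dM).
    rewrite diff_lin; last exact: mulmxr_continuous.
    rewrite deriveEjacobian; last exact: dPhi.
    by rewrite KE mulmxBr mulmx1 mulmxA.
  have [|t t01 Et] := @MVT_line R n psi x v.
    move=> t t01; have At := rA _ (seg t t01).
    by have /differentiable_rowP := dpsi _ At; exact.
  have -> : ((Phi y - Phi x) *m M - v) 0 j = psi (x + v) - psi x.
    rewrite /psi (_ : x + v = y); last by rewrite /v addrC subrK.
    by rewrite /v mulmxBl; do ![rewrite mxE]; ring.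
  rewrite Et Dpsi; last exact: rA (seg t t01).
  have [_ Kd] := rP _ (inb _ (seg t t01)).
  rewrite mxE (le_trans (ler_norm_sum _ _ _)) //.
  have {}Kd i : `|K (x + t *: v) i j| <= d by exact: (Kd (i, j)).
  have -> : `|v| / 2 = \sum_(i < n.+1) `|v| * d.
    rewrite sumr_const card_ord -[RHS]mulr_natr -[RHS]mulrA /d; congr (_ * _).
    by rewrite invfM mulfVK // pnatr_eq0.
  apply: ler_sum => i _; rewrite normrM; apply: ler_pM => //.
  exact: norm_coord.
have {small} small : `|(Phi y - Phi x) *m M - v| <= `|v| / 2.
  by apply/row_norm_le => //; rewrite divr_ge0.
have {}MC := MC (Phi y - Phi x).
have tri := ler_normB ((Phi y - Phi x) *m M) ((Phi y - Phi x) *m M - v).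
rewrite subKr in tri.
rewrite -/v mulrC ler_pdivrMr ?mulr_gt0 // mulrC.
have : `|v| <= C * `|Phi y - Phi x| + `|v| / 2.
  exact: le_trans tri (lerD MC small).
lra.
Qed.

(** The point of the closed ball whose value is nearest to y, in the Euclidean
   distance, is interior, so that the differential of the squared distance vanishes
   there. The factor n.+3 makes up for the two norms: the squared distance is at most
   (n + 1) r'^2 at the center and at least ((n + 2) r')^2 on the sphere, for
   r' = k r / (n + 3). *)
Lemma local_surjection (x0 : E) (k r : R) (y : E) : 0 < k -> 0 < r ->
  (forall x, `|x - x0| <= r -> A x) ->
  (forall x, A x -> 'J Phi x \in unitmx) ->
  (forall x, `|x - x0| <= r -> k * `|x - x0| <= `|Phi x - Phi x0|) ->
  `|y - Phi x0| < k * r / n.+3%:R ->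
  exists2 x, `|x - x0| < r & Phi x = y.
Proof.
move=> k0 r0 rA Ju lip ysmall.
pose g x := \sum_i (Phi x 0 i - y 0 i) ^+ 2.
have sg : smooth A g.
  apply: smooth_sum => // i; apply: smoothX => //.
  apply: smoothD => //; first by have /(smooth_rowP oA) := sPhi; exact.
  exact: smooth_cst.
have KE : closed_ball x0 r = [set x | `|x - x0| <= r].
  by rewrite closed_ballE //; apply/funext => x; rewrite /closed_ball_ /= distrC.
have cK : compact (closed_ball x0 r).
  apply: bounded_closed_compact; last exact: closed_ball_closed.
  exists (`|x0| + r); split; first exact: num_real.
  move=> M Mlt x; rewrite KE /= => xr; apply: le_trans (ltW Mlt).
  by rewrite -[x](subrK x0) addrC (le_trans (ler_normD _ _)) // lerD.
have [||c] := EVT_min_rV _ cK (f := g).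
- by exists x0; rewrite KE /= subrr normr0 ltW.
- apply: continuous_in_subspaceT => x; rewrite inE KE /= => /rA Ax.
  exact: smooth_cts sg Ax.
rewrite inE KE /= => cr cmin.
have {}cmin x : `|x - x0| <= r -> g c <= g x.
  by move=> xr; apply: cmin; rewrite inE.
have r1 : 0 < k * r / n.+3%:R by rewrite divr_gt0 ?mulr_gt0 ?ltr0n.
set r' := k * r / n.+3%:R in ysmall r1.
have r'E : k * r = r' * (n%:R + 3).
  by rewrite -natrD addn3 /r' mulfVK // pnatr_eq0.
have cin : `|c - x0| < r.
  rewrite ltNge; apply/negP => rc.
  have g0 : g x0 <= n.+1%:R * r' ^+ 2.
    have -> : n.+1%:R * r' ^+ 2 = \sum_(i < n.+1) r' ^+ 2.
      by rewrite sumr_const card_ord mulr_natl.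
    rewrite /g; apply: ler_sum => i _.
    rewrite -real_normK ?num_real // lerXn2r ?nnegrE ?(ltW r1) //.
    have := norm_coord (Phi x0 - y) i; rewrite !mxE => /le_trans; apply.
    by rewrite distrC ltW.
  have gc : `|Phi c - y| ^+ 2 <= g c.
    have g_ge0 : 0 <= g c by apply: sumr_ge0 => i _; exact: sqr_ge0.
    rewrite -(sqr_sqrtr g_ge0) lerXn2r ?nnegrE ?sqrtr_ge0 //.
    apply/row_norm_le; first exact: sqrtr_ge0.
    move=> j; rewrite !mxE -sqrtr_sqr ler_sqrt // /g (bigD1 j) //= lerDl.
    by apply: sumr_ge0 => i _; exact: sqr_ge0.
  have h1 : k * r <= `|Phi c - Phi x0|.
    by apply: le_trans (lip _ cr); rewrite ler_pM2l.
  have h2 : `|Phi c - Phi x0| <= `|Phi c - y| + `|y - Phi x0|.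
    exact: ler_distD.
  have h3 : r' * (n%:R + 2) <= `|Phi c - y|.
    rewrite r'E in h1; lra.
  have h4 : (r' * (n%:R + 2)) ^+ 2 <= n.+1%:R * r' ^+ 2.
    apply: le_trans (le_trans gc (le_trans (cmin x0 _) g0)).
      by rewrite lerXn2r ?nnegrE // mulr_ge0 ?addr_ge0 // ltW.
    by rewrite subrr normr0 ltW.
  have n0 : 0 <= n%:R :> R by rewrite ler0n.
  have nS : n.+1%:R = n%:R + 1 :> R by rewrite natr1.
  rewrite nS in h4.
  have r2 : 0 < r' ^+ 2 by rewrite exprn_gt0.
  have : (n%:R + 2) ^+ 2 * r' ^+ 2 <= (n%:R + 1) * r' ^+ 2.
    by rewrite -exprMn (mulrC _ r').
  rewrite ler_pM2r //; nra.
exists c => //.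
have Ac : A c by exact: rA.
have crit v : 'D_v g c = 0.
  have nb : \forall t \near (0 : R), `|c + t *: v - x0| < r.
    have ct : {for (0 : R), continuous (fun t : R => c + t *: v - x0)}.
      apply: differentiable_continuous; apply: differentiableB => //.
    have := @cts_dist R R E _ 0 ((r - `|c - x0|) / 2) ct.
    rewrite divr_gt0 ?subr_gt0 // => /(_ isT).
    apply: filterS => t; rewrite scale0r addr0 => ht.
    have := ler_distD (c - x0) (c + t *: v - x0) 0.
    rewrite !subr0 distrC; lra.
  have [d /= d0 dP] := (nbhs_ballP _ _).1 nb.
  have tb t : t \in `](- d), d[ -> `|c + t *: v - x0| < r.
    rewrite in_itv /= => /andP[t1 t2]; apply: dP.
    by rewrite -ball_normE /= sub0r normrN ltr_norml t1.
  have dg t : t \in `](- d), d[ ->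
      is_derive t 1 (fun s => g (c + s *: v)) ('D_v g (c + t *: v)).
    move=> td; apply: is_derive_line; apply: smooth_diff sg _.
    by apply: rA; apply: ltW; exact: tb.
  have d00 : (0 : R) \in `](- d), d[ by rewrite in_itv /= oppr_lt0 d0.
  have [|||_ D0] := @derive1_at_min R (fun s => g (c + s *: v)) (- d) d 0 _ _ d00.
  - by rewrite ltW // (@lt_trans _ _ 0) // oppr_lt0.
  - by move=> t td; have [] := dg t td.
  - move=> t td; rewrite scale0r addr0; apply: cmin; apply: ltW; exact: tb.
  have [_] := dg 0 d00; rewrite D0 scale0r addr0 => <- //.
pose w := Phi c - y.
have {}crit (v : E) : \sum_i w 0 i * (v *m 'J Phi c) 0 i = 0.
  have dP i : differentiable (fun x => Phi x 0 i) c.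
    by have /differentiable_rowP := dPhi Ac; exact.
  have dPy i : differentiable (fun x => Phi x 0 i - y 0 i) c.
    by apply: differentiableB.
  have : 'D_v g c = \sum_i 2 * (w 0 i * (v *m 'J Phi c) 0 i).
    rewrite (_ : g = \sum_(i < n.+1) (fun x => Phi x 0 i - y 0 i) ^+ 2); last first.
      by apply/funext => x; rewrite fct_sumE.
    rewrite derive_sum; last first.
      by move=> i; apply: derivableX; exact: diff_derivable.
    apply: eq_bigr => i _; rewrite deriveX; last exact: diff_derivable.
    rewrite deriveB; [|exact: diff_derivable|exact: derivable_cst].
    rewrite derive_cst subr0 -deriveEjacobian; last exact: dPhi.
    rewrite (derive_row _ _ (dPhi Ac)) expr1 /w !mxE /= -mulr_natl mulrA.
    by [].
  rewrite crit -mulr_sumr => /esym/eqP; rewrite mulf_eq0 pnatr_eq0 /=.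
  by move/eqP.
have := crit (w *m invmx ('J Phi c)); rewrite mulmxKV ?Ju // => w0.
apply/eqP; rewrite -subr_eq0 -/w; apply/eqP/rowP => i; rewrite [RHS]mxE.
apply/eqP; rewrite -sqrf_eq0 expr2; apply/eqP.
have /psumr_eq0P := w0; apply => // j _; by rewrite -expr2 sqr_ge0.
Qed.

(** Phi is injective near x0, and onto a ball; its inverse is Lipschitz, hence
   differentiable with the inverse Jacobian, and this formula for the derivative makes
   the inverse C^(k+1) as soon as it is C^k. *)
Lemma inverse_function x0 : A x0 -> (forall x, A x -> 'J Phi x \in unitmx) ->
  exists D r G, let B := ball (Phi x0) r in
  [/\ [/\ open D, D x0, D `<=` A & 0 < r],
      forall x, D x -> B (Phi x) /\ G (Phi x) = x,
      forall y, B y -> D (G y) /\ Phi (G y) = y & smooth B G].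
Proof.
move=> Ax0 Ju.
have [k [r [k0 r0 rA lip]]] := expanding Ax0 (Ju _ Ax0).
have lip0 x : `|x - x0| <= r -> k * `|x - x0| <= `|Phi x - Phi x0|.
  by move=> xr; apply: lip => //; rewrite subrr normr0 ltW.
pose r' := k * r / n.+3%:R.
have r'0 : 0 < r' by rewrite divr_gt0 ?mulr_gt0 ?ltr0n.
pose B := ball (Phi x0) r'.
pose D := ball x0 r `&` Phi @^-1` B.
have rD x : D x -> `|x - x0| <= r.
  by move=> [+ _]; rewrite -ball_normE /= distrC => /ltW.
have DA x : D x -> A x by move=> /rD/rA.
pose G y := xget x0 [set x | D x /\ Phi x = y].
have GP y : B y -> D (G y) /\ Phi (G y) = y.
  move=> By; apply: (@xgetPex _ x0 [set x | D x /\ Phi x = y]).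
  have [|x xr xy] := @local_surjection x0 k r y k0 r0 rA Ju lip0.
    by have := By; rewrite /B -ball_normE /= distrC.
  exists x; split => //; split; last by rewrite /= xy.
  by rewrite -ball_normE /= distrC.
have inj x x' : D x -> D x' -> Phi x = Phi x' -> x = x'.
  move=> /rD Dx /rD Dx' E1; have := lip _ _ Dx Dx'.
  rewrite E1 subrr normr0 pmulr_rle0 // normr_le0 subr_eq0.
  by move/eqP.
have oB : open B by exact: ball_open.
have oD : open D.
  rewrite openE => x [xr Bx]; rewrite /interior; apply: filterI.
    by apply: open_nbhs_nbhs; split => //; exact: ball_open.
  apply: (smooth_cts sPhi (rA _ _)).
    by move: xr; rewrite -ball_normE /= distrC => /ltW.
  exact: open_nbhs_nbhs.
have lipG y y' : B y -> B y' -> `|G y' - G y| <= k^-1 * `|y' - y|.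
  move=> /GP[Dy Ey] /GP[Dy' Ey']; rewrite ler_pdivlMl //.
  by have := lip _ _ (rD _ Dy) (rD _ Dy'); rewrite Ey Ey'.
pose Ji y := invmx ('J Phi (G y)).
have dG y : B y -> differentiable G y /\ forall v, 'D_v G y = v *m Ji y.
  move=> By; have [Dy Ey] := GP _ By; have Ay := DA _ Dy.
  have [C C0 MC] := norm_mulmx_le (Ji y).
  apply: (@differentiable_lim R E E G (mulmxr (Ji y))).
    exact: mulmxr_continuous.
  move=> e e0 /=; have e'0 : 0 < e * k / C by rewrite divr_gt0 // mulr_gt0.
  have [d /= d0 dP] := (nbhs_ballP _ _).1 (differentiable_near (dPhi Ay) e'0).
  have nB : \forall h \near (0 : E), B (h + y).
    have [a /= a0 aP] := (nbhs_ballP _ _).1 (open_nbhs_nbhs (conj oB By)).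
    apply: filterS (nbhsx_ballx (0 : E) a a0) => h ha; apply: aP.
    by move: ha; rewrite -!ball_normE /= sub0r normrN opprD addrCA subrr addr0 normrN.
  have nd : \forall h \near (0 : E), ball 0 (k * d) h.
    by apply: nbhsx_ballx; rewrite mulr_gt0.
  apply: filterS2 nB nd => h Bh hd.
  set dl := G (h + y) - G y.
  have dlh : `|dl| <= k^-1 * `|h| by have := lipG _ _ By Bh; rewrite addrK.
  have dld : ball 0 d dl.
    rewrite -ball_normE /= sub0r normrN (le_lt_trans dlh) // mulrC ltr_pdivrMr //.
    by move: hd; rewrite -ball_normE /= sub0r normrN mulrC.
  have := dP _ dld; rewrite /dl subrK (GP _ Bh).2 Ey addrK -/dl.
  rewrite deriveEjacobian; last exact: dPhi.
  move=> hE.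
  have -> : dl - h *m Ji y = (- (h - dl *m 'J Phi (G y))) *m Ji y.
    by rewrite opprB mulmxBl mulmxK // Ju.
  apply: le_trans (MC _) _; rewrite normrN.
  apply: (@le_trans _ _ (C * (e * k / C * (k^-1 * `|h|)))).
    rewrite ler_pM2l // (le_trans hE) // ler_pM2l //.
  rewrite le_eqVlt; apply/orP; left; apply/eqP; field.
  by rewrite !gt_eqF.
have sJi i j : smooth A (fun x => invmx ('J Phi x) i j).
  apply: smooth_invmx => // i' j'; exact: smooth_jacobian.
exists D, r', G; split => //.
- split => //; split; [exact: ballxx|exact: ballxx].
- move=> x Dx; have Bx : B (Phi x) by case: Dx.
  split => //; have [DG EG] := GP _ Bx; exact: inj.
- elim=> [|m IH].
    by move=> y By; apply: differentiable_continuous; case: (dG y By).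
  split=> [y By|v]; first by case: (dG y By).
  apply/(Ck_rowP _ _ oB) => j.
  have cs i : Ck m B (fun y => v 0 i * ((fun x => invmx ('J Phi x) i j) \o G) y).
    apply: CkM => //; first exact: Ck_cst.
    apply: (Ck_comp (B := A)) => //; last exact: sJi.
    by move=> y /GP[/DA].
  apply: (Ck_eq oB) (Ck_sum (index_enum _) oB cs) => y By.
  by have [_ ->] := dG y By; rewrite mxE.
Qed.

End InverseFunction.

(** * The product of the ambient linear space *)

Section DotProduct.
Context {R : realType} (eps : R).
Local Notation "<< u , v >>" := (dot eps u v).
Implicit Types (u v w : 'rV[R]_5) (a : R).

Lemma dotC u v : <<u, v>> = <<v, u>>.
Proof. by apply: eq_bigr => i _; rewrite [u 0 i * _]mulrC. Qed.

Lemma dotDl u v w : <<u + v, w>> = <<u, w>> + <<v, w>>.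
Proof.
by rewrite /dot -big_split; apply: eq_bigr => i _; rewrite mxE mulrDl mulrDr.
Qed.

Lemma dotZl a u v : <<a *: u, v>> = a * <<u, v>>.
Proof.
rewrite /dot mulr_sumr; apply: eq_bigr => i _.
by rewrite mxE -mulrA mulrCA.
Qed.

Lemma dotNl u v : <<- u, v>> = - <<u, v>>.
Proof. by rewrite -scaleN1r dotZl mulN1r. Qed.

Lemma dotBl u v w : <<u - v, w>> = <<u, w>> - <<v, w>>.
Proof. by rewrite dotDl dotNl. Qed.

Lemma dot0l v : <<0, v>> = 0.
Proof. by rewrite -(scale0r v) dotZl mul0r. Qed.

Lemma dotDr u v w : <<w, u + v>> = <<w, u>> + <<w, v>>.
Proof. by rewrite dotC dotDl !(dotC w). Qed.

Lemma dotZr a u v : <<v, a *: u>> = a * <<v, u>>.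
Proof. by rewrite dotC dotZl dotC. Qed.

Lemma dotNr u v : <<v, - u>> = - <<v, u>>.
Proof. by rewrite dotC dotNl dotC. Qed.

Lemma dotBr u v w : <<w, u - v>> = <<w, u>> - <<w, v>>.
Proof. by rewrite dotDr dotNr. Qed.

Lemma dot0r v : <<v, 0>> = 0.
Proof. by rewrite dotC dot0l. Qed.

Lemma dot_suml (I : Type) (r : seq I) (F : I -> 'rV[R]_5) v :
  <<\sum_(i <- r) F i, v>> = \sum_(i <- r) <<F i, v>>.
Proof. exact: (big_morph (fun u => <<u, v>>) (fun x y => dotDl x y v) (dot0l v)). Qed.

Lemma derive_dot {V : normedModType R} (u w : V -> 'rV[R]_5) (x v : V) :
  differentiable u x -> differentiable w x ->
  'D_v (fun y => <<u y, w y>>) x = <<'D_v u x, w x>> + <<u x, 'D_v w x>>.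
Proof.
move=> du dw.
have du' j : derivable (fun y => u y 0 j) x v.
  by apply: diff_derivable; have /differentiable_rowP := du; exact.
have dw' j : derivable (fun y => w y 0 j) x v.
  by apply: diff_derivable; have /differentiable_rowP := dw; exact.
pose s (i : 'I_5) : R := if (eps < 0) && (i == 0) then -1 else 1.
have -> : (fun y => <<u y, w y>>) =
    \sum_i (s i *: ((fun y => u y 0 i) * (fun y => w y 0 i))).
  by apply/funext => y; rewrite fct_sumE.
rewrite derive_sum; last first.
  by move=> j; apply: derivableZ; exact: derivableM.
rewrite -big_split; apply: eq_bigr => j _ /=.
rewrite deriveZ; last exact: derivableM.
rewrite deriveM // -(derive_row v j du) -(derive_row v j dw) /= -mulrDr -/(s j).
by congr (_ * _); rewrite addrC; congr (_ + _); exact: mulrC.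
Qed.

End DotProduct.

(** * Charts and their transition maps *)

Section Charts.
Context {R : realType} {M : surface R}.
Implicit Types (c : chart R M) (p q : M).

Lemma chart_cancel c x : is_chart c -> cimg c x ->
  cdom c (cinv c x) /\ cmap c (cinv c x) = x.
Proof. by move=> [_ _ _ _ K] [q cq <-]; rewrite K. Qed.

Lemma open_chart_image c (V : set M) : is_chart c -> open V ->
  open (cmap c @` (cdom c `&` V)).
Proof.
move=> cc; have [od oi cm ci K] := cc => oV.
rewrite openE => x [q [cq Vq] qx]; rewrite /interior.
have ix : cimg c x by exists q.
have n1 : nbhs x (cimg c) by exact: open_nbhs_nbhs.
have n2 : nbhs x (cinv c @^-1` V).
  by apply: (ci x ix); apply: open_nbhs_nbhs; split => //; rewrite -qx K.
apply: filterS2 n1 n2 => y iy Vy; have [dy Ey] := chart_cancel cc iy.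
by exists (cinv c y).
Qed.

Lemma max_atlas_chart_at p : in_max_atlas (chart_at p).
Proof. by split; [exact: chart_atP|move=> q; exact: chart_at_compatible]. Qed.

Lemma pt_cimg p : cimg (chart_at p) (pt p).
Proof. by exists p => //; exact: mem_chart_at. Qed.

Lemma open_cimg p : open (cimg (chart_at p)).
Proof. by have [] := chart_atP p. Qed.

Lemma cinvK p : cinv (chart_at p) (pt p) = p.
Proof. by have [_ _ _ _ K] := chart_atP p; rewrite K //; exact: mem_chart_at. Qed.

Arguments pt_cimg : clear implicits.
Arguments open_cimg : clear implicits.
Arguments max_atlas_chart_at : clear implicits.
Arguments cinvK : clear implicits.

Section ChartDerivative.
Context (c : chart R M) (q : M).
Hypotheses (ac : in_max_atlas c) (cq : cdom c q).

Let cc : is_chart c. Proof. by case: ac. Qed.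

Let overlap_pt : (cmap (chart_at q) @` (cdom (chart_at q) `&` cdom c)) (pt q).
Proof. by exists q => //; split=> //; exact: mem_chart_at. Qed.

Let overlap_c : (cmap c @` (cdom (chart_at q) `&` cdom c)) (cmap c q).
Proof. by exists q => //; split=> //; exact: mem_chart_at. Qed.

Let open_overlap_pt : open (cmap (chart_at q) @` (cdom (chart_at q) `&` cdom c)).
Proof. by apply: open_chart_image; [exact: chart_atP|case: cc]. Qed.

Let open_overlap_c : open (cmap c @` (cdom (chart_at q) `&` cdom c)).
Proof.
rewrite setIC; apply: open_chart_image => //.
by have [] := chart_atP q.
Qed.

Let tr_in : differentiable (cmap c \o cinv (chart_at q)) (pt q).
Proof. by have [s _] := ac.2 q; exact: smooth_diff s overlap_pt. Qed.

Let tr_out : differentiable (cmap (chart_at q) \o cinv c) (cmap c q).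
Proof. by have [_ s] := ac.2 q; exact: smooth_diff s overlap_c. Qed.

Let KK : cinv c (cmap c q) = q. Proof. by have [_ _ _ _] := cc; exact. Qed.

Lemma Dsurf_chartK v :
  'D_(Dsurf (cmap c) q v) (cmap (chart_at q) \o cinv c) (cmap c q) = v.
Proof.
have E0 : (cmap c \o cinv (chart_at q)) (pt q) = cmap c q.
  by rewrite /= cinvK.
have d2 : differentiable (cmap (chart_at q) \o cinv c)
    ((cmap c \o cinv (chart_at q)) (pt q)) by rewrite E0.
rewrite /Dsurf -E0 -(derive_comp v tr_in d2).
rewrite (@near_eq_derive _ _ _ _ id); first by rewrite derive_id.
apply: open_near_eq open_overlap_pt _ overlap_pt => x [q' [dq' cq'] <-] /=.
have [_ _ _ _ K] := chart_atP q; have [_ _ _ _ K'] := cc.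
by rewrite K // K'.
Qed.

Lemma Dsurf_chartKV w :
  Dsurf (cmap c) q ('D_w (cmap (chart_at q) \o cinv c) (cmap c q)) = w.
Proof.
have E0 : (cmap (chart_at q) \o cinv c) (cmap c q) = pt q by rewrite /= KK.
have d2 : differentiable (cmap c \o cinv (chart_at q))
    ((cmap (chart_at q) \o cinv c) (cmap c q)) by rewrite E0.
rewrite /Dsurf -E0 -(derive_comp w tr_out d2).
rewrite (@near_eq_derive _ _ _ _ id); first by rewrite derive_id.
apply: open_near_eq open_overlap_c _ overlap_c => x [q' [dq' cq'] <-] /=.
have [_ _ _ _ K] := chart_atP q; have [_ _ _ _ K'] := cc.
by rewrite K' // K.
Qed.

Context {V : normedModType R} (u : M -> V).
Hypothesis du : differentiable (loc q u) (pt q).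

Let near_loc : \forall x \near cmap c q,
  (loc q u \o (cmap (chart_at q) \o cinv c)) x = (u \o cinv c) x.
Proof.
apply: open_near_eq open_overlap_c _ overlap_c => x [q' [dq' cq'] <-] /=.
have [_ _ _ _ K] := chart_atP q; have [_ _ _ _ K'] := cc.
by rewrite /loc /= K' // K.
Qed.

Let du' : differentiable (loc q u) ((cmap (chart_at q) \o cinv c) (cmap c q)).
Proof. by rewrite /= KK. Qed.

Lemma differentiable_chart : differentiable (u \o cinv c) (cmap c q).
Proof.
apply: near_eq_differentiable near_loc _.
exact: differentiable_comp tr_out du'.
Qed.

(** The transition map carries the identification of the tangent space by the
   chart at q to the one by c. *)
Lemma Dsurf_chart v :
  'D_(Dsurf (cmap c) q v) (u \o cinv c) (cmap c q) = Dsurf u q v.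
Proof.
rewrite -(near_eq_derive _ near_loc) (derive_comp _ tr_out du') Dsurf_chartK.
by rewrite /= KK.
Qed.

End ChartDerivative.

Lemma components_self (X : M -> 'rV[R]_2) q :
  components (chart_at q) X q = X q.
Proof.
have nid : \forall x \near pt q, loc q (cmap (chart_at q)) x = id x.
  apply: (open_near_eq (open_cimg q) _ (pt_cimg q)) => x ix.
  by have [] := chart_cancel (chart_atP q) ix.
by rewrite /components /Dsurf (near_eq_derive _ nid) derive_id.
Qed.

(** * Calculus on the surface *)

Definition der (X : M -> 'rV[R]_2) {V : normedModType R} (u : M -> V) (q : M) : V :=
  Dsurf u q (X q).

Lemma smooth_loc_diff {V : normedModType R} (u : M -> V) q :
  smooth_on_surface u -> differentiable (loc q u) (pt q).
Proof. by move=> su; exact: smooth_diff (su q) (pt_cimg q). Qed.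

Lemma loc_der (X : M -> 'rV[R]_2) {V : normedModType R} (u : M -> V) p x :
  smooth_on_surface u -> cimg (chart_at p) x ->
  loc p (der X u) x = 'D_(loc p (components (chart_at p) X) x) (loc p u) x.
Proof.
move=> su ix; have [dx Kx] := chart_cancel (chart_atP p) ix.
rewrite /loc /= /der -(Dsurf_chart (max_atlas_chart_at p) dx).
  by rewrite Kx.
exact: smooth_loc_diff.
Qed.

Lemma DsurfDvar {V : normedModType R} (u : M -> V) q v w : smooth_on_surface u ->
  Dsurf u q (v + w) = Dsurf u q v + Dsurf u q w.
Proof. by move=> su; rewrite /Dsurf deriveDvar //; exact: smooth_loc_diff. Qed.

Lemma DsurfZvar {V : normedModType R} (u : M -> V) q a v : smooth_on_surface u ->
  Dsurf u q (a *: v) = a *: Dsurf u q v.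
Proof. by move=> su; rewrite /Dsurf deriveZvar //; exact: smooth_loc_diff. Qed.

Lemma Dsurf_row m (u : M -> 'rV[R]_m) q v j : smooth_on_surface u ->
  Dsurf u q v 0 j = Dsurf (fun q => u q 0 j) q v.
Proof. by move=> su; rewrite /Dsurf derive_row //; exact: smooth_loc_diff. Qed.

Lemma msmooth_rowP m (u : M -> 'rV[R]_m) :
  smooth_on_surface u <-> forall j, smooth_on_surface (fun q => u q 0 j).
Proof.
split=> [su j p|su p]; first exact: ((smooth_rowP (open_cimg p) _).1 (su p) j).
by apply/(smooth_rowP (open_cimg p)) => j; exact: su.
Qed.

Lemma msmooth_der X (u : M -> R) :
  smooth_field X -> smooth_on_surface u -> smooth_on_surface (der X u).
Proof.
move=> sX su p; have oU := open_cimg p.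
pose e := loc p (components (chart_at p) X).
have s1 : smooth (cimg (chart_at p))
    (fun x => \sum_j e x 0 j * 'D_(delta_mx 0 j) (loc p u) x).
  apply: smooth_sum => // j; apply: smoothM => //.
    by have /(smooth_rowP oU) := sX p; exact.
  by apply: smooth_D; exact: su.
apply: (smooth_eq oU _ s1) => x ix.
by rewrite loc_der // derive_sumvar //; exact: smooth_diff (su p) ix.
Qed.

Lemma der_row m X (u : M -> 'rV[R]_m) j : smooth_on_surface u ->
  (fun q => der X u q 0 j) = der X (fun q => u q 0 j).
Proof. by move=> su; apply/funext => q; rewrite /der Dsurf_row. Qed.

Lemma msmooth_der_row m X (u : M -> 'rV[R]_m) :
  smooth_field X -> smooth_on_surface u -> smooth_on_surface (der X u).
Proof.
move=> sX su; apply/msmooth_rowP => j; rewrite der_row //.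
by apply: msmooth_der => //; have /msmooth_rowP := su; exact.
Qed.

Lemma msmooth_cst {V : normedModType R} (a : V) :
  smooth_on_surface (fun _ : M => a).
Proof. by move=> p; exact: smooth_cst. Qed.

Lemma msmoothD {V : normedModType R} (u w : M -> V) :
  smooth_on_surface u -> smooth_on_surface w ->
  smooth_on_surface (fun q => u q + w q).
Proof. by move=> su sw p; apply: (smoothD (open_cimg p)) (su p) (sw p). Qed.

Lemma msmoothM (u w : M -> R) :
  smooth_on_surface u -> smooth_on_surface w ->
  smooth_on_surface (fun q => u q * w q).
Proof. by move=> su sw p; apply: (smoothM (open_cimg p)) (su p) (sw p). Qed.

Lemma msmoothX (u : M -> R) m :
  smooth_on_surface u -> smooth_on_surface (fun q => u q ^+ m).
Proof. by move=> su p; apply: (smoothX (open_cimg p)) (su p). Qed.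

Lemma msmoothZ m (a : M -> R) (u : M -> 'rV[R]_m) :
  smooth_on_surface a -> smooth_on_surface u ->
  smooth_on_surface (fun q => a q *: u q).
Proof. by move=> sa su p; apply: (smoothZ (open_cimg p)) (sa p) (su p). Qed.

Lemma msmoothB m (u w : M -> 'rV[R]_m) :
  smooth_on_surface u -> smooth_on_surface w ->
  smooth_on_surface (fun q => u q - w q).
Proof. by move=> su sw p; apply: (smoothB (open_cimg p)) (su p) (sw p). Qed.

Lemma msmoothV (u : M -> R) : (forall q, u q != 0) ->
  smooth_on_surface u -> smooth_on_surface (fun q => (u q)^-1).
Proof.
by move=> u0 su p; apply: (smoothV (open_cimg p)) (su p) => x _; exact: u0.
Qed.

Lemma msmooth_sqrt (u : M -> R) : (forall q, 0 < u q) ->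
  smooth_on_surface u -> smooth_on_surface (fun q => Num.sqrt (u q)).
Proof.
by move=> u0 su p; apply: (smooth_sqrt (open_cimg p)) (su p) => x _; exact: u0.
Qed.

Lemma Dsurf_cst {V : normedModType R} (a : V) q v : Dsurf (fun _ : M => a) q v = 0.
Proof. exact: derive_cst. Qed.

Lemma DsurfD {V : normedModType R} (u w : M -> V) q v :
  smooth_on_surface u -> smooth_on_surface w ->
  Dsurf (fun q => u q + w q) q v = Dsurf u q v + Dsurf w q v.
Proof.
move=> su sw; rewrite /Dsurf -deriveD //; apply: diff_derivable;
  exact: smooth_loc_diff.
Qed.

Lemma DsurfM (u w : M -> R) q v :
  smooth_on_surface u -> smooth_on_surface w ->
  Dsurf (fun q => u q * w q) q v = Dsurf u q v * w q + u q * Dsurf w q v.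
Proof.
move=> su sw; rewrite /Dsurf.
have d1 : derivable (loc q u) (pt q) v by exact/diff_derivable/smooth_loc_diff.
have d2 : derivable (loc q w) (pt q) v by exact/diff_derivable/smooth_loc_diff.
rewrite -[LHS]/('D_v (loc q u * loc q w) (pt q)) deriveM //.
by rewrite /loc /= cinvK addrC mulrC [X in X + _]mulrC.
Qed.

Lemma DsurfZ m (a : M -> R) (u : M -> 'rV[R]_m) q v :
  smooth_on_surface a -> smooth_on_surface u ->
  Dsurf (fun q => a q *: u q) q v = Dsurf a q v *: u q + a q *: Dsurf u q v.
Proof.
move=> sa su; apply/rowP => j; rewrite Dsurf_row; last exact: msmoothZ.
have sj : smooth_on_surface (fun q => u q 0 j) by have /msmooth_rowP := su; exact.
have -> : (fun q' => (a q' *: u q') 0 j) = (fun q' => a q' * u q' 0 j).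
  by apply/funext => q'; rewrite mxE.
by rewrite (DsurfM _ _ sa sj) !mxE (Dsurf_row _ _ _ su).
Qed.

Lemma msmooth_dot eps (u w : M -> 'rV[R]_5) :
  smooth_on_surface u -> smooth_on_surface w ->
  smooth_on_surface (fun q => dot eps (u q) (w q)).
Proof.
move=> /msmooth_rowP su /msmooth_rowP sw p; apply: (smooth_sum (open_cimg p)) => j.
apply: (smoothM (open_cimg p)); first exact: smooth_cst.
by apply: (smoothM (open_cimg p)); [exact: su|exact: sw].
Qed.

Lemma Dsurf_dot eps (u w : M -> 'rV[R]_5) q v :
  smooth_on_surface u -> smooth_on_surface w ->
  Dsurf (fun q => dot eps (u q) (w q)) q v =
    dot eps (Dsurf u q v) (w q) + dot eps (u q) (Dsurf w q v).
Proof.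
move=> su sw; rewrite /Dsurf.
have := derive_dot eps v (smooth_loc_diff q su) (smooth_loc_diff q sw).
by rewrite /loc /= cinvK.
Qed.

(** The derivative of X u, for a field X, is the product rule applied to the sum of the
   partial derivatives of u weighted by the components of X. *)
Lemma Dsurf_der W (u : M -> R) q v : smooth_field W -> smooth_on_surface u ->
  Dsurf (der W u) q v =
    Dsurf u q ('D_v (loc q (components (chart_at q) W)) (pt q)) +
    'D_v (fun x => 'D_(W q) (loc q u) x) (pt q).
Proof.
move=> sW su; have oU := open_cimg q; have Ux := pt_cimg q.
set e := loc q (components (chart_at q) W).
have se j : differentiable (fun x => e x 0 j) (pt q).
  by have /(smooth_rowP oU)/(_ j) := sW q; move=> s; exact: smooth_diff s Ux.
have sD j : differentiable (fun x => 'D_(delta_mx 0 j) (loc q u) x) (pt q).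
  exact: smooth_diff (smooth_D _ (su q)) Ux.
have eq : e (pt q) = W q by rewrite /e /loc /= cinvK components_self.
rewrite /Dsurf.
rewrite (@near_eq_derive _ _ _ _
  (\sum_j (fun x => e x 0 j) * (fun x => 'D_(delta_mx 0 j) (loc q u) x))); last first.
  apply: open_near_eq oU _ Ux => x ix; rewrite loc_der //.
  by rewrite fct_sumE derive_sumvar //; exact: smooth_diff (su q) ix.
rewrite derive_sum; last first.
  by move=> j; apply: derivableM; exact: diff_derivable.
rewrite (derive_swap v (W q) oU (su q) Ux).
rewrite (derive_sumvar _ (smooth_diff (smooth_D v (su q)) Ux)).
rewrite (derive_sumvar _ (smooth_loc_diff q su)) -big_split.
apply: eq_bigr => j _ /=; rewrite deriveM; [|exact: diff_derivable..].
have dr := derive_row v j (smooth_diff (sW q) Ux : differentiable e (pt q)).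
rewrite dr eq addrC (derive_swap (delta_mx 0 j) v oU (su q) Ux).
by congr (_ + _); exact: mulrC.
Qed.

Lemma Dsurf_der_row m W (u : M -> 'rV[R]_m) q v :
  smooth_field W -> smooth_on_surface u ->
  Dsurf (der W u) q v =
    Dsurf u q ('D_v (loc q (components (chart_at q) W)) (pt q)) +
    'D_v (fun x => 'D_(W q) (loc q u) x) (pt q).
Proof.
move=> sW su; apply/rowP => j.
have sj : smooth_on_surface (fun q => u q 0 j) by have /msmooth_rowP := su; exact.
rewrite Dsurf_row; last exact: msmooth_der_row.
rewrite der_row // Dsurf_der // [RHS]mxE (Dsurf_row _ _ _ su); congr (_ + _).
rewrite derive_row; last exact: smooth_diff (smooth_D _ (su q)) (pt_cimg q).
apply: near_eq_derive; apply: (open_near_eq (open_cimg q) _ (pt_cimg q)) => x ix.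
by rewrite derive_row //; exact: smooth_diff (su q) ix.
Qed.

(** The second derivatives cancel by symmetry, which leaves the derivative along
   the bracket of the two fields. *)
Lemma der_commutator X Y (u : M -> R) q :
  smooth_field X -> smooth_field Y -> smooth_on_surface u ->
  der X (der Y u) q - der Y (der X u) q =
    Dsurf u q ('D_(X q) (loc q (components (chart_at q) Y)) (pt q)
             - 'D_(Y q) (loc q (components (chart_at q) X)) (pt q)).
Proof.
move=> sX sY su; have oU := open_cimg q; have Ux := pt_cimg q.
rewrite {1}/der (Dsurf_der _ _ sY su) {1}/der (Dsurf_der _ _ sX su).
have cancel_second (a b s t : R) : s = t -> a + s - (b + t) = a - b.
  by move=> ->; rewrite opprD addrACA subrr addr0.
rewrite (cancel_second _ _ _ _ (derive_swap (X q) (Y q) oU (su q) Ux)).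
rewrite DsurfDvar //; congr (_ + _).
by rewrite -(scaleN1r ('D_(Y q) _ _)) DsurfZvar // scaleN1r.
Qed.

(** A function with vanishing derivative is locally constant, hence constant on
   the connected surface. *)
Lemma Dsurf0_constant (u : M -> R) (p : M) : smooth_on_surface u ->
  (forall q v, Dsurf u q v = 0) -> forall q, u q = u p.
Proof.
move=> su u0.
have near_const q : \forall q' \near q, u q' = u q.
  pose c := chart_at q; have cc : is_chart c := chart_atP q.
  have [_ _ cm _ K] := cc.
  have nU : nbhs (pt q) (cimg c) by exact: open_nbhs_nbhs (conj (open_cimg q) (pt_cimg q)).
  have [e /= e0 eP] := (nbhs_ballP _ _).1 nU.
  have D0 x w : cimg c x -> 'D_w (loc q u) x = 0.
    move=> ix; have [dx Kx] := chart_cancel cc ix.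
    rewrite -[in LHS]Kx -(Dsurf_chartKV (max_atlas_chart_at q) dx w).
    rewrite (Dsurf_chart (max_atlas_chart_at q) dx) ?u0 //.
    exact: smooth_loc_diff.
  have uE x : ball (pt q) e x -> loc q u x = u q.
    move=> bx; have bt t : 0 <= t <= 1 -> ball (pt q) e (pt q + t *: (x - pt q)).
      move=> /andP[t0 t1]; move: bx; rewrite -!ball_normE /=.
      rewrite opprD addrA subrr sub0r normrN normrZ ger0_norm // distrC.
      by apply: le_lt_trans; rewrite ler_piMl.
    have [|t t01] := @MVT_line R 1 (loc q u) (pt q) (x - pt q).
      by move=> t t01; apply: smooth_diff (su q) _; apply: eP; exact: bt.
    rewrite D0; last by apply: eP; exact: bt.
    rewrite (addrC (pt q)) subrK => /eqP; rewrite subr_eq0 => /eqP ->.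
    by rewrite /loc /= cinvK.
  have n1 : nbhs q (cdom c).
    by apply: open_nbhs_nbhs; split; [case: cc|exact: mem_chart_at].
  have n2 : nbhs q (cmap c @^-1` ball (pt q) e).
    by apply: (cm q (mem_chart_at q)); exact: nbhsx_ballx.
  by apply: filterS2 n1 n2 => q' dq' /uE; rewrite /loc /= K.
pose B := [set q | u q = u p].
have oB : open B.
  by rewrite openE => q /= Bq; apply: filterS (near_const q) => q'; rewrite Bq.
have oBC : open (~` B).
  rewrite openE => q /= Bq; apply: filterS (near_const q) => q' E1 E2.
  by apply: Bq; rewrite /B /= -E1; exact: E2.
have BT : B = setT.
  apply: (@surface_connected _ M B); first by exists p.
    by exists B => //; rewrite setTI.
  by exists B; [rewrite -openC|rewrite setTI].
by move=> q; have : B q by rewrite BT.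
Qed.

(** The inverse function theorem on the surface. The image is a ball, so that
   coordinate lines in it are connected. *)
Lemma chart_of_map p (A : set 'rV[R]_2) (Phi : 'rV[R]_2 -> 'rV[R]_2) :
  open A -> A (pt p) -> A `<=` cimg (chart_at p) -> smooth A Phi ->
  (forall x, A x -> 'J Phi x \in unitmx) ->
  exists x : chart R M,
    [/\ in_max_atlas x, cdom x p, cmap x = Phi \o cmap (chart_at p),
        exists r, cimg x = ball (Phi (pt p)) r &
        forall q, cdom x q -> cdom (chart_at p) q /\ A (cmap (chart_at p) q)].
Proof.
move=> oA Ap AU sPhi Ju; set c := chart_at p.
have [D [r [G [[oD Dp DA r0] PhiD GB sG]]]] := inverse_function oA sPhi Ap Ju.
set B := ball _ _ in PhiD GB sG.
have oB : open B by exact: ball_open.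
have cc : is_chart c := chart_atP p.
have [od oi cm ci K] := cc.
have DU d : D d -> cdom c (cinv c d) /\ cmap c (cinv c d) = d.
  by move=> /DA/AU; exact: chart_cancel cc.
pose x := Chart (cinv c @` D) (Phi \o cmap c) (cinv c \o G).
have domx q : cdom x q <-> cdom c q /\ D (cmap c q).
  split=> [[d Dd <-]|[cq Dq]]; first by have [? ->] := DU d Dd.
  by exists (cmap c q) => //; exact: K.
have imgx : cimg x = B.
  apply/seteqP; split=> [y [q /domx[cq Dq] <-]|y By].
    by have [] := PhiD _ Dq.
  have [DG EG] := GB y By; have [dG KG] := DU _ DG.
  by exists (cinv c (G y)); [exists (G y)|rewrite /= KG EG].
have cx : is_chart x.
  split.
  - rewrite openE => q /domx[cq Dq].
    have n1 : nbhs q (cdom c) by exact: open_nbhs_nbhs.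
    have n2 : nbhs q (cmap c @^-1` D) by apply: (cm q cq); exact: open_nbhs_nbhs.
    by apply: filterS2 n1 n2 => q' cq' Dq'; apply/domx.
  - by rewrite imgx.
  - move=> q /domx[cq Dq]; apply: continuous_comp; first exact: cm.
    by apply: smooth_cts sPhi _; exact: DA.
  - move=> y; rewrite imgx => By; have [DG EG] := GB y By.
    apply: continuous_comp; first exact: smooth_cts sG By.
    by apply: ci; apply: AU; exact: DA.
  - by move=> q /domx[cq Dq] /=; rewrite (PhiD _ Dq).2 K.
have odx : open (cdom x) by case: cx.
exists x; split.
- split => // p'.
  have cc' : is_chart (chart_at p') := chart_atP p'.
  have [od' _ _ _ K'] := cc'.
  have [s1 s2] : compatible (chart_at p') c := chart_at_compatible p' p.
  split.
    apply: (@smooth_comp_row _ _ _ _ _ A (cmap c \o cinv (chart_at p')) Phi) => //.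
    - exact: open_chart_image.
    - by move=> y [q [cq /domx[dq Dq]] <-] /=; rewrite K' //; exact: DA.
    - apply: smooth_sub s1 => y [q [cq /domx[dq Dq]] <-].
      by exists q.
  have oB' : open (cmap x @` (cdom (chart_at p') `&` cdom x)).
    by rewrite setIC; exact: open_chart_image.
  apply: (@smooth_comp_row _ _ _ _ _ (cmap c @` (cdom (chart_at p') `&` cdom c))
    G (cmap (chart_at p') \o cinv c)) => //.
  - by rewrite setIC; exact: open_chart_image.
  - move=> y [q [cq /domx[dq Dq]] <-] /=; rewrite (PhiD _ Dq).2.
    by exists q.
  - apply: smooth_sub sG => y [q [cq /domx[dq Dq]] <-].
    by have [] := PhiD _ Dq.
- by apply/domx; split => //; exact: mem_chart_at.
- by [].
- by exists r.
- by move=> q /domx[cq Dq]; split => //; exact: DA.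
Qed.

End Charts.
Arguments pt_cimg {R M} p.
Arguments open_cimg {R M} p.
Arguments max_atlas_chart_at {R M} p.
Arguments cinvK {R M} p.

(** * The Gauss equation of a parametrized surface *)

Section LinearFunctions.
Context {R : realType} {V W : lmodType R} (f : V -> W).
Hypothesis lin : linear f.

Definition linear_of : {linear V -> W} :=
  HB.pack f (GRing.isLinear.Build R V W *:%R f lin).

Lemma linear_ofD a b : f (a + b) = f a + f b.
Proof. exact: (linearD linear_of). Qed.

Lemma linear_ofZ c a : f (c *: a) = c *: f a.
Proof. exact: (linearZZ linear_of). Qed.

Lemma linear_of_sum (I : Type) (r : seq I) (F : I -> V) :
  f (\sum_(i <- r) F i) = \sum_(i <- r) f (F i).
Proof. exact: (linear_sum linear_of). Qed.

End LinearFunctions.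

Section ParametrizedSurface.
Context {R : realType} (eps : R) (psi : 'rV[R]_2 -> 'rV[R]_5) (U : set 'rV[R]_2).
Hypotheses (oU : open U) (spsi : smooth U psi).
Hypothesis Gu : forall x, U x -> first_form eps psi x \in unitmx.
Local Notation "<< u , v >>" := (dot eps u v).
Local Notation G := (first_form eps psi).
Implicit Types (x v w : 'rV[R]_2).

Let dpsi x : U x -> differentiable psi x.
Proof. exact: smooth_diff spsi. Qed.

Let sD v : smooth U (fun y => 'D_v psi y).
Proof. exact: smooth_D. Qed.

Let dD v x : U x -> differentiable (fun y => 'D_v psi y) x.
Proof. exact: smooth_diff (sD v). Qed.

Lemma row_mul_dot x w (a : 'rV[R]_5) : U x ->
  ((\row_j << a, 'D_(e_ j) psi x >>) *m w^T) 0 0 = << a, 'D_w psi x >>.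
Proof.
move=> Ux; rewrite (derive_sumvar w (dpsi Ux)) mxE dotC dot_suml.
by apply: eq_bigr => j _; rewrite !mxE dotZl dotC mulrC.
Qed.

Lemma first_formE x v w : U x ->
  (v *m G x *m w^T) 0 0 = << 'D_v psi x, 'D_w psi x >>.
Proof.
move=> Ux; have -> : v *m G x = \row_j << 'D_v psi x, 'D_(e_ j) psi x >>.
  apply/rowP => j; rewrite !mxE (derive_sumvar v (dpsi Ux)) dot_suml.
  by apply: eq_bigr => i _; rewrite mxE dotZl.
exact: row_mul_dot.
Qed.

Lemma row_invmxE x v (r : 'rV[R]_2) w : U x -> v = r *m invmx (G x) ->
  << 'D_v psi x, 'D_w psi x >> = (r *m w^T) 0 0.
Proof. by move=> Ux ->; rewrite -first_formE // mulmxKV ?Gu. Qed.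

Lemma dpsi_inj x v : U x -> (forall w, << 'D_v psi x, 'D_w psi x >> = 0) -> v = 0.
Proof.
move=> Ux v0; suff : v *m G x = 0 by move/(congr1 (mulmx^~ (invmx (G x)))); rewrite mulmxK ?Gu // mul0mx.
apply/rowP => j; have := v0 (e_ j); rewrite -first_formE // /e_ trmx_delta.
by rewrite -colE !mxE.
Qed.

Lemma dpsiB x v w : U x -> 'D_(v - w) psi x = 'D_v psi x - 'D_w psi x.
Proof.
by move=> Ux; rewrite !deriveE ?linearB //; exact: dpsi.
Qed.

Lemma tangent_partE x w (a : 'rV[R]_5) : U x ->
  << 'D_(tangent_part eps psi x a) psi x, 'D_w psi x >> = << a, 'D_w psi x >>.
Proof. by move=> Ux; rewrite (row_invmxE w Ux (erefl _)) row_mul_dot. Qed.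

Lemma normal_part_perp x w (a : 'rV[R]_5) : U x ->
  << normal_part eps psi x a, 'D_w psi x >> = 0.
Proof. by move=> Ux; rewrite /normal_part dotBl tangent_partE // subrr. Qed.

Lemma tangent_part_uniq x v (a : 'rV[R]_5) : U x ->
  (forall w, << 'D_v psi x, 'D_w psi x >> = << a, 'D_w psi x >>) ->
  tangent_part eps psi x a = v.
Proof.
move=> Ux va; apply/eqP; rewrite -subr_eq0; apply/eqP/(dpsi_inj Ux) => w.
by rewrite dpsiB // dotBl tangent_partE // va subrr.
Qed.

Lemma tangent_part_linear x : linear (tangent_part eps psi x).
Proof.
move=> c a b; rewrite /tangent_part scalemxAl -mulmxDl; congr (_ *m _).
by apply/rowP => j; rewrite !mxE dotDl dotZl.
Qed.

Lemma normal_part_linear x : U x -> linear (normal_part eps psi x).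
Proof.
move=> Ux c a b; rewrite /normal_part tangent_part_linear.
have -> : forall v w, 'D_(c *: v + w) psi x = c *: 'D_v psi x + 'D_w psi x.
  by move=> v w; rewrite deriveDvar; [rewrite deriveZvar|]; [|exact: dpsi..].
move: ('D_ _ psi x) ('D_ _ psi x) => v w.
by rewrite scalerBr opprD addrACA.
Qed.

Lemma normal_part_tangent x v : U x -> normal_part eps psi x ('D_v psi x) = 0.
Proof.
move=> Ux; rewrite /normal_part (@tangent_part_uniq x v) ?subrr //.
Qed.

Lemma normal_part_dot x (a b : 'rV[R]_5) : U x ->
  << normal_part eps psi x a, b >> = << normal_part eps psi x a, normal_part eps psi x b >>.
Proof.
move=> Ux; rewrite [in RHS]/(normal_part _ _ _ b) dotBr.
by rewrite (normal_part_perp (tangent_part eps psi x b) a Ux) subr0.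
Qed.

Lemma D2_linear x v : U x -> linear (fun w => 'D_v (fun y => 'D_w psi y) x).
Proof.
move=> Ux c a b.
have dZ : differentiable (fun y => c *: 'D_a psi y) x.
  by apply: differentiableZ; exact: dD.
rewrite -deriveZ; last exact/diff_derivable/dD.
rewrite -deriveD; [|exact/diff_derivable|exact/diff_derivable/dD].
apply: near_eq_derive; apply: (open_near_eq oU _ Ux) => y Uy.
by rewrite deriveDvar ?deriveZvar //; exact: dpsi.
Qed.

Lemma D2_sum x v w : U x -> 'D_v (fun y => 'D_w psi y) x =
  \sum_i \sum_j (v 0 i * w 0 j) *: 'D_(e_ i) (fun y => 'D_(e_ j) psi y) x.
Proof.
move=> Ux; rewrite (derive_sumvar v (dD w Ux)); apply: eq_bigr => i _.
have lin := D2_linear (e_ i) Ux.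
rewrite {1}[w]row_sum_delta (linear_of_sum lin) scaler_sumr.
by apply: eq_bigr => j _; rewrite (linear_ofZ lin) scalerA.
Qed.

Lemma D2_swap x v w : U x ->
  'D_v (fun y => 'D_w psi y) x = 'D_w (fun y => 'D_v psi y) x.
Proof.
move=> Ux; apply/rowP => j.
have sj : smooth U (fun y => psi y 0 j) by have /(smooth_rowP oU) := spsi; exact.
have Dj a b : ('D_a (fun y => 'D_b psi y) x) 0 j =
    'D_a (fun y => 'D_b (fun y => psi y 0 j) y) x.
  rewrite derive_row; last exact: dD.
  apply: near_eq_derive; apply: (open_near_eq oU _ Ux) => y Uy.
  by rewrite derive_row //; exact: dpsi.
have sw := derive_swap v w oU sj Ux.
exact: etrans (Dj v w) (etrans sw (esym (Dj w v))).
Qed.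

(** The derivatives of the metric are sums of products of second and first derivatives
   of psi; by the symmetry of the second derivatives all but one of them cancel. *)
Lemma christoffelE i j x : U x ->
  christoffel G i j x = tangent_part eps psi x ('D_(e_ i) (fun y => 'D_(e_ j) psi y) x).
Proof.
move=> Ux; rewrite /christoffel /tangent_part scalemxAl; congr (_ *m _).
apply/rowP => l; rewrite !mxE.
have DG a b c : 'D_(e_ a) (fun y => G y b c) x =
    << 'D_(e_ a) (fun y => 'D_(e_ b) psi y) x, 'D_(e_ c) psi x >> +
    << 'D_(e_ b) psi x, 'D_(e_ a) (fun y => 'D_(e_ c) psi y) x >>.
  rewrite -derive_dot; [|exact: dD..].
  apply: (congr1 (fun u => 'D_(e_ a) u x)); apply/funext => y; exact: mxE.
have polarize (A B C p q r p' q' r' : R) : A = p + q -> B = p' + r ->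
    C = q' + r' -> p' = p -> q' = q -> r' = r -> 2^-1 * (A + B - C) = p.
  by move=> -> -> -> -> -> ->; field.
apply: (polarize _ _ _ _ _ _ _ _ _ (DG i j l) (DG j i l) (DG l i j)).
- exact: (congr1 (dot eps ^~ _) (D2_swap (e_ j) (e_ i) Ux)).
- exact: (etrans (dotC _ _ _) (congr1 (dot eps _) (D2_swap (e_ l) (e_ i) Ux))).
- exact: (congr1 (dot eps _) (D2_swap (e_ l) (e_ j) Ux)).
Qed.

(** The Levi-Civita connection of the induced metric is the tangential part of
   the derivative in the ambient linear space. *)
Lemma levi_civitaE (Y : 'rV[R]_2 -> 'rV[R]_2) v x w : U x -> differentiable Y x ->
  << 'D_(levi_civita G Y v x) psi x, 'D_w psi x >> =
  << 'D_v (fun y => 'D_(Y y) psi y) x, 'D_w psi x >>.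
Proof.
move=> Ux dY.
have dYj j : differentiable (fun y => Y y 0 j) x.
  by have /differentiable_rowP := dY; exact.
have -> : 'D_v (fun y => 'D_(Y y) psi y) x =
    'D_('D_v Y x) psi x + 'D_v (fun y => 'D_(Y x) psi y) x.
  apply/rowP => k.
  have dYy : \forall y \near x, 'D_(Y y) psi y = \sum_j Y y 0 j *: 'D_(e_ j) psi y.
    apply: (open_near_eq oU _ Ux) => y Uy; exact: derive_sumvar (dpsi Uy).
  have dt j : differentiable (fun y => Y y 0 j *: 'D_(e_ j) psi y) x.
    apply/differentiable_rowP => l.
    rewrite (_ : (fun y => _) = (fun y => Y y 0 j) * (fun y => 'D_(e_ j) psi y 0 l)).
      apply: differentiableM => //.
      by have /differentiable_rowP := dD (e_ j) Ux; exact.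
    by apply/funext => y; rewrite mxE.
  rewrite (near_eq_derive _ dYy).
  rewrite (_ : (fun y => _) = \sum_j (fun y => Y y 0 j *: 'D_(e_ j) psi y)); last first.
    by apply/funext => y; rewrite fct_sumE.
  rewrite derive_sum; last by move=> j; exact/diff_derivable.
  rewrite (derive_sumvar ('D_v Y x) (dpsi Ux)).
  have lin := D2_linear v Ux.
  have -> : 'D_v (fun y => 'D_(Y x) psi y) x = \sum_j Y x 0 j *: 'D_v (fun y => 'D_(e_ j) psi y) x.
    rewrite {1}[Y x]row_sum_delta (linear_of_sum lin).
    by apply: eq_bigr => j _; rewrite (linear_ofZ lin).
  rewrite -big_split; congr (fun_of_matrix _ _ _); apply: eq_bigr => j _ /=.
  apply/rowP => l; rewrite derive_row //.
  rewrite (_ : (fun y => _) = (fun y => Y y 0 j) * (fun y => 'D_(e_ j) psi y 0 l)); last first.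
    by apply/funext => y; rewrite mxE.
  have dDl : differentiable (fun y => 'D_(e_ j) psi y 0 l) x.
    by have /differentiable_rowP := dD (e_ j) Ux; exact.
  rewrite deriveM; [|exact/diff_derivable..].
  rewrite !mxE -(derive_row v j dY) -(derive_row v l (dD (e_ j) Ux)) addrC.
  by congr (_ + _); exact: mulrC.
rewrite /levi_civita deriveDvar; last exact: dpsi.
rewrite !dotDl; congr (_ + _).
rewrite D2_sum // dot_suml.
rewrite [in LHS]deriveE ?linear_sum; last exact: dpsi.
rewrite dot_suml; apply: eq_bigr => i _.
rewrite linear_sum !dot_suml; apply: eq_bigr => j _.
rewrite linearZ !dotZl -deriveE; last exact: dpsi.
congr (_ * _).
by rewrite (christoffelE i j Ux); exact: tangent_partE.
Qed.

Local Notation Z i j := (fun x => 'D_(e_ i) (fun y => 'D_(e_ j) psi y) x).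
Local Notation N i j := (fun x => normal_part eps psi x (Z i j x)).

Let sZ i j : smooth U (Z i j).
Proof. exact: smooth_D. Qed.

Let stang i j : smooth U (fun x => tangent_part eps psi x (Z i j x)).
Proof.
apply/(smooth_rowP oU) => k.
have s1 : smooth U (fun x => \sum_l << Z i j x, 'D_(e_ l) psi x >> * invmx (G x) l k).
  apply: smooth_sum => // l; apply: smoothM => //.
    apply: smooth_sum => // m; apply: smoothM => //; first exact: smooth_cst.
    apply: smoothM => //.
      by have /(smooth_rowP oU) := sZ i j; exact.
    by have /(smooth_rowP oU) := sD (e_ l); exact.
  apply: (smooth_invmx oU Gu) => a b.
  have s2 : smooth U (fun x => << 'D_(e_ a) psi x, 'D_(e_ b) psi x >>).
    apply: smooth_sum => // m; apply: smoothM => //; first exact: smooth_cst.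
    apply: smoothM => //.
      by have /(smooth_rowP oU) := sD (e_ a); exact.
    by have /(smooth_rowP oU) := sD (e_ b); exact.
  by apply: (smooth_eq oU) s2 => x Ux; rewrite mxE.
apply: (smooth_eq oU) s1 => x Ux; rewrite mxE.
by apply: eq_bigr => l _; rewrite mxE.
Qed.

Lemma levi_civita_coordinate i j x : U x ->
  levi_civita G (fun=> e_ j) (e_ i) x = tangent_part eps psi x (Z i j x).
Proof.
move=> Ux; symmetry; apply: tangent_part_uniq => // w.
rewrite levi_civitaE //.
Qed.

(** The Gauss equation: the tangential parts of the second derivatives of psi
   account for the curvature, and by symmetry of the third derivatives only the
   derivatives of the normal parts remain. *)
Lemma gauss_equation x : U x ->
  gauss_curvature G x = (<< N 1 1 x, N 0 0 x >> - << N 0 1 x, N 0 1 x >>) / \det (G x).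
Proof.
move=> Ux; rewrite /gauss_curvature; congr (_ / _).
set Rm := _ - _.
have -> : (Rm *m G x) 0 0 = << 'D_Rm psi x, 'D_(e_ 0) psi x >>.
  rewrite -first_formE // /e_ trmx_delta -colE.
  by rewrite [RHS]mxE.
have LC i j k : << 'D_(levi_civita G (levi_civita G (fun=> e_ k) (e_ j)) (e_ i) x) psi x,
     'D_(e_ 0) psi x >> = << 'D_(e_ i) (Z j k) x, 'D_(e_ 0) psi x >> +
     << N j k x, Z i 0 x >>.
  pose t := fun x => tangent_part eps psi x (Z j k x).
  have -> : levi_civita G (levi_civita G (fun=> e_ k) (e_ j)) (e_ i) x =
      levi_civita G t (e_ i) x.
    have nt : \forall y \near x, levi_civita G (fun=> e_ k) (e_ j) y = t y.
      by apply: (open_near_eq oU _ Ux) => y; exact: levi_civita_coordinate.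
    have tx : levi_civita G (fun=> e_ k) (e_ j) x = t x := levi_civita_coordinate _ _ Ux.
    rewrite [LHS]/levi_civita [RHS]/levi_civita (near_eq_derive _ nt) tx //.
  rewrite levi_civitaE //; last exact: smooth_diff (stang j k) Ux.
  have sN : smooth U (N j k).
    apply: smoothB => //.
    apply: (smooth_eq oU (u := fun x => \sum_l t x 0 l *: 'D_(e_ l) psi x)).
      by move=> y Uy; rewrite -derive_sumvar //; exact: dpsi.
    apply: smooth_sum => // l; apply: smoothZ => //.
    by have /(smooth_rowP oU) := stang j k; exact.
  have dN : differentiable (N j k) x := smooth_diff sN Ux.
  have Dt : 'D_(e_ i) (fun y => 'D_(t y) psi y) x = 'D_(e_ i) (Z j k) x - 'D_(e_ i) (N j k) x.
    rewrite -deriveB; [|exact/diff_derivable/(smooth_diff (sZ j k) Ux)|exact/diff_derivable].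
    apply: (congr1 (fun u => 'D_(e_ i) u x)); apply/funext => y.
    exact: (esym (subKr (Z j k y) ('D_(t y) psi y))).
  apply: etrans (congr1 (dot eps ^~ _) Dt) _.
  apply: etrans (dotBl _ _ _ _) _; congr (_ + _).
  have : 'D_(e_ i) (fun y => << N j k y, 'D_(e_ 0) psi y >>) x = 0.
    have n0 : \forall y \near x, << N j k y, 'D_(e_ 0) psi y >> = 0.
      by apply: (open_near_eq oU _ Ux) => y Uy; exact: normal_part_perp.
    by rewrite (near_eq_derive _ n0) derive_cst.
  rewrite derive_dot //; last exact: dD.
  by move/eqP; rewrite addr_eq0 => /eqP ->; rewrite opprK.
have D3 : 'D_(e_ 0) (Z 1 1) x = 'D_(e_ 1) (Z 0 1) x.
  apply/rowP => k.
  have sk : smooth U (fun y => 'D_(e_ 1) psi y 0 k).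
    by have /(smooth_rowP oU) := sD (e_ 1); exact.
  have Dk a b : ('D_a (fun y => 'D_b (fun y => 'D_(e_ 1) psi y) y) x) 0 k =
      'D_a (fun y => 'D_b (fun y => 'D_(e_ 1) psi y 0 k) y) x.
    rewrite derive_row; last exact: smooth_diff (smooth_D b (sD (e_ 1))) Ux.
    apply: near_eq_derive; apply: (open_near_eq oU _ Ux) => y Uy.
    by rewrite derive_row //; exact: dD.
  have sw := derive_swap (e_ 0) (e_ 1) oU sk Ux.
  exact: etrans (Dk (e_ 0) (e_ 1)) (etrans sw (esym (Dk (e_ 1) (e_ 0)))).
have NZ i j k l : << N i j x, Z k l x >> = << N i j x, N k l x >>.
  exact: normal_part_dot.
have cancel (a b c d b' d' : R) : a = c -> b = b' -> d = d' -> a + b - (c + d) = b' - d'.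
  by move=> -> -> ->; rewrite opprD addrACA subrr add0r.
apply: etrans (congr1 (dot eps ^~ _) (dpsiB _ _ Ux)) _.
apply: etrans (dotBl _ _ _ _) _.
apply: etrans (congr2 (fun a b => a - b) (LC 0 1 1) (LC 1 0 1)) _.
apply: cancel.
- exact: (congr1 (dot eps ^~ _) D3).
- exact: NZ 1 1 0 0.
- have e3 := NZ 0 1 0 1.
  have e4 := congr1 (dot eps (N 0 1 x)) (D2_swap (e_ 1) (e_ 0) Ux).
  exact: etrans e4 e3.
Qed.

End ParametrizedSurface.

Lemma sum_ord2 {V : zmodType} (F : 'I_2 -> V) : \sum_i F i = F 0 + F 1.
Proof.
rewrite !big_ord_recl big_ord0 addr0; congr (F _ + F _); exact: val_inj.
Qed.

Lemma linear_double_sum {R : realType} {V W : lmodType R} (L : V -> W)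
    (F : 'I_2 -> 'I_2 -> V) (v w : 'rV[R]_2) : linear L -> F 1 0 = F 0 1 ->
  L (\sum_i \sum_j (v 0 i * w 0 j) *: F i j) =
    (v 0 0 * w 0 0) *: L (F 0 0) + (v 0 0 * w 0 1 + v 0 1 * w 0 0) *: L (F 0 1)
    + (v 0 1 * w 0 1) *: L (F 1 1).
Proof.
move=> lin F10; rewrite !sum_ord2 F10 !(linear_ofD lin) !(linear_ofZ lin) scalerDl !addrA.
by [].
Qed.

(** A change of basis multiplies the Gram expression of a symmetric bilinear map
   and the determinant of the metric by the same factor. *)
Lemma gram_change_of_basis {R : realType} (eps : R) (G : 'M[R]_2)
    (n00 n01 n11 : 'rV[R]_5) (a b : 'rV[R]_2) :
  let NN (v w : 'rV[R]_2) := (v 0 0 * w 0 0) *: n00 + (v 0 0 * w 0 1 + v 0 1 * w 0 0) *: n01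
    + (v 0 1 * w 0 1) *: n11 in
  G 1 0 = G 0 1 ->
  (a *m G *m a^T) 0 0 = 1 -> (b *m G *m b^T) 0 0 = 1 -> (a *m G *m b^T) 0 0 = 0 ->
  (dot eps n11 n00 - dot eps n01 n01) / \det G =
  dot eps (NN a a) (NN b b) - dot eps (NN a b) (NN a b).
Proof.
move=> NN g10.
have gE (v w : 'rV[R]_2) : (v *m G *m w^T) 0 0 =
     v 0 0 * w 0 0 * G 0 0 + v 0 0 * w 0 1 * G 0 1 + v 0 1 * w 0 0 * G 0 1
     + v 0 1 * w 0 1 * G 1 1.
  by rewrite mxE sum_ord2 !mxE !sum_ord2 g10; ring.
rewrite !gE => aa bb ab.
have dE : \det G = G 0 0 * G 1 1 - G 0 1 * G 0 1.
  rewrite (expand_det_row _ 0) sum_ord2 /cofactor !det_mx11 !mxE /=.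
  rewrite (_ : lift 0 0 = 1 :> 'I_2); last exact: val_inj.
  rewrite (_ : lift 1 0 = 0 :> 'I_2); last exact: val_inj.
  by rewrite g10 expr0 /= expr1; ring.
have detG : (a 0 0 * b 0 1 - a 0 1 * b 0 0) ^+ 2 * \det G = 1.
  rewrite dE; move: aa bb ab.
  move: (G 0 0) (G 0 1) (G 1 1) => E F H aa bb ab.
  have -> : (a 0 0 * b 0 1 - a 0 1 * b 0 0) ^+ 2 * (E * H - F * F) =
    (a 0 0 * a 0 0 * E + a 0 0 * a 0 1 * F + a 0 1 * a 0 0 * F + a 0 1 * a 0 1 * H) *
    (b 0 0 * b 0 0 * E + b 0 0 * b 0 1 * F + b 0 1 * b 0 0 * F + b 0 1 * b 0 1 * H) -
    (a 0 0 * b 0 0 * E + a 0 0 * b 0 1 * F + a 0 1 * b 0 0 * F + a 0 1 * b 0 1 * H) ^+ 2.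
    ring.
  by rewrite aa bb ab; ring.
have dn0 : \det G != 0.
  by apply: contra_eq_neq detG => ->; rewrite mulr0 eq_sym oner_eq0.
apply: (mulIf dn0); rewrite mulfVK // /NN !dotDl !dotZl !dotDr !dotZr.
rewrite (dotC _ n11 n00) (dotC _ n01 n00) (dotC _ n11 n01).
move: detG; move: (\det _) => D detG.
move: (dot _ n00 n00) (dot _ n00 n01) (dot _ n00 n11) (dot _ n01 n01) (dot _ n01 n11)
  (dot _ n11 n11) => n1 n2 n3 n4 n5 n6.
rewrite -[LHS]mul1r -detG; ring.
Qed.

Section ParametrizedSurfaceFrame.
Context {R : realType} (eps : R) (psi : 'rV[R]_2 -> 'rV[R]_5) (U : set 'rV[R]_2).
Hypotheses (oU : open U) (spsi : smooth U psi).
Hypothesis Gu : forall x, U x -> first_form eps psi x \in unitmx.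
Local Notation "<< u , v >>" := (dot eps u v).
Local Notation G := (first_form eps psi).

Lemma gauss_equation_frame x (a b : 'rV[R]_2) : U x ->
  (a *m G x *m a^T) 0 0 = 1 -> (b *m G x *m b^T) 0 0 = 1 ->
  (a *m G x *m b^T) 0 0 = 0 ->
  let NN v w := normal_part eps psi x ('D_v (fun y => 'D_w psi y) x) in
  gauss_curvature G x = << NN a a, NN b b >> - << NN a b, NN a b >>.
Proof.
move=> Ux aa bb ab NN.
have g10 : G x 1 0 = G x 0 1.
  by apply: etrans (etrans (mxE _ _ _ _) (dotC _ _ _)) _; rewrite mxE.
have lin := normal_part_linear eps spsi Ux.
have NNE (v w : 'rV[R]_2) := etrans (congr1 (normal_part eps psi x) (D2_sum oU spsi v w Ux))
  (linear_double_sum v w lin (D2_swap oU spsi (e_ 1) (e_ 0) Ux)).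
have gram := gram_change_of_basis eps _ _ _ g10 aa bb ab.
apply: etrans (gauss_equation oU spsi Gu Ux) _.
apply: etrans (gram _ _ _) _.
exact: (congr2 (fun s t => s - t)
  (congr2 (dot eps) (esym (NNE a a)) (esym (NNE b b)))
  (congr2 (dot eps) (esym (NNE a b)) (esym (NNE a b)))).
Qed.

End ParametrizedSurfaceFrame.

(** * Algebra of moving frames *)

Section DoubleSum.
Context {R : realType} {W : lmodType R} (T : 'rV[R]_2 -> 'rV[R]_2 -> W).
Hypothesis TE : forall v w, T v w = \sum_i \sum_j (v 0 i * w 0 j) *: T (e_ i) (e_ j).

Lemma double_sum_left v w : T v w = \sum_i v 0 i *: T (e_ i) w.
Proof.
rewrite TE; apply: eq_bigr => i _.
rewrite (TE (e_ i) w) [in RHS](bigD1 i) //= [X in _ + X]big1 => [|k ki].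
  rewrite addr0 scaler_sumr; apply: eq_bigr => j _.
  by rewrite scalerA mxE !eqxx mul1r.
by apply: big1 => j _; rewrite mxE (negPf ki) andbF mul0r scale0r.
Qed.

Lemma double_sum_right v w : T v w = \sum_j w 0 j *: T v (e_ j).
Proof.
rewrite TE exchange_big; apply: eq_bigr => j _.
rewrite (TE v (e_ j)) scaler_sumr; apply: eq_bigr => i _.
rewrite (bigD1 j) //= big1 => [|k kj].
  by rewrite addr0 scalerA mxE !eqxx mulr1 mulrC.
by rewrite mxE (negPf kj) andbF mulr0 scale0r.
Qed.

End DoubleSum.

Section MovingFrameAlgebra.
Context {R : realType} (eps : R).
Local Notation "<< u , v >>" := (dot eps u v).

(** The matrix P with rows a and b satisfies P G P^T = 1, whence G^-1 = P^T P. *)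
Lemma gram_orthonormal (G : 'M[R]_2) (a b : 'rV[R]_2) : G^T = G ->
  (a *m G *m a^T) 0 0 = 1 -> (b *m G *m b^T) 0 0 = 1 -> (a *m G *m b^T) 0 0 = 0 ->
  G \in unitmx /\ invmx G = a^T *m a + b^T *m b.
Proof.
move=> Gs aa bb ab; pose P := col_mx a b.
have ba : (b *m G *m a^T) 0 0 = 0.
  have -> : b *m G *m a^T = (a *m G *m b^T)^T by rewrite !trmx_mul trmxK Gs mulmxA.
  by rewrite mxE.
have e11 (A : 'M[R]_1) c : A 0 0 = c -> A = c%:M by move=> <-; exact: mx11_scalar.
have PP : P *m (G *m P^T) = 1%:M.
  rewrite mulmxA mul_col_mx tr_col_mx mul_col_row.
  by rewrite (e11 _ _ aa) (e11 _ _ bb) (e11 _ _ ab) (e11 _ _ ba) scalar_mx_block raddf0.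
have GP : G *m (P^T *m P) = 1%:M by rewrite mulmxA; exact: mulmx1C.
have [Gu _] := mulmx1_unit GP; split=> //.
rewrite -[RHS]mul1mx -(mulVmx Gu) -mulmxA.
by rewrite -mul_row_col -tr_col_mx GP mulmx1.
Qed.

(** A family of five orthogonal vectors of nonzero norm is a basis: its Gram
   matrix is invertible. *)
Lemma orthogonal_expansion (b : 'I_5 -> 'rV[R]_5) (n : 'I_5 -> R) (w : 'rV[R]_5) :
  (forall i j, << b i, b j >> = if i == j then n i else 0) ->
  (forall i, n i != 0) -> w = \sum_i (<< w, b i >> / n i) *: b i.
Proof.
move=> bb n0.
pose S : 'M[R]_5 := diag_mx (\row_i if (eps < 0) && (i == 0) then -1 else 1).
pose Q : 'M[R]_5 := \matrix_i b i.
pose T : 'M[R]_5 := \matrix_(i, j) ((S *m (b j)^T) i 0 / n j).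
have dE (u : 'rV[R]_5) j : (u *m T) 0 j = << u, b j >> / n j.
  rewrite mxE /dot mulr_suml; apply: eq_bigr => i _.
  rewrite !mxE mulrA; congr (_ / _); rewrite (bigD1 i) //= big1 => [|k ki].
    by rewrite addr0 !mxE eqxx mulr1n mulrCA.
  by rewrite !mxE (eq_sym i k) (negPf ki) mulr0n mul0r.
have QT : Q *m T = 1%:M.
  apply/matrixP => i j; rewrite [RHS]mxE.
  have -> : (Q *m T) i j = (row i Q *m T) 0 j by rewrite -row_mul [RHS]mxE.
  by rewrite rowK dE bb; case: eqP => [->|_]; rewrite ?mul0r // divff.
have := mulmx1C QT => /(congr1 (mulmx w)); rewrite mulmx1 mulmxA => {1}<-.
rewrite [LHS]mulmx_sum_row; apply: eq_bigr => i _.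
by rewrite dE rowK.
Qed.

(** The factor eps of the component along ph is part of nu = eps *: ph, which has
   square norm eps; the formula thus covers eps = 0. *)
Definition normal_projection (y1 y2 nu ph w : 'rV[R]_5) : 'rV[R]_5 :=
  w - << w, y1 >> *: y1 - << w, y2 >> *: y2 - << w, nu >> *: ph.

Lemma normal_projection_linear y1 y2 nu ph : linear (normal_projection y1 y2 nu ph).
Proof.
move=> c a b; rewrite /normal_projection !dotDl !dotZl.
move: << a, _ >> << a, _ >> << a, _ >> << b, _ >> << b, _ >> << b, _ >>.
by move=> r1 r2 r3 t1 t2 t3; apply/rowP => j; rewrite !mxE; ring.
Qed.

Lemma normal_projection_perp y1 y2 ph w :
  << y1, y1 >> = 1 -> << y2, y2 >> = 1 -> << y1, y2 >> = 0 ->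
  << y1, eps *: ph >> = 0 -> << y2, eps *: ph >> = 0 ->
  << eps *: ph, eps *: ph >> = eps ->
  let Nw := normal_projection y1 y2 (eps *: ph) ph w in
  [/\ << Nw, y1 >> = 0, << Nw, y2 >> = 0 & << Nw, eps *: ph >> = 0].
Proof.
move=> h1 h2 h3 h5 h6 h4; rewrite /normal_projection.
have h5' : eps * << w, ph >> * << ph, y1 >> = 0.
  by move: h5; rewrite dotZr dotC mulrAC => ->; rewrite mul0r.
have h6' : eps * << w, ph >> * << ph, y2 >> = 0.
  by move: h6; rewrite dotZr dotC mulrAC => ->; rewrite mul0r.
have h4' : eps * << w, ph >> * << ph, eps *: ph >> = eps * << w, ph >>.
  rewrite dotZl dotZr in h4; rewrite dotZr.
  have -> : eps * << w, ph >> * (eps * << ph, ph >>) =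
    << w, ph >> * (eps * (eps * << ph, ph >>)) by ring.
  by rewrite h4 mulrC.
rewrite !dotBl !(dotZl _ << _, _ >>) h1 h2 h5 h6 h3 (dotC _ y2 y1) h3.
rewrite !(dotZr _ _ ph w) h5' h6' h4'.
by rewrite !mulr1 !mulr0 !subr0 !subrr.
Qed.

Lemma normal_projection_dot y1 y2 ph w eta :
  << eta, y1 >> = 0 -> << eta, y2 >> = 0 -> << eta, eps *: ph >> = 0 ->
  << normal_projection y1 y2 (eps *: ph) ph w, eta >> = << w, eta >>.
Proof.
move=> h1 h2 h3; rewrite /normal_projection.
rewrite !dotBl !(dotZl _ << _, _ >>) (dotC _ y1) h1 (dotC _ y2) h2 !mulr0 !subr0.
rewrite dotZr [in X in _ - X]dotC; move: h3; rewrite dotZr => h3.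
rewrite [<< ph, w >>]dotC.
have -> : eps * << w, ph >> * << ph, eta >> = 0.
  by rewrite mulrAC [<< ph, eta >>]dotC h3 mul0r.
by rewrite subr0.
Qed.

(** The vector nu is eps *: phi p. It is a multiple of the normal of the space form for
   eps <> 0 and vanishes for eps = 0, and its square norm is eps in both cases. *)
Record moving_frame (y1 y2 n3 n4 nu : 'rV[R]_5) : Prop := MovingFrame {
  mf11 : << y1, y1 >> = 1; mf22 : << y2, y2 >> = 1;
  mf33 : << n3, n3 >> = 1; mf44 : << n4, n4 >> = 1; mf55 : << nu, nu >> = eps;
  mf12 : << y1, y2 >> = 0; mf13 : << y1, n3 >> = 0; mf14 : << y1, n4 >> = 0;
  mf15 : << y1, nu >> = 0; mf23 : << y2, n3 >> = 0; mf24 : << y2, n4 >> = 0;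
  mf25 : << y2, nu >> = 0; mf34 : << n3, n4 >> = 0; mf35 : << n3, nu >> = 0;
  mf45 : << n4, nu >> = 0 }.

Definition frame_comb (y1 y2 n3 n4 nu : 'rV[R]_5) (c1 c2 c3 c4 c5 : R) : 'rV[R]_5 :=
  c1 *: y1 + c2 *: y2 + c3 *: n3 + c4 *: n4 + c5 *: nu.

Section Frame.
Context (y1 y2 n3 n4 nu : 'rV[R]_5) (mf : moving_frame y1 y2 n3 n4 nu).

Lemma comb_dot c1 c2 c3 c4 c5 d1 d2 d3 d4 d5 :
  << frame_comb y1 y2 n3 n4 nu c1 c2 c3 c4 c5, frame_comb y1 y2 n3 n4 nu d1 d2 d3 d4 d5 >> =
  c1 * d1 + c2 * d2 + c3 * d3 + c4 * d4 + eps * (c5 * d5).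
Proof.
have [h11 h22 h33 h44 h55 h12 h13 h14 h15 h23 h24 h25 h34 h35 h45] := mf.
rewrite /frame_comb !(dotDl, dotDr, dotZl, dotZr).
rewrite (dotC _ y2 y1) (dotC _ n3 y1) (dotC _ n4 y1) (dotC _ nu y1).
rewrite (dotC _ n3 y2) (dotC _ n4 y2) (dotC _ nu y2).
rewrite (dotC _ n4 n3) (dotC _ nu n3) (dotC _ nu n4).
by rewrite h11 h22 h33 h44 h55 h12 h13 h14 h15 h23 h24 h25 h34 h35 h45; ring.
Qed.

Lemma comb1 : y1 = frame_comb y1 y2 n3 n4 nu 1 0 0 0 0.
Proof. by rewrite /frame_comb scale1r !scale0r !addr0. Qed.

Lemma comb2 : y2 = frame_comb y1 y2 n3 n4 nu 0 1 0 0 0.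
Proof. by rewrite /frame_comb scale1r !scale0r !addr0 add0r. Qed.

Lemma comb3 : n3 = frame_comb y1 y2 n3 n4 nu 0 0 1 0 0.
Proof. by rewrite /frame_comb scale1r !scale0r !addr0 !add0r. Qed.

Lemma comb4 : n4 = frame_comb y1 y2 n3 n4 nu 0 0 0 1 0.
Proof. by rewrite /frame_comb scale1r !scale0r !addr0 !add0r. Qed.

Lemma comb_dot1 c1 c2 c3 c4 c5 : << frame_comb y1 y2 n3 n4 nu c1 c2 c3 c4 c5, y1 >> = c1.
Proof. by rewrite {2}comb1 comb_dot; ring. Qed.

Lemma comb_dot2 c1 c2 c3 c4 c5 : << frame_comb y1 y2 n3 n4 nu c1 c2 c3 c4 c5, y2 >> = c2.
Proof. by rewrite {2}comb2 comb_dot; ring. Qed.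

Lemma comb_dot3 c1 c2 c3 c4 c5 : << frame_comb y1 y2 n3 n4 nu c1 c2 c3 c4 c5, n3 >> = c3.
Proof. by rewrite {2}comb3 comb_dot; ring. Qed.

Lemma comb_dot4 c1 c2 c3 c4 c5 : << frame_comb y1 y2 n3 n4 nu c1 c2 c3 c4 c5, n4 >> = c4.
Proof. by rewrite {2}comb4 comb_dot; ring. Qed.

End Frame.

(** For eps = 0 the vector eps *: phi vanishes, and the first basis vector completes
   the frame instead. *)
Lemma frame_expansion (y1 y2 n3 n4 phi w : 'rV[R]_5) (c5 : R) :
  moving_frame y1 y2 n3 n4 (eps *: phi) ->
  (eps = 0 -> [/\ y1 0 0 = 0, y2 0 0 = 0, n3 0 0 = 0, n4 0 0 = 0 & w 0 0 = 0]) ->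
  eps * << w, phi >> = eps * c5 ->
  w = frame_comb y1 y2 n3 n4 (eps *: phi) << w, y1 >> << w, y2 >> << w, n3 >> << w, n4 >> c5.
Proof.
move=> mf w0 wphi.
have [h11 h22 h33 h44 h55 h12 h13 h14 h15 h23 h24 h25 h34 h35 h45] := mf.
pose nu : 'rV[R]_5 := if eps == 0 then delta_mx 0 0 else eps *: phi.
pose nn : R := if eps == 0 then 1 else eps.
pose b (i : 'I_5) := nth 0 [:: y1; y2; n3; n4; nu] i.
pose n (i : 'I_5) := nth 0 [:: 1; 1; 1; 1; nn] i.
have e0dot u : eps = 0 -> << u, delta_mx 0 0 >> = u 0 0.
  move=> e0; rewrite /dot (bigD1 0) //= big1 ?addr0 => [|i i0]; last first.
    by rewrite !mxE eqxx (negPf i0) !mulr0.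
  by rewrite !mxE eqxx e0 ltxx mulr1 mul1r.
have [p1 p2 p3 p4 pp] : [/\ << y1, nu >> = 0, << y2, nu >> = 0, << n3, nu >> = 0,
    << n4, nu >> = 0 & << nu, nu >> = nn].
  rewrite /nu /nn; case: eqP => [e0|_]; last by [].
  have [? ? ? ? ?] := w0 e0; rewrite !e0dot //; split=> //.
  by rewrite mxE !eqxx.
have bb i j : << b i, b j >> = if i == j then n i else 0.
  case: i => -[|[|[|[|[|//]]]]] hi; case: j => -[|[|[|[|[|//]]]]] hj;
  by rewrite /b /n /= ?h11 ?h22 ?h33 ?h44 ?pp ?p1 ?p2 ?p3 ?p4
     ?h12 ?h13 ?h14 ?h23 ?h24 ?h34 // dotC ?p1 ?p2 ?p3 ?p4 ?h12 ?h13 ?h14 ?h23 ?h24 ?h34.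
have n0 i : n i != 0.
  case: i => -[|[|[|[|[|//]]]]] hi; rewrite /n /= ?oner_neq0 // /nn.
  by have [_|//] := eqVneq eps 0; exact: oner_neq0.
rewrite {1}(orthogonal_expansion w bb n0) !big_ord_recl big_ord0 /frame_comb /b /n /=.
rewrite !divr1 addr0 !addrA; congr (_ + _).
rewrite /nu /nn; case: eqP => [e0|/eqP e0].
  have [? ? ? ? w00] := w0 e0.
  by rewrite e0dot // w00 mul0r !scale0r e0 scale0r scaler0.
by rewrite dotZr wphi mulrAC divff // mul1r.
Qed.

End MovingFrameAlgebra.

(** * The geometry of the surface in an orthonormal frame *)

Section FrameOnSurface.
Context {R : realType} (eps : R) {M : surface R} (phi : M -> 'rV[R]_5).
Context (E1 E2 : M -> 'rV[R]_2).
Hypothesis himm : immersion_in_N4 eps phi.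
Hypotheses (sE1 : smooth_field E1) (sE2 : smooth_field E2).
Hypothesis ortho : forall p, [/\ inner eps phi p (E1 p) (E1 p) = 1,
    inner eps phi p (E2 p) (E2 p) = 1 & inner eps phi p (E1 p) (E2 p) = 0].
Local Notation "<< u , v >>" := (dot eps u v).
Local Notation Y1 := (der E1 phi).
Local Notation Y2 := (der E2 phi).
Local Notation nu q := (eps *: phi q).
Implicit Types (p q : M).

Lemma smooth_phi : smooth_on_surface phi.
Proof. by case: himm. Qed.
Let sphi := smooth_phi.

Lemma smooth_Y1 : smooth_on_surface Y1. Proof. exact: msmooth_der_row. Qed.
Lemma smooth_Y2 : smooth_on_surface Y2. Proof. exact: msmooth_der_row. Qed.

Lemma innerE q v w : inner eps phi q v w = << Dsurf phi q v, Dsurf phi q w >>.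
Proof. exact: (first_formE eps (sphi q) v w (pt_cimg q)). Qed.

Lemma Y_orthonormal q :
  [/\ << Y1 q, Y1 q >> = 1, << Y2 q, Y2 q >> = 1 & << Y1 q, Y2 q >> = 0].
Proof. by have := ortho q; rewrite !innerE. Qed.

Lemma first_form_sym (psi : 'rV[R]_2 -> 'rV[R]_5) x :
  (first_form eps psi x)^T = first_form eps psi x.
Proof. by apply/matrixP => i j; rewrite !mxE dotC. Qed.

(** The components of the frame fields are orthonormal for the metric in every chart,
   because its products are those of the derivatives of phi along the fields. *)
Lemma metric_frame p x : cimg (chart_at p) x ->
  let a := loc p (components (chart_at p) E1) x in
  let b := loc p (components (chart_at p) E2) x in
  metric eps phi p x \in unitmx /\ invmx (metric eps phi p x) = a^T *m a + b^T *m b.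
Proof.
move=> ix a b; have [h1 h2 h3] := Y_orthonormal (cinv (chart_at p) x).
have ea : 'D_a (loc p phi) x = Y1 (cinv (chart_at p) x) := esym (loc_der E1 sphi ix).
have eb : 'D_b (loc p phi) x = Y2 (cinv (chart_at p) x) := esym (loc_der E2 sphi ix).
have fE v w := first_formE eps (sphi p) v w ix.
apply: gram_orthonormal; first exact: first_form_sym.
- exact: etrans (fE a a) (etrans (congr2 (dot eps) ea ea) h1).
- exact: etrans (fE b b) (etrans (congr2 (dot eps) eb eb) h2).
- exact: etrans (fE a b) (etrans (congr2 (dot eps) ea eb) h3).
Qed.

Lemma metric_unit p x : cimg (chart_at p) x -> first_form eps (loc p phi) x \in unitmx.
Proof. by move=> ix; have [] := metric_frame ix. Qed.

Lemma invmx_metric q :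
  invmx (metric eps phi q (pt q)) = (E1 q)^T *m E1 q + (E2 q)^T *m E2 q.
Proof.
have [_ ->] := metric_frame (pt_cimg q).
by rewrite /loc /= cinvK !components_self.
Qed.

Lemma metric_trace_frame {W : lmodType R} (T : 'rV[R]_2 -> 'rV[R]_2 -> W) q :
  (forall v w, T v w = \sum_i \sum_j (v 0 i * w 0 j) *: T (e_ i) (e_ j)) ->
  metric_trace (metric eps phi q) T (pt q) = T (E1 q) (E1 q) + T (E2 q) (E2 q).
Proof.
move=> TE; rewrite /metric_trace (TE (E1 q)) (TE (E2 q)) -big_split.
apply: eq_bigr => i _; rewrite -big_split; apply: eq_bigr => j _ /=.
by rewrite invmx_metric -scalerDl !mxE !big_ord1 !mxE.
Qed.

Lemma tangent_part_frame q (w : 'rV[R]_5) :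
  tangent_part eps (loc q phi) (pt q) w = << w, Y1 q >> *: E1 q + << w, Y2 q >> *: E2 q.
Proof.
have e11 (A : 'M[R]_1) (v : 'rV[R]_2) : A *m v = A 0 0 *: v.
  by rewrite {1}[A]mx11_scalar mul_scalar_mx.
rewrite /tangent_part [invmx _]invmx_metric mulmxDr !mulmxA !e11.
congr (_ *: _ + _ *: _).
  exact: (row_mul_dot eps (sphi q) (E1 q) w (pt_cimg q)).
exact: (row_mul_dot eps (sphi q) (E2 q) w (pt_cimg q)).
Qed.

Lemma normal_part_frame q (w : 'rV[R]_5) :
  normal_part eps (loc q phi) (pt q) w = w - << w, Y1 q >> *: Y1 q - << w, Y2 q >> *: Y2 q.
Proof.
rewrite /normal_part tangent_part_frame.
have d := smooth_loc_diff q sphi.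
by rewrite (deriveDvar _ _ d) !(deriveZvar _ _ d) opprD addrA.
Qed.

Lemma gradM_frame (u : M -> R) q : smooth_on_surface u ->
  gradM eps phi u q = der E1 u q *: E1 q + der E2 u q *: E2 q.
Proof.
move=> su; have e11 (A : 'M[R]_1) (v : 'rV[R]_2) : A *m v = A 0 0 *: v.
  by rewrite {1}[A]mx11_scalar mul_scalar_mx.
have d := smooth_loc_diff q su.
have rE v : ((\row_j 'D_(e_ j) (loc q u) (pt q)) *m v^T) 0 0 = Dsurf u q v.
  rewrite /Dsurf (derive_sumvar v d) mxE; apply: eq_bigr => j _.
  by rewrite !mxE mulrC.
by rewrite /gradM /gradient invmx_metric mulmxDr !mulmxA !e11 !rE.
Qed.

Lemma tangent_frame q v :
  v = inner eps phi q v (E1 q) *: E1 q + inner eps phi q v (E2 q) *: E2 q.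
Proof.
have e11 (A : 'M[R]_1) (w : 'rV[R]_2) : A *m w = A 0 0 *: w.
  by rewrite {1}[A]mx11_scalar mul_scalar_mx.
have Gu := metric_unit (pt_cimg q).
by rewrite -{1}(mulmxK Gu v) [invmx _]invmx_metric mulmxDr !mulmxA !e11.
Qed.

Lemma Dsurf_frame {W : normedModType R} (u : M -> W) q v : smooth_on_surface u ->
  Dsurf u q v = inner eps phi q v (E1 q) *: der E1 u q
              + inner eps phi q v (E2 q) *: der E2 u q.
Proof.
move=> su; have vE := tangent_frame q v.
apply: etrans (congr1 (Dsurf u q) vE) _.
apply: etrans (DsurfDvar _ _ _ su) _.
by congr (_ + _); exact: DsurfZvar.
Qed.

Lemma nu_perp q v : << Dsurf phi q v, nu q >> = 0.
Proof.
rewrite dotZr; have [->|e0] := eqVneq eps 0; first by rewrite mul0r.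
have cst : (fun q => << phi q, phi q >>) = (fun=> eps^-1).
  apply/funext => p; have [_ /(_ p) + _] := himm.
  by rewrite /N4 /= (negPf e0) => -[].
have := Dsurf_dot eps q v sphi sphi; rewrite cst Dsurf_cst [X in _ = _ + X]dotC.
move=> /esym/eqP; rewrite -mulr2n mulrn_eq0 /= => /eqP ->.
by rewrite mulr0.
Qed.

Lemma nu_norm q : << nu q, nu q >> = eps.
Proof.
rewrite dotZl dotZr; have [->|e0] := eqVneq eps 0; first by rewrite mul0r.
have [_ /(_ q) + _] := himm; rewrite /N4 /= (negPf e0) => -[-> _].
by rewrite divff // mulr1.
Qed.

Lemma coord0_Dsurf (Z : M -> 'rV[R]_5) q v : smooth_on_surface Z ->
  (forall p, Z p 0 0 = 0) -> Dsurf Z q v 0 0 = 0.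
Proof.
move=> sZ Z0; rewrite Dsurf_row // (_ : (fun p => _) = (fun=> 0)) ?Dsurf_cst //.
by apply/funext => p; exact: Z0.
Qed.

Lemma coord0_phi q : eps = 0 -> phi q 0 0 = 0.
Proof. by move=> e0; have [_ /(_ q) + _] := himm; rewrite /N4 /= e0 eqxx. Qed.

Lemma coord0_Y X q : eps = 0 -> der X phi q 0 0 = 0.
Proof. by move=> e0; apply: coord0_Dsurf => // p; exact: coord0_phi. Qed.

(** The normal space of the surface in N^4 is the orthogonal complement of Y1, Y2
   and, for eps <> 0, of the position vector. *)
Definition normal_component q : 'rV[R]_5 -> 'rV[R]_5 :=
  normal_projection eps (Y1 q) (Y2 q) (nu q) (phi q).

Lemma nproj_linear q : linear (normal_component q).
Proof. exact: normal_projection_linear. Qed.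

Lemma nproj_tangent q v : normal_component q (Dsurf phi q v) = 0.
Proof.
have [h1 h2 h3] := Y_orthonormal q.
rewrite /normal_component /normal_projection nu_perp scale0r subr0.
rewrite (Dsurf_frame q v sphi); move: h1 h2 h3; move: (Y1 q) (Y2 q) => y1 y2 h1 h2 h3.
rewrite !dotDl !dotZl h1 h2 h3 (dotC _ y2) h3 !mulr0 !mulr1 addr0 add0r.
by rewrite addrAC addrK subrr.
Qed.

Lemma normal_part_proj q (w : 'rV[R]_5) :
  normal_part eps (loc q phi) (pt q) (proj_N4 eps (phi q) w) = normal_component q w.
Proof.
rewrite normal_part_frame /proj_N4 /normal_component /normal_projection.
have p1 : << nu q, Y1 q >> = 0 by rewrite dotC; exact: nu_perp.
have p2 : << nu q, Y2 q >> = 0 by rewrite dotC; exact: nu_perp.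
move: p1 p2; move: (Y1 q) (Y2 q) (phi q) => y1 y2 ph.
rewrite !dotZl => p1 p2.
have e1 : eps * << w, ph >> * << ph, y1 >> = 0 by rewrite mulrAC p1 mul0r.
have e2 : eps * << w, ph >> * << ph, y2 >> = 0 by rewrite mulrAC p2 mul0r.
rewrite !dotBl !dotZl e1 e2 !subr0 dotZr.
by rewrite -!addrA; congr (_ + _); rewrite addrC -!addrA.
Qed.

Lemma secondB_bilinear q v w : secondB eps phi q v w =
  \sum_i \sum_j (v 0 i * w 0 j) *: secondB eps phi q (e_ i) (e_ j).
Proof.
have E v' w' : secondB eps phi q v' w' =
    normal_component q ('D_v' (fun y => 'D_w' (loc q phi) y) (pt q)).
  rewrite -normal_part_proj /secondB /second_form /ambient_conn.
  by rewrite {2}/loc /= cinvK.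
have lin := nproj_linear q.
apply: etrans (E v w) _.
apply: etrans (congr1 (normal_component q) (D2_sum (open_cimg q) (sphi q) v w (pt_cimg q))) _.
rewrite (linear_of_sum lin); apply: eq_bigr => i _.
rewrite (linear_of_sum lin); apply: eq_bigr => j _.
rewrite (linear_ofZ lin); congr (_ *: _); exact: esym (E _ _).
Qed.

(** Extending a tangent vector to a field changes the second derivative by a
   tangent vector only. *)
Lemma secondBE X q v : smooth_field X ->
  secondB eps phi q v (X q) = normal_component q (Dsurf (der X phi) q v).
Proof.
move=> sX; have lin := nproj_linear q.
rewrite (Dsurf_der_row q v sX sphi) (linear_ofD lin) nproj_tangent add0r.
rewrite -normal_part_proj /secondB /second_form /ambient_conn.
by rewrite {2}/loc /= cinvK.
Qed.

Lemma nabla_perpE (Z : M -> 'rV[R]_5) q v :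
  nabla_perp eps phi Z q v = normal_component q (Dsurf Z q v).
Proof.
rewrite -normal_part_proj /nabla_perp /normal_conn /ambient_conn.
by rewrite {2}/loc /= cinvK.
Qed.

Lemma secondB_suml q v w :
  secondB eps phi q v w = \sum_i v 0 i *: secondB eps phi q (e_ i) w.
Proof. exact: double_sum_left (secondB_bilinear q) v w. Qed.

Lemma secondB_sumr q v w :
  secondB eps phi q v w = \sum_j w 0 j *: secondB eps phi q v (e_ j).
Proof. exact: double_sum_right (secondB_bilinear q) v w. Qed.

Lemma shapeAE q eta v w :
  << Dsurf phi q (shapeA eps phi q eta v), Dsurf phi q w >> =
  << secondB eps phi q v w, eta >>.
Proof.
apply: etrans (row_invmxE (sphi q) (@metric_unit q) w (pt_cimg q) (erefl _)) _.
rewrite mxE (secondB_sumr q v w) dot_suml; apply: eq_bigr => j _.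
by rewrite !mxE dotZl mulrC.
Qed.

Lemma nablaE X q v w : smooth_field X ->
  << Dsurf phi q (nabla eps phi X q v), Dsurf phi q w >> =
  << Dsurf (der X phi) q v, Dsurf phi q w >>.
Proof.
move=> sX; have dX := smooth_diff (sX q) (pt_cimg q).
apply: etrans (levi_civitaE (open_cimg q) (sphi q) (@metric_unit q) v w (pt_cimg q) dX) _.
apply: (congr1 (dot eps ^~ _)); apply: near_eq_derive.
apply: (open_near_eq (open_cimg q) _ (pt_cimg q)) => x ix.
exact: esym (loc_der X sphi ix).
Qed.

(** Normal parts are taken in the linear space: their component along the position
   vector is what contributes eps to the curvature. *)
Lemma gaussKE q : gaussK eps phi q =
  << normal_part eps (loc q phi) (pt q) (der E1 Y1 q),
     normal_part eps (loc q phi) (pt q) (der E2 Y2 q) >> -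
  << normal_part eps (loc q phi) (pt q) (der E1 Y2 q),
     normal_part eps (loc q phi) (pt q) (der E1 Y2 q) >>.
Proof.
have [h1 h2 h3] := ortho q.
have NE X v : smooth_field X ->
    normal_part eps (loc q phi) (pt q) ('D_v (fun y => 'D_(X q) (loc q phi) y) (pt q)) =
    normal_part eps (loc q phi) (pt q) (Dsurf (der X phi) q v).
  move=> sX; have lin := normal_part_linear eps (sphi q) (pt_cimg q).
  rewrite (Dsurf_der_row q v sX sphi) (linear_ofD lin).
  have t w := normal_part_tangent (sphi q) (@metric_unit q) w (pt_cimg q).
  exact: esym (etrans (congr2 +%R (t _) (erefl _)) (add0r _)).
apply: etrans (gauss_equation_frame (open_cimg q) (sphi q) (@metric_unit q)
  (pt_cimg q) h1 h2 h3) _.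
exact: (congr2 (fun s t => s - t)
  (congr2 (dot eps) (NE E1 (E1 q) sE1) (NE E2 (E2 q) sE2))
  (congr2 (dot eps) (NE E2 (E1 q) sE2) (NE E2 (E1 q) sE2))).
Qed.

Lemma meanHE q : meanH eps phi q =
  2^-1 *: (normal_component q (der E1 Y1 q) + normal_component q (der E2 Y2 q)).
Proof.
rewrite /meanH metric_trace_frame; last exact: secondB_bilinear.
by rewrite !secondBE.
Qed.

Lemma smooth_nproj (Z : M -> 'rV[R]_5) : smooth_on_surface Z ->
  smooth_on_surface (fun q => normal_component q (Z q)).
Proof.
move=> sZ; have s1 := smooth_Y1; have s2 := smooth_Y2.
have sn : smooth_on_surface (fun q => nu q).
  by apply: msmoothZ => //; exact: msmooth_cst.
apply: msmoothB; [apply: msmoothB; [apply: msmoothB => //|]|].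
- by apply: msmoothZ => //; exact: msmooth_dot.
- by apply: msmoothZ => //; exact: msmooth_dot.
- by apply: msmoothZ => //; exact: msmooth_dot.
Qed.

Lemma smooth_meanH : smooth_on_surface (meanH eps phi).
Proof.
have -> : meanH eps phi = fun q => 2^-1 *: (normal_component q (der E1 Y1 q) + normal_component q (der E2 Y2 q)).
  by apply/funext => q; exact: meanHE.
apply: (@msmoothZ _ _ _ (fun=> 2^-1)); first exact: msmooth_cst.
apply: msmoothD; apply: smooth_nproj; apply: msmooth_der_row => //.
  exact: smooth_Y1.
exact: smooth_Y2.
Qed.

End FrameOnSurface.

(** * Structure equations of the adapted frame *)

Section AdaptedFrame.
Context {R : realType} (eps : R) {M : surface R} (phi : M -> 'rV[R]_5).
Context (E1 E2 : M -> 'rV[R]_2) (E4 : M -> 'rV[R]_5)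
  (k1 k2 alpha a1 a2 b1 b2 : M -> R).
Hypothesis himm : immersion_in_N4 eps phi.
Hypothesis hcmc : forall p, exists v,
  shapeA eps phi p (E3 eps phi p) v != meanf eps phi p *: v.
Hypothesis hframe : adapted_frame eps phi E1 E2 E4 k1 k2 alpha a1 a2 b1 b2.
Local Notation "<< u , v >>" := (dot eps u v).
Local Notation Y1 := (der E1 phi).
Local Notation Y2 := (der E2 phi).
Local Notation H := (meanH eps phi).
Local Notation f := (meanf eps phi).
Local Notation e3 := (E3 eps phi).
Local Notation nu q := (eps *: phi q).
Local Notation nproj := (normal_component eps phi E1 E2).
Implicit Types (p q : M).

Let sE1 : smooth_field E1 := frame_smooth1 hframe.
Let sE2 : smooth_field E2 := frame_smooth2 hframe.
Let ortho := frame_orthonormal hframe.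
Let sphi : smooth_on_surface phi := smooth_phi himm.
Let sY1 : smooth_on_surface Y1 := smooth_Y1 himm sE1.
Let sY2 : smooth_on_surface Y2 := smooth_Y2 himm sE2.
Let sH : smooth_on_surface H := smooth_meanH himm sE1 sE2 ortho.
Let Yon q : [/\ << Y1 q, Y1 q >> = 1, << Y2 q, Y2 q >> = 1 & << Y1 q, Y2 q >> = 0]
  := Y_orthonormal himm ortho q.
Let HE q : H q = 2^-1 *: (nproj q (der E1 Y1 q) + nproj q (der E2 Y2 q))
  := meanHE himm sE1 sE2 ortho q.

(** If f q = 0, then E3 q = 0 and its shape operator vanishes, so that q is umbilic. *)
Lemma meanf_gt0 q : 0 < f q.
Proof.
rewrite lt_neqAle sqrtr_ge0 andbT eq_sym; apply/eqP => f0.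
have [v] := hcmc q; rewrite f0 scale0r /E3 f0 invr0 scale0r /shapeA /shape_op.
rewrite (_ : \row_j _ = 0) ?mul0mx ?eqxx //.
by apply/rowP => j; rewrite !mxE dot0r.
Qed.

Lemma meanH_norm q : << H q, H q >> = f q ^+ 2.
Proof.
have := meanf_gt0 q; rewrite /meanf sqrtr_gt0 => h.
by rewrite sqr_sqrtr // ltW.
Qed.

Lemma smooth_meanf : smooth_on_surface f.
Proof.
apply: msmooth_sqrt; last exact: msmooth_dot.
by move=> q; rewrite meanH_norm exprn_gt0 // meanf_gt0.
Qed.

Lemma smooth_E3 : smooth_on_surface e3.
Proof.
apply: msmoothZ => //; apply: msmoothV; last exact: smooth_meanf.
by move=> q; rewrite gt_eqF // meanf_gt0.
Qed.

Let sf := smooth_meanf.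
Let s3 := smooth_E3.
Let s4 : smooth_on_surface E4 := frame_smooth4 hframe.

Lemma meanHE3 q : H q = f q *: e3 q.
Proof. by rewrite /E3 scalerA divff ?scale1r // gt_eqF // meanf_gt0. Qed.

Let nproj_perp q (w : 'rV[R]_5) :
  [/\ << nproj q w, Y1 q >> = 0, << nproj q w, Y2 q >> = 0 & << nproj q w, nu q >> = 0].
Proof.
have [h1 h2 h3] := Yon q; apply: normal_projection_perp => //.
- exact: nu_perp himm q (E1 q).
- exact: nu_perp himm q (E2 q).
- exact: nu_norm himm q.
Qed.

Let dot_half (u v w : 'rV[R]_5) : << u, w >> = 0 -> << v, w >> = 0 ->
  << 2^-1 *: (u + v), w >> = 0.
Proof. by move=> uw vw; rewrite dotZl dotDl uw vw addr0 mulr0. Qed.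

Let e3_perp q : [/\ << e3 q, Y1 q >> = 0, << e3 q, Y2 q >> = 0 & << e3 q, nu q >> = 0].
Proof.
have [p1 p2 p3] := nproj_perp q (der E1 Y1 q).
have [q1 q2 q3] := nproj_perp q (der E2 Y2 q).
by rewrite /E3 HE; split; rewrite dotZl dot_half // mulr0.
Qed.

Let E4_perp q : [/\ << E4 q, Y1 q >> = 0, << E4 q, Y2 q >> = 0 & << E4 q, nu q >> = 0].
Proof.
have [t4 p4] := frame_normal4 hframe q; split; [exact: p4|exact: p4|].
rewrite dotZr; move: t4; rewrite /tangent_N4; have [->|e0 ->] := eqVneq eps 0.
  by rewrite mul0r.
by rewrite mulr0.
Qed.

Lemma adapted_moving_frame q : moving_frame eps (Y1 q) (Y2 q) (e3 q) (E4 q) (nu q).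
Proof.
have [h1 h2 h3] := Yon q; have [p1 p2 p3] := e3_perp q.
have [q1 q2 q3] := E4_perp q.
apply: MovingFrame.
- exact: h1.
- exact: h2.
- rewrite /E3 dotZl dotZr meanH_norm; have := meanf_gt0 q => f0.
  by field; rewrite gt_eqF.
- exact: frame_unit4 hframe q.
- exact: nu_norm himm q.
- exact: h3.
- exact: etrans (dotC _ _ _) p1.
- exact: etrans (dotC _ _ _) q1.
- exact: nu_perp himm q (E1 q).
- exact: etrans (dotC _ _ _) p2.
- exact: etrans (dotC _ _ _) q2.
- exact: nu_perp himm q (E2 q).
- exact: frame_orth34 hframe q.
- exact: p3.
- exact: q3.
Qed.
Let mf := adapted_moving_frame.

Local Notation comb q := (frame_comb (Y1 q) (Y2 q) (e3 q) (E4 q) (nu q)).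

Lemma coord0_frame q : eps = 0 ->
  [/\ Y1 q 0 0 = 0, Y2 q 0 0 = 0, e3 q 0 0 = 0 & E4 q 0 0 = 0].
Proof.
move=> e0; have y1 p := coord0_Y himm E1 p e0.
have y2 p := coord0_Y himm E2 p e0.
split=> //.
  have y11 := coord0_Dsurf q (E1 q) sY1 y1; have y22 := coord0_Dsurf q (E2 q) sY2 y2.
  rewrite /E3 HE /normal_component /normal_projection.
  move: y11 y22 (y1 q) (y2 q) (coord0_phi himm q e0).
  rewrite -/(der E1 Y1 q) -/(der E2 Y2 q).
  move: (der E1 Y1 q) (der E2 Y2 q) (Y1 q) (Y2 q) (phi q) (f q) => w1 w2 z1 z2 ph c.
  move=> h1 h2 h3 h4 h5; rewrite !mxE h1 h2 h3 h4 h5; ring.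
by have [+ _] := frame_normal4 hframe q; rewrite /tangent_N4 e0 eqxx.
Qed.

(** For eps = 0 the product with nu carries no information; the vanishing of the
   coordinate 0 replaces it. *)
Lemma Dsurf_comb (Z : M -> 'rV[R]_5) q v c1 c2 c3 c4 c5 : smooth_on_surface Z ->
  (eps = 0 -> forall p, Z p 0 0 = 0) ->
  << Dsurf Z q v, Y1 q >> = c1 -> << Dsurf Z q v, Y2 q >> = c2 ->
  << Dsurf Z q v, e3 q >> = c3 -> << Dsurf Z q v, E4 q >> = c4 ->
  << Dsurf Z q v, nu q >> = eps * c5 ->
  Dsurf Z q v = comb q c1 c2 c3 c4 c5.
Proof.
move=> sZ Z0 <- <- <- <-; rewrite dotZr => h5; apply: frame_expansion => //.
move=> e0; have [? ? ? ?] := coord0_frame q e0; split=> //.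
by apply: coord0_Dsurf => //; exact: Z0.
Qed.

Let dot_const (Z W : M -> 'rV[R]_5) c q v : smooth_on_surface Z ->
  smooth_on_surface W -> (forall p, << Z p, W p >> = c) ->
  << Dsurf Z q v, W q >> = - << Z q, Dsurf W q v >>.
Proof.
move=> sZ sW ZW; apply/eqP; rewrite -addr_eq0 -Dsurf_dot //; apply/eqP.
by rewrite (_ : (fun p => _) = (fun=> c)) ?Dsurf_cst //; apply/funext.
Qed.

Let self_dot (Z : M -> 'rV[R]_5) c q v : smooth_on_surface Z ->
  (forall p, << Z p, Z p >> = c) -> << Dsurf Z q v, Z q >> = 0.
Proof.
move=> sZ ZZ; have := dot_const q v sZ sZ ZZ; rewrite [in RHS]dotC.
move: << _, _ >> => r; lra.
Qed.

Let snu : smooth_on_surface (fun q => nu q).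
Proof. by apply: msmoothZ => //; exact: msmooth_cst. Qed.

Let Dnu q v : Dsurf (fun q => nu q) q v = eps *: Dsurf phi q v.
Proof.
have := DsurfZ q v (msmooth_cst eps) sphi.
by rewrite Dsurf_cst scale0r add0r.
Qed.

Let nu_dot (Z : M -> 'rV[R]_5) q v : smooth_on_surface Z ->
  (forall p, << Z p, nu p >> = 0) ->
  << Dsurf Z q v, nu q >> = eps * - << Z q, Dsurf phi q v >>.
Proof.
move=> sZ Zn; rewrite (dot_const q v sZ snu Zn) Dnu dotZr mulrN.
by [].
Qed.

Let sn1 p : << Y1 p, nu p >> = 0. Proof. exact: mf15 (mf p). Qed.
Let sn2 p : << Y2 p, nu p >> = 0. Proof. exact: mf25 (mf p). Qed.
Let sn3 p : << e3 p, nu p >> = 0. Proof. exact: mf35 (mf p). Qed.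
Let sn4 p : << E4 p, nu p >> = 0. Proof. exact: mf45 (mf p). Qed.

Let nproj_dot q (w eta : 'rV[R]_5) :
  << eta, Y1 q >> = 0 -> << eta, Y2 q >> = 0 -> << eta, nu q >> = 0 ->
  << nproj q w, eta >> = << w, eta >>.
Proof. exact: normal_projection_dot. Qed.

Let shape_dot (eta : 'rV[R]_5) X q v : smooth_field X ->
  << eta, Y1 q >> = 0 -> << eta, Y2 q >> = 0 -> << eta, nu q >> = 0 ->
  << Dsurf phi q (shapeA eps phi q eta v), der X phi q >> =
  << Dsurf (der X phi) q v, eta >>.
Proof.
move=> sX h1 h2 h3; apply: etrans (shapeAE himm ortho q eta v (X q)) _.
rewrite (secondBE himm ortho q v sX); exact: nproj_dot.
Qed.

Let shape3 X q v k w : smooth_field X -> shapeA eps phi q (e3 q) v = k *: w ->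
  << Dsurf (der X phi) q v, e3 q >> = k * << Dsurf phi q w, der X phi q >>.
Proof.
move=> sX E; have [h1 h2 h3] := e3_perp q; rewrite -(shape_dot _ sX h1 h2 h3) E.
by rewrite (DsurfZvar _ _ _ sphi) dotZl.
Qed.

Let shape4 X q v k w : smooth_field X -> shapeA eps phi q (E4 q) v = k *: w ->
  << Dsurf (der X phi) q v, E4 q >> = k * << Dsurf phi q w, der X phi q >>.
Proof.
move=> sX E; have [h1 h2 h3] := E4_perp q; rewrite -(shape_dot _ sX h1 h2 h3) E.
by rewrite (DsurfZvar _ _ _ sphi) dotZl.
Qed.

Let Y11 q : << Y1 q, Y1 q >> = 1. Proof. by case: (Yon q). Qed.
Let Y22 q : << Y2 q, Y2 q >> = 1. Proof. by case: (Yon q). Qed.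
Let Y12 q : << Y1 q, Y2 q >> = 0. Proof. by case: (Yon q). Qed.
Let Y21 q : << Y2 q, Y1 q >> = 0. Proof. exact: etrans (dotC _ _ _) (Y12 q). Qed.

Let k11 q : << der E1 Y1 q, e3 q >> = k1 q.
Proof. by apply: etrans (shape3 sE1 (frame_k1 hframe q)) _; rewrite Y11 mulr1. Qed.
Let k12 q : << der E1 Y2 q, e3 q >> = 0.
Proof. by apply: etrans (shape3 sE2 (frame_k1 hframe q)) _; rewrite Y12 mulr0. Qed.
Let k21 q : << der E2 Y1 q, e3 q >> = 0.
Proof. by apply: etrans (shape3 sE1 (frame_k2 hframe q)) _; rewrite Y21 mulr0. Qed.
Let k22 q : << der E2 Y2 q, e3 q >> = k2 q.
Proof. by apply: etrans (shape3 sE2 (frame_k2 hframe q)) _; rewrite Y22 mulr1. Qed.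

Let al11 q : << der E1 Y1 q, E4 q >> = alpha q.
Proof. by apply: etrans (shape4 sE1 (frame_alpha1 hframe q)) _; rewrite Y11 mulr1. Qed.
Let al12 q : << der E1 Y2 q, E4 q >> = 0.
Proof. by apply: etrans (shape4 sE2 (frame_alpha1 hframe q)) _; rewrite Y12 mulr0. Qed.
Let al21 q : << der E2 Y1 q, E4 q >> = 0.
Proof. by apply: etrans (shape4 sE1 (frame_alpha2 hframe q)) _; rewrite Y21 mulr0. Qed.
Let al22 q : << der E2 Y2 q, E4 q >> = - alpha q.
Proof. by apply: etrans (shape4 sE2 (frame_alpha2 hframe q)) _; rewrite Y22 mulr1. Qed.

Let g1 q : << der E1 Y1 q, Y2 q >> = - a1 q.
Proof.
apply: etrans (esym (nablaE himm ortho q (E1 q) (E2 q) sE1)) _.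
rewrite (frame_a1 hframe q) (DsurfZvar _ _ _ sphi) dotZl.
by apply: etrans (congr1 ( *%R (- a1 q)) (Y22 q)) _; rewrite mulr1.
Qed.

Let g2 q : << der E2 Y2 q, Y1 q >> = a2 q.
Proof.
apply: etrans (esym (nablaE himm ortho q (E2 q) (E1 q) sE2)) _.
rewrite (frame_a2 hframe q) (DsurfZvar _ _ _ sphi) dotZl.
by apply: etrans (congr1 ( *%R (a2 q)) (Y11 q)) _; rewrite mulr1.
Qed.

Let beta1 q : << der E1 e3 q, E4 q >> = b1 q.
Proof.
have [h1 h2 h3] := E4_perp q; rewrite (frame_b1 hframe q).
by rewrite (nabla_perpE himm ortho e3 q (E1 q)) nproj_dot.
Qed.

Let beta2 q : << der E2 e3 q, E4 q >> = b2 q.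
Proof.
have [h1 h2 h3] := E4_perp q; rewrite (frame_b2 hframe q).
by rewrite (nabla_perpE himm ortho e3 q (E2 q)) nproj_dot.
Qed.

Let c0Y1 : eps = 0 -> forall p, Y1 p 0 0 = 0.
Proof. by move=> e0 p; case: (coord0_frame p e0). Qed.
Let c0Y2 : eps = 0 -> forall p, Y2 p 0 0 = 0.
Proof. by move=> e0 p; case: (coord0_frame p e0). Qed.
Let c03 : eps = 0 -> forall p, e3 p 0 0 = 0.
Proof. by move=> e0 p; case: (coord0_frame p e0). Qed.
Let c04 : eps = 0 -> forall p, E4 p 0 0 = 0.
Proof. by move=> e0 p; case: (coord0_frame p e0). Qed.

Let mf33' q : << e3 q, e3 q >> = 1. Proof. exact: mf33 (mf q). Qed.
Let mf44' q : << E4 q, E4 q >> = 1. Proof. exact: mf44 (mf q). Qed.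
Let mf43' q : << E4 q, e3 q >> = 0. Proof. by rewrite dotC; exact: mf34 (mf q). Qed.
Let e31 q : << e3 q, Y1 q >> = 0. Proof. by case: (e3_perp q). Qed.
Let e32 q : << e3 q, Y2 q >> = 0. Proof. by case: (e3_perp q). Qed.
Let e41 q : << E4 q, Y1 q >> = 0. Proof. by case: (E4_perp q). Qed.
Let e42 q : << E4 q, Y2 q >> = 0. Proof. by case: (E4_perp q). Qed.

(** The structure equations. The components that are not given by the definitions of
   the k_i, alpha, the a_i and the b_i follow by differentiating the constant products of
   two frame vectors. *)
Lemma structure11 q : der E1 Y1 q = comb q 0 (- a1 q) (k1 q) (alpha q) (- 1).
Proof.
apply: (Dsurf_comb sY1 c0Y1 _ (g1 q) (k11 q) (al11 q)).
  exact: (self_dot _ _ sY1 Y11).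
apply: etrans (nu_dot q (E1 q) sY1 sn1) _.
exact: (congr1 (fun r => eps * - r) (Y11 q)).
Qed.

Lemma structure12 q : der E1 Y2 q = comb q (a1 q) 0 0 0 0.
Proof.
apply: (Dsurf_comb sY2 c0Y2 _ _ (k12 q) (al12 q)).
- apply: etrans (dot_const q (E1 q) sY2 sY1 Y21) _.
  by apply: etrans (congr1 -%R (etrans (dotC _ _ _) (g1 q))) _; rewrite opprK.
- exact: (self_dot _ _ sY2 Y22).
apply: etrans (nu_dot q (E1 q) sY2 sn2) _.
by apply: etrans (congr1 (fun r => eps * - r) (Y21 q)) _; rewrite oppr0.
Qed.

Lemma structure21 q : der E2 Y1 q = comb q 0 (- a2 q) 0 0 0.
Proof.
apply: (Dsurf_comb sY1 c0Y1 _ _ (k21 q) (al21 q)).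
- exact: (self_dot _ _ sY1 Y11).
- apply: etrans (dot_const q (E2 q) sY1 sY2 Y12) _.
  exact: (congr1 -%R (etrans (dotC _ _ _) (g2 q))).
apply: etrans (nu_dot q (E2 q) sY1 sn1) _.
by apply: etrans (congr1 (fun r => eps * - r) (Y12 q)) _; rewrite oppr0.
Qed.

Lemma structure22 q : der E2 Y2 q = comb q (a2 q) 0 (k2 q) (- alpha q) (- 1).
Proof.
apply: (Dsurf_comb sY2 c0Y2 (g2 q) _ (k22 q) (al22 q)).
  exact: (self_dot _ _ sY2 Y22).
apply: etrans (nu_dot q (E2 q) sY2 sn2) _.
exact: (congr1 (fun r => eps * - r) (Y22 q)).
Qed.

Lemma structure13 q : der E1 e3 q = comb q (- k1 q) 0 0 (b1 q) 0.
Proof.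
apply: (Dsurf_comb s3 c03 _ _ _ (beta1 q)).
- apply: etrans (dot_const q (E1 q) s3 sY1 e31) _.
  exact: (congr1 -%R (etrans (dotC _ _ _) (k11 q))).
- apply: etrans (dot_const q (E1 q) s3 sY2 e32) _.
  by apply: etrans (congr1 -%R (etrans (dotC _ _ _) (k12 q))) _; rewrite oppr0.
- exact: (self_dot _ _ s3 mf33').
apply: etrans (nu_dot q (E1 q) s3 sn3) _.
by apply: etrans (congr1 (fun r => eps * - r) (e31 q)) _; rewrite oppr0.
Qed.

Lemma structure23 q : der E2 e3 q = comb q 0 (- k2 q) 0 (b2 q) 0.
Proof.
apply: (Dsurf_comb s3 c03 _ _ _ (beta2 q)).
- apply: etrans (dot_const q (E2 q) s3 sY1 e31) _.
  by apply: etrans (congr1 -%R (etrans (dotC _ _ _) (k21 q))) _; rewrite oppr0.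
- apply: etrans (dot_const q (E2 q) s3 sY2 e32) _.
  exact: (congr1 -%R (etrans (dotC _ _ _) (k22 q))).
- exact: (self_dot _ _ s3 mf33').
apply: etrans (nu_dot q (E2 q) s3 sn3) _.
by apply: etrans (congr1 (fun r => eps * - r) (e32 q)) _; rewrite oppr0.
Qed.

Lemma structure14 q : der E1 E4 q = comb q (- alpha q) 0 (- b1 q) 0 0.
Proof.
apply: (Dsurf_comb s4 c04).
- apply: etrans (dot_const q (E1 q) s4 sY1 e41) _.
  exact: (congr1 -%R (etrans (dotC _ _ _) (al11 q))).
- apply: etrans (dot_const q (E1 q) s4 sY2 e42) _.
  by apply: etrans (congr1 -%R (etrans (dotC _ _ _) (al12 q))) _; rewrite oppr0.
- apply: etrans (dot_const q (E1 q) s4 s3 mf43') _.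
  exact: (congr1 -%R (etrans (dotC _ _ _) (beta1 q))).
- exact: (self_dot _ _ s4 mf44').
apply: etrans (nu_dot q (E1 q) s4 sn4) _.
by apply: etrans (congr1 (fun r => eps * - r) (e41 q)) _; rewrite oppr0.
Qed.

Lemma structure24 q : der E2 E4 q = comb q 0 (alpha q) (- b2 q) 0 0.
Proof.
apply: (Dsurf_comb s4 c04).
- apply: etrans (dot_const q (E2 q) s4 sY1 e41) _.
  by apply: etrans (congr1 -%R (etrans (dotC _ _ _) (al21 q))) _; rewrite oppr0.
- apply: etrans (dot_const q (E2 q) s4 sY2 e42) _.
  by apply: etrans (congr1 -%R (etrans (dotC _ _ _) (al22 q))) _; rewrite opprK.
- apply: etrans (dot_const q (E2 q) s4 s3 mf43') _.
  exact: (congr1 -%R (etrans (dotC _ _ _) (beta2 q))).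
- exact: (self_dot _ _ s4 mf44').
apply: etrans (nu_dot q (E2 q) s4 sn4) _.
by apply: etrans (congr1 (fun r => eps * - r) (e42 q)) _; rewrite oppr0.
Qed.

End AdaptedFrame.

(** * Biconservative, Codazzi and Gauss equations *)

Section RealAlgebra.
Context {R : realType}.
Implicit Types (k g x y z al s t : R).

Lemma half_sum_eq0 k g x y z al s t :
  2 * (k * x + al * (g * s) + (0 * z + 0 * t)) + (2 * g * x * 1 + 2 * g * y * 0) = 0 ->
  (k + g) * x + g * (al * s) = 0.
Proof. by move=> h; lra. Qed.

Lemma half_diff_eq0 k g x y z al s t :
  2 * (0 * z + 0 * t + (k * x + - al * (g * s))) + (2 * g * y * 0 + 2 * g * x * 1) = 0 ->
  (k + g) * x - g * (al * s) = 0.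
Proof. by move=> h; lra. Qed.

Lemma dot_linear_combination (eps : R) (D : 'rV[R]_2 -> 'rV[R]_5) m v v1 v2 (w : 'rV[R]_5)
    (r c1 c2 : R) :
  (forall a b, D (a + b) = D a + D b) -> (forall c a, D (c *: a) = c *: D a) ->
  dot eps (D (2 *: m + v)) w = 0 -> dot eps (D m) w = r -> v = c1 *: v1 + c2 *: v2 ->
  2 * r + (c1 * dot eps (D v1) w + c2 * dot eps (D v2) w) = 0.
Proof. by move=> DD DZ h <- vE; move: h; rewrite vE !DD !DZ !dotDl !dotZl. Qed.

Lemma additive_sub (D : 'rV[R]_2 -> 'rV[R]_5) v w :
  (forall a b, D (a + b) = D a + D b) -> (forall c a, D (c *: a) = c *: D a) ->
  D (v - w) = D v - D w.
Proof. by move=> DD DZ; rewrite -(scaleN1r w) DD DZ scaleN1r. Qed.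

Lemma dot_commutator (eps : R) (u1 u2 u3 u4 w : 'rV[R]_5) (a b r1 r2 r3 r4 : R) :
  u1 - u2 = a *: u3 + b *: u4 -> dot eps u1 w = r1 -> dot eps u2 w = r2 ->
  dot eps u3 w = r3 -> dot eps u4 w = r4 -> r1 - r2 = a * r3 + b * r4.
Proof. by move=> E <- <- <- <-; rewrite -dotBl E dotDl !dotZl. Qed.

End RealAlgebra.

Section Consequences.
Context {R : realType} (eps : R) {M : surface R} (phi : M -> 'rV[R]_5).
Context (E1 E2 : M -> 'rV[R]_2) (E4 : M -> 'rV[R]_5)
  (k1 k2 alpha a1 a2 b1 b2 : M -> R).
Hypothesis himm : immersion_in_N4 eps phi.
Hypothesis hcmc : forall p, exists v,
  shapeA eps phi p (E3 eps phi p) v != meanf eps phi p *: v.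
Hypothesis hframe : adapted_frame eps phi E1 E2 E4 k1 k2 alpha a1 a2 b1 b2.
Local Notation "<< u , v >>" := (dot eps u v).
Local Notation Y1 := (der E1 phi).
Local Notation Y2 := (der E2 phi).
Local Notation H := (meanH eps phi).
Local Notation f := (meanf eps phi).
Local Notation e3 := (E3 eps phi).
Local Notation nu q := (eps *: phi q).
Local Notation nproj := (normal_component eps phi E1 E2).
Local Notation comb q := (frame_comb (Y1 q) (Y2 q) (e3 q) (E4 q) (nu q)).
Implicit Types (p q : M).

Let sE1 : smooth_field E1 := frame_smooth1 hframe.
Let sE2 : smooth_field E2 := frame_smooth2 hframe.
Let ortho := frame_orthonormal hframe.
Let sphi : smooth_on_surface phi := smooth_phi himm.
Let sY1 : smooth_on_surface Y1 := smooth_Y1 himm sE1.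
Let sY2 : smooth_on_surface Y2 := smooth_Y2 himm sE2.
Let sH : smooth_on_surface H := smooth_meanH himm sE1 sE2 ortho.
Let sf : smooth_on_surface f := smooth_meanf himm hcmc hframe.
Let s3 : smooth_on_surface e3 := smooth_E3 himm hcmc hframe.
Let s4 : smooth_on_surface E4 := frame_smooth4 hframe.
Let mf q := adapted_moving_frame himm hcmc hframe q.
Let S11 q := structure11 himm hcmc hframe q.
Let S12 q := structure12 himm hcmc hframe q.
Let S21 q := structure21 himm hcmc hframe q.
Let S22 q := structure22 himm hcmc hframe q.
Let S13 q := structure13 himm hcmc hframe q.
Let S23 q := structure23 himm hcmc hframe q.
Let S14 q := structure14 himm hcmc hframe q.
Let S24 q := structure24 himm hcmc hframe q.
Let d1 q c1 c2 c3 c4 c5 := comb_dot1 (mf q) c1 c2 c3 c4 c5.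
Let d2 q c1 c2 c3 c4 c5 := comb_dot2 (mf q) c1 c2 c3 c4 c5.
Let d3 q c1 c2 c3 c4 c5 := comb_dot3 (mf q) c1 c2 c3 c4 c5.
Let d4 q c1 c2 c3 c4 c5 := comb_dot4 (mf q) c1 c2 c3 c4 c5.

Let nproj_dot q (w eta : 'rV[R]_5) :
  << eta, Y1 q >> = 0 -> << eta, Y2 q >> = 0 -> << eta, nu q >> = 0 ->
  << nproj q w, eta >> = << w, eta >>.
Proof. exact: normal_projection_dot. Qed.

Let nproj_perp q (w : 'rV[R]_5) :
  [/\ << nproj q w, Y1 q >> = 0, << nproj q w, Y2 q >> = 0 & << nproj q w, nu q >> = 0].
Proof.
have [h11 h22 _ _ h55 h12 _ _ h15 _ _ h25 _ _ _] := mf q.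
exact: normal_projection_perp.
Qed.

Let p3 q : [/\ << e3 q, Y1 q >> = 0, << e3 q, Y2 q >> = 0 & << e3 q, nu q >> = 0].
Proof.
have [_ _ _ _ _ _ h13 _ _ h23 _ _ _ h35 _] := mf q.
by split=> //; apply: etrans (dotC _ _ _) _.
Qed.

Let p4 q : [/\ << E4 q, Y1 q >> = 0, << E4 q, Y2 q >> = 0 & << E4 q, nu q >> = 0].
Proof.
have [_ _ _ _ _ _ _ h14 _ _ h24 _ _ _ h45] := mf q.
by split=> //; apply: etrans (dotC _ _ _) _.
Qed.

Let dot11 q : << der E1 Y1 q, e3 q >> = k1 q.
Proof. exact: etrans (congr1 (dot eps ^~ _) (S11 q)) (d3 _ _ _ _ _ _). Qed.
Let dot22 q : << der E2 Y2 q, e3 q >> = k2 q.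
Proof. exact: etrans (congr1 (dot eps ^~ _) (S22 q)) (d3 _ _ _ _ _ _). Qed.

(** The trace of A_3 is 2 <H, E3>, and H = f E3. *)
Lemma trace_A3 q : k1 q + k2 q = 2 * f q.
Proof.
have [h1 h2 h3] := p3 q.
have e : << H q, e3 q >> = f q.
  by rewrite (meanHE3 hcmc) dotZl (mf33 (mf q)) mulr1.
have e' : << H q, e3 q >> = 2^-1 * (k1 q + k2 q).
  apply: etrans (congr1 (dot eps ^~ _) (meanHE himm sE1 sE2 ortho q)) _.
  apply: etrans (dotZl _ _ _ _) _; congr (_ * _).
  apply: etrans (dotDl _ _ _ _) _; congr (_ + _).
    exact: etrans (nproj_dot _ h1 h2 h3) (dot11 q).
  exact: etrans (nproj_dot _ h1 h2 h3) (dot22 q).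
by rewrite -e e' mulrA divff ?mul1r // pnatr_eq0.
Qed.

Lemma gaussK_frame q : gaussK eps phi q = k1 q * k2 q - alpha q ^+ 2 + eps.
Proof.
have NE w c1 c2 c3 c4 c5 : w = comb q c1 c2 c3 c4 c5 ->
    normal_part eps (loc q phi) (pt q) w = comb q 0 0 c3 c4 c5.
  move=> ->; apply: etrans (normal_part_frame himm ortho q _) _.
  rewrite d1 d2 /frame_comb.
  move: (Y1 q) (Y2 q) (e3 q) (E4 q) (nu q) => y1 y2 n3 n4 n5.
  by apply/rowP => j; rewrite !mxE; ring.
apply: etrans (gaussKE himm sE1 sE2 ortho q) _.
apply: etrans (congr2 (fun s t => s - t)
  (congr2 (dot eps) (NE _ _ _ _ _ _ (S11 q)) (NE _ _ _ _ _ _ (S22 q)))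
  (congr2 (dot eps) (NE _ _ _ _ _ _ (S12 q)) (NE _ _ _ _ _ _ (S12 q)))) _.
rewrite !(comb_dot (mf q)); ring.
Qed.

Let comb_dotl q (w : 'rV[R]_5) c1 c2 c3 c4 c5 : << comb q c1 c2 c3 c4 c5, w >> =
  c1 * << Y1 q, w >> + c2 * << Y2 q, w >> + c3 * << e3 q, w >> + c4 * << E4 q, w >>
  + c5 * << nu q, w >>.
Proof.
rewrite /frame_comb; move: (Y1 q) (Y2 q) (e3 q) (E4 q) (nu q) => y1 y2 n3 n4 n5.
by rewrite !dotDl !dotZl.
Qed.

Let DH q v : Dsurf H q v = Dsurf f q v *: e3 q + f q *: Dsurf e3 q v.
Proof.
apply: etrans _ (DsurfZ q v sf s3); apply: (congr1 (fun u => Dsurf u q v)).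
by apply/funext => p; exact: meanHE3 hcmc p.
Qed.

Let normal_derivative q (w z : 'rV[R]_5) c1 c2 c3 c4 c5 : w = comb q c1 c2 c3 c4 c5 ->
  << nproj q w, nproj q z >> = c3 * << z, e3 q >> + c4 * << z, E4 q >>.
Proof.
move=> ->; have [h1 h2 h3] := nproj_perp q z.
have [i1 i2 i3] := p3 q; have [j1 j2 j3] := p4 q.
rewrite nproj_dot // comb_dotl ![<< _, nproj q z >>]dotC h1 h2 h3 !nproj_dot //.
ring.
Qed.

(** The biconservative equation paired with Y1 and Y2. The trace of the shape operators
   in the directions of the normal derivatives of H = f E3 is read off from the second
   fundamental form. *)
Lemma biconservative_frame q : biconservative eps phi ->
  (k1 q + f q) * der E1 f q + f q * (alpha q * b1 q) = 0 /\
  (k2 q + f q) * der E2 f q - f q * (alpha q * b2 q) = 0.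
Proof.
move=> /(_ q) bc.
have s2 : smooth_on_surface (fun p => f p ^+ 2) by exact: msmoothX.
pose T v w := shapeA eps phi q (nabla_perp eps phi H q v) w.
have dot_bc X : << Dsurf phi q (2 *: metric_trace (metric eps phi q) T (pt q)
    + gradM eps phi (fun p => f p ^+ 2) q), der X phi q >> = 0.
  by rewrite bc -(scale0r (0 : 'rV[R]_2)) (DsurfZvar _ _ _ sphi) scale0r dot0l.
pose B X (v w : 'rV[R]_2) := << secondB eps phi q w (X q), nproj q (Dsurf H q v) >>.
have lin := nproj_linear eps phi E1 E2 q.
have BE X v w : B X v w = \sum_i \sum_j (v 0 i * w 0 j) *: B X (e_ i) (e_ j).
  have wl v' : B X v' w = \sum_j w 0 j * B X v' (e_ j).
    apply: etrans (congr1 (dot eps ^~ _) (secondB_suml himm ortho q w (X q))) _.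
    by apply: etrans (dot_suml _ _ _ _) _; apply: eq_bigr => j _; exact: dotZl.
  have Hs : nproj q (Dsurf H q v) = \sum_i v 0 i *: nproj q (Dsurf H q (e_ i)).
    have e := derive_sumvar v (smooth_loc_diff q sH).
    apply: etrans (congr1 (nproj q) e) _; apply: etrans (linear_of_sum lin _ _) _.
    by apply: eq_bigr => i _; exact: linear_ofZ lin _ _.
  have vl : B X v w = \sum_i v 0 i * B X (e_ i) w.
    apply: etrans (congr1 (dot eps _) Hs) _; apply: etrans (dotC _ _ _) _.
    apply: etrans (dot_suml _ _ _ _) _; apply: eq_bigr => i _.
    by apply: etrans (dotZl _ _ _ _) _; congr (_ * _); exact: dotC.
  rewrite vl; apply: eq_bigr => i _; rewrite wl mulr_sumr.
  by apply: eq_bigr => j _; rewrite mulrA.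
have traceT X : << Dsurf phi q (metric_trace (metric eps phi q) T (pt q)), der X phi q >>
    = B X (E1 q) (E1 q) + B X (E2 q) (E2 q).
  rewrite -(metric_trace_frame himm ortho q (BE X)) /metric_trace.
  have lD := smooth_loc_diff q sphi.
  rewrite {1}/Dsurf [LHS]/(dot _ _ _) -/(dot _ _ _).
  have sumD (I : Type) (r : seq I) (F : I -> 'rV[R]_2) :
      Dsurf phi q (\sum_(i <- r) F i) = \sum_(i <- r) Dsurf phi q (F i).
    rewrite /Dsurf deriveE // linear_sum; apply: eq_bigr => i _.
    by rewrite deriveE.
  rewrite -/(Dsurf phi q _) sumD dot_suml; apply: eq_bigr => i _.
  rewrite sumD dot_suml; apply: eq_bigr => j _.
  rewrite (DsurfZvar _ _ _ sphi) dotZl; congr (_ * _).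
  rewrite /T (shapeAE himm ortho) /B.
  by rewrite (nabla_perpE himm ortho H q (e_ i)).
have gradE : gradM eps phi (fun p => f p ^+ 2) q =
    (2 * f q * der E1 f q) *: E1 q + (2 * f q * der E2 f q) *: E2 q.
  rewrite (gradM_frame himm ortho q s2).
  have e X : der X (fun p => f p ^+ 2) q = 2 * f q * der X f q.
    rewrite /der (_ : (fun p => f p ^+ 2) = (fun p => f p * f p)); last first.
      by apply/funext => p; rewrite expr2.
    rewrite (DsurfM _ _ sf sf); ring.
  by rewrite !e.
have DHe3 v c1 c2 c4 c5 : Dsurf e3 q v = comb q c1 c2 0 c4 c5 ->
    << Dsurf H q v, e3 q >> = Dsurf f q v /\ << Dsurf H q v, E4 q >> = f q * c4.
  move=> De; have DHE := etrans (DH q v) (congr1 (fun w => Dsurf f q v *: e3 q + f q *: w) De).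
  split; apply: etrans (congr1 (dot eps ^~ _) DHE) _; rewrite dotDl (dotZl _ (Dsurf f q v)) (dotZl _ (f q)).
    by rewrite d3 (mf33 (mf q)); ring.
  by rewrite d4 (mf34 (mf q)); ring.
have [H13 H14] := DHe3 (E1 q) _ _ _ _ (S13 q).
have [H23 H24] := DHe3 (E2 q) _ _ _ _ (S23 q).
have BX X v w c1 c2 c3 c4 c5 r3 r4 : smooth_field X ->
    Dsurf (der X phi) q w = comb q c1 c2 c3 c4 c5 ->
    << Dsurf H q v, e3 q >> = r3 -> << Dsurf H q v, E4 q >> = r4 ->
    B X v w = c3 * r3 + c4 * r4.
  move=> sX Dw <- <-.
  apply: etrans (congr1 (dot eps ^~ _) (secondBE himm ortho q w sX)) _.
  exact: normal_derivative Dw.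
have DD v w : Dsurf phi q (v + w) = Dsurf phi q v + Dsurf phi q w by exact: DsurfDvar.
have DZ c v : Dsurf phi q (c *: v) = c *: Dsurf phi q v by exact: DsurfZvar.
split.
- have := dot_linear_combination DD DZ (dot_bc E1)
    (etrans (traceT E1) (congr2 (fun s t => s + t)
      (BX E1 (E1 q) (E1 q) _ _ _ _ _ _ _ sE1 (S11 q) H13 H14)
      (BX E1 (E2 q) (E2 q) _ _ _ _ _ _ _ sE1 (S21 q) H23 H24))) gradE.
  rewrite (mf11 (mf q)) (etrans (dotC _ _ _) (mf12 (mf q))) -/(der E1 f q).
  exact: half_sum_eq0.
- have := dot_linear_combination DD DZ (dot_bc E2)
    (etrans (traceT E2) (congr2 (fun s t => s + t)
      (BX E2 (E1 q) (E1 q) _ _ _ _ _ _ _ sE2 (S12 q) H13 H14)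
      (BX E2 (E2 q) (E2 q) _ _ _ _ _ _ _ sE2 (S22 q) H23 H24))) gradE.
  rewrite (mf12 (mf q)) (mf22 (mf q)) -/(der E2 f q).
  exact: half_diff_eq0.
Qed.

(** The map phi is an immersion, so that the bracket of E1 and E2 is known from its
   image E1 Y2 - E2 Y1, which the structure equations give. *)
Lemma frame_commutator (u : M -> R) q : smooth_on_surface u ->
  der E1 (der E2 u) q - der E2 (der E1 u) q = a1 q * der E1 u q + a2 q * der E2 u q.
Proof.
move=> su; pose br := 'D_(E1 q) (loc q (components (chart_at q) E2)) (pt q)
             - 'D_(E2 q) (loc q (components (chart_at q) E1)) (pt q).
have DD (V : normedModType R) (w : M -> V) v v' : smooth_on_surface w ->
  Dsurf w q (v + v') = Dsurf w q v + Dsurf w q v' by exact: DsurfDvar.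
have DZ (V : normedModType R) (w : M -> V) c v : smooth_on_surface w ->
  Dsurf w q (c *: v) = c *: Dsurf w q v by exact: DsurfZvar.
have Dbr : Dsurf phi q br = der E1 Y2 q - der E2 Y1 q.
  apply/rowP => j.
  have sj : smooth_on_surface (fun p => phi p 0 j) by have /msmooth_rowP := sphi; exact.
  rewrite (Dsurf_row q br j sphi) -(der_commutator q sE1 sE2 sj) !mxE.
  rewrite -(der_row E2 j sphi) -(der_row E1 j sphi).
  rewrite -(der_row E1 j sY2) -(der_row E2 j sY1).
  by [].
have brE : br = a1 q *: E1 q + a2 q *: E2 q.
  apply/eqP; rewrite -subr_eq0; apply/eqP.
  have [_ _ inj] := himm; apply: (inj q).
  apply: etrans (additive_sub _ _ (fun v v' => DD _ _ v v' sphi) (fun c v => DZ _ _ c v sphi)) _.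
  have e1 := etrans Dbr (congr2 (fun v w => v - w) (S12 q) (S21 q)).
  have e2 : Dsurf phi q (a1 q *: E1 q + a2 q *: E2 q) = a1 q *: Y1 q + a2 q *: Y2 q.
    by rewrite DD // !DZ.
  apply: etrans (congr2 (fun v w => v - w) e1 e2) _; rewrite /frame_comb.
  move: (Y1 q) (Y2 q) (e3 q) (E4 q) (nu q) => y1 y2 n3 n4 n5.
  by apply/rowP => j; rewrite !mxE; ring.
rewrite (der_commutator q sE1 sE2 su) -/br brE.
by apply: etrans (DD _ _ _ _ su) _; congr (_ + _); exact: DZ.
Qed.

Lemma frame_commutator_row m (u : M -> 'rV[R]_m) q : smooth_on_surface u ->
  der E1 (der E2 u) q - der E2 (der E1 u) q = a1 q *: der E1 u q + a2 q *: der E2 u q.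
Proof.
move=> su; apply/rowP => j.
have sj : smooth_on_surface (fun p => u p 0 j) by have /msmooth_rowP := su; exact.
have entry X Y : smooth_field Y ->
    der X (der Y u) q 0 j = der X (der Y (fun p => u p 0 j)) q.
  move=> sY; have e1 := congr1 (fun g => g q) (der_row X j (msmooth_der_row sY su)).
  exact: etrans e1 (congr1 (fun g => der X g q) (der_row Y j su)).
have entry1 X : der X u q 0 j = der X (fun p => u p 0 j) q.
  exact: (congr1 (fun g => g q) (der_row X j su)).
have rowB (v w : 'rV[R]_m) : (v - w) 0 j = v 0 j - w 0 j by rewrite !mxE.
have rowDZ (v w : 'rV[R]_m) a b : (a *: v + b *: w) 0 j = a * v 0 j + b * w 0 j.
  by rewrite !mxE.
apply: etrans (rowB _ _) (etrans _ (esym (rowDZ _ _ _ _))).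
apply: etrans (congr2 (fun a b => a - b) (entry E1 E2 sE2) (entry E2 E1 sE1)) _.
apply: etrans (frame_commutator q sj) _.
exact: esym (congr2 (fun a b => a1 q * a + a2 q * b) (entry1 E1) (entry1 E2)).
Qed.

(* The product rule for <Z, W> = g, solved for the term that differentiates Z. *)
Let dot_der X (Z W : M -> 'rV[R]_5) (g : M -> R) z w q :
  smooth_on_surface Z -> smooth_on_surface W ->
  (forall p, << Z p, W p >> = g p) -> Z q = z -> der X W q = w ->
  << der X Z q, W q >> = der X g q - << z, w >>.
Proof.
move=> sZ sW /funext <- <- <-; apply/eqP; rewrite eq_sym subr_eq; apply/eqP.
exact: Dsurf_dot.
Qed.

Let commutator_dot (Z : M -> 'rV[R]_5) (w : 'rV[R]_5) A B C D q : smooth_on_surface Z ->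
  << der E1 (der E2 Z) q, w >> = A -> << der E2 (der E1 Z) q, w >> = B ->
  << der E1 Z q, w >> = C -> << der E2 Z q, w >> = D ->
  A - B = a1 q * C + a2 q * D.
Proof.
by move=> sZ; exact: dot_commutator (frame_commutator_row q sZ).
Qed.

Let vdot (w z e : 'rV[R]_5) (r : R) : w = z -> << z, e >> = r -> << w, e >> = r.
Proof. by move=> ->. Qed.

Let s21 : smooth_on_surface (der E2 Y1) := msmooth_der_row sE2 sY1.
Let s22 : smooth_on_surface (der E2 Y2) := msmooth_der_row sE2 sY2.
Let s11 : smooth_on_surface (der E1 Y1) := msmooth_der_row sE1 sY1.
Let s12 : smooth_on_surface (der E1 Y2) := msmooth_der_row sE1 sY2.

Let c11 q (e : 'rV[R]_5) r := @vdot _ _ e r (S11 q).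
Let c12 q (e : 'rV[R]_5) r := @vdot _ _ e r (S12 q).
Let c21 q (e : 'rV[R]_5) r := @vdot _ _ e r (S21 q).
Let c22 q (e : 'rV[R]_5) r := @vdot _ _ e r (S22 q).

Lemma smooth_alpha : smooth_on_surface alpha.
Proof.
suff -> : alpha = fun q => << der E1 Y1 q, E4 q >> by exact: msmooth_dot.
by apply/funext => q; exact: esym (c11 (d4 _ _ _ _ _ _)).
Qed.

Lemma smooth_a2 : smooth_on_surface a2.
Proof.
suff -> : a2 = fun q => << der E2 Y2 q, Y1 q >> by exact: msmooth_dot.
by apply/funext => q; exact: esym (c22 (d1 _ _ _ _ _ _)).
Qed.

Let der0 X q : der X (fun=> 0 : R) q = 0.
Proof. exact: Dsurf_cst. Qed.

Let derN X (g : M -> R) q : smooth_on_surface g ->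
  der X (fun p => - g p) q = - der X g q.
Proof.
move=> sg; have := DsurfM q (X q) (msmooth_cst (-1 : R)) sg.
rewrite Dsurf_cst mul0r add0r mulN1r => <-.
apply: (congr1 (fun h => Dsurf h q (X q))); apply/funext => p.
by rewrite mulN1r.
Qed.

(** The Codazzi and Gauss equations are components of the commutator relation
   applied to the tangent frame; the digits ij stand for the component of
   [E1, E2] Yi along the j-th frame vector. *)
Lemma codazzi13 q : - der E2 k1 q + alpha q * b2 q = a1 q * (k1 q - k2 q).
Proof.
have := commutator_dot sY1
  (dot_der (X := E1) (g := fun=> 0) s21 s3 (fun p => c21 (d3 p _ _ _ _ _)) (S21 q) (S13 q))
  (dot_der (X := E2) (g := k1) s11 s3 (fun p => c11 (d3 p _ _ _ _ _)) (S11 q) (S23 q))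
  (c11 (d3 q _ _ _ _ _)) (c21 (d3 q _ _ _ _ _)).
rewrite der0 !(comb_dot (mf q)); lra.
Qed.

Lemma codazzi14 q : der E2 alpha q + k1 q * b2 q = - 2 * a1 q * alpha q.
Proof.
have := commutator_dot sY1
  (dot_der (X := E1) (g := fun=> 0) s21 s4 (fun p => c21 (d4 p _ _ _ _ _)) (S21 q) (S14 q))
  (dot_der (X := E2) (g := alpha) s11 s4 (fun p => c11 (d4 p _ _ _ _ _)) (S11 q) (S24 q))
  (c11 (d4 q _ _ _ _ _)) (c21 (d4 q _ _ _ _ _)).
rewrite der0 !(comb_dot (mf q)); lra.
Qed.

Lemma codazzi23 q : der E1 k2 q + alpha q * b1 q = - a2 q * (k1 q - k2 q).
Proof.
have := commutator_dot sY2
  (dot_der (X := E1) (g := k2) s22 s3 (fun p => c22 (d3 p _ _ _ _ _)) (S22 q) (S13 q))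
  (dot_der (X := E2) (g := fun=> 0) s12 s3 (fun p => c12 (d3 p _ _ _ _ _)) (S12 q) (S23 q))
  (c12 (d3 q _ _ _ _ _)) (c22 (d3 q _ _ _ _ _)).
rewrite der0 !(comb_dot (mf q)); lra.
Qed.

Lemma codazzi24 q : der E1 alpha q = 2 * a2 q * alpha q + k2 q * b1 q.
Proof.
have := commutator_dot sY2
  (dot_der (X := E1) (g := fun p => - alpha p) s22 s4 (fun p => c22 (d4 p _ _ _ _ _)) (S22 q) (S14 q))
  (dot_der (X := E2) (g := fun=> 0) s12 s4 (fun p => c12 (d4 p _ _ _ _ _)) (S12 q) (S24 q))
  (c12 (d4 q _ _ _ _ _)) (c22 (d4 q _ _ _ _ _)).
rewrite der0 (derN _ _ smooth_alpha) !(comb_dot (mf q)); lra.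
Qed.

Lemma gauss_frame q : a1 =1 (fun=> 0) ->
  der E1 a2 q = a2 q ^+ 2 + k1 q * k2 q - alpha q ^+ 2 + eps.
Proof.
move=> a10.
have z p : << der E1 Y1 p, Y2 p >> = 0.
  by apply: c11; apply: etrans (d2 p _ _ _ _ _) _; rewrite a10 oppr0.
have := commutator_dot sY1
  (dot_der (X := E1) (g := fun p => - a2 p) s21 sY2 (fun p => c21 (d2 p _ _ _ _ _)) (S21 q) (S12 q))
  (dot_der (X := E2) (g := fun=> 0) s11 sY2 z (S11 q) (S22 q))
  (c11 (d2 q _ _ _ _ _)) (c21 (d2 q _ _ _ _ _)).
rewrite der0 (derN _ _ smooth_a2) !(comb_dot (mf q)) a10 => h.
by rewrite !expr2; lra.
Qed.

End Consequences.

(** * Surfaces with k2 = 0 *)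

Section ReducedAlgebra.
Context {R : realType}.
Implicit Types (f x y z k c al a b n : R).

Lemma ratio_derivative u u' f f1 a : f != 0 -> a * f = 3 / 2 * f1 ->
  u' = 2 * a * u -> u' * (f ^+ 3)^-1 + u * (- (f ^+ 3) ^- 2 * (3 * f ^+ 2 * f1)) = 0.
Proof.
move=> f0 af ->; have -> : f1 = 2 / 3 * (a * f) by rewrite af; field.
by field.
Qed.

Lemma second_derivative_ode f f1 f11 a al eps da : f != 0 ->
  a * f = 3 / 2 * f1 -> da = a ^+ 2 - al ^+ 2 + eps ->
  da * f + a * f1 = 3 / 2 * f11 ->
  f11 * f - 5 / 2 * f1 ^+ 2 - 2 / 3 * eps * f ^+ 2 + 2 / 3 * (al ^+ 2 * f ^+ 2) = 0.
Proof.
move=> f0 af -> h.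
have -> : f11 = 2 / 3 * ((a ^+ 2 - al ^+ 2 + eps) * f + a * f1) by rewrite h; field.
have -> : f1 = 2 / 3 * (a * f) by rewrite af; field.
by field.
Qed.

Lemma first_integral f f1 a al eps C c0 : a * f = 3 / 2 * f1 -> al = c0 * f ^+ 3 ->
  a ^+ 2 + al ^+ 2 + eps = C * f ^+ 3 ->
  f1 ^+ 2 = 4 / 9 * (C * f ^+ 5 - c0 ^+ 2 * f ^+ 8 - eps * f ^+ 2).
Proof.
move=> af alE h.
have -> : f1 = 2 / 3 * (a * f) by rewrite af; field.
have -> : C * f ^+ 5 = (C * f ^+ 3) * f ^+ 2 by ring.
by rewrite -h alE; field.
Qed.

End ReducedAlgebra.

Section Reduced.
Context {R : realType} (eps : R) {M : surface R} (phi : M -> 'rV[R]_5).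
Context (E1 E2 : M -> 'rV[R]_2) (E4 : M -> 'rV[R]_5)
  (k1 k2 alpha a1 a2 b1 b2 : M -> R).
Hypothesis himm : immersion_in_N4 eps phi.
Hypothesis hcmc : forall p, exists v,
  shapeA eps phi p (E3 eps phi p) v != meanf eps phi p *: v.
Hypothesis hframe : adapted_frame eps phi E1 E2 E4 k1 k2 alpha a1 a2 b1 b2.
Local Notation f := (meanf eps phi).
Hypothesis bc : biconservative eps phi.
Hypotheses (b20 : forall p, b2 p = 0) (k1E : forall p, k1 p = 2 * f p)
  (k20 : forall p, k2 p = 0).
Local Notation "<< u , v >>" := (dot eps u v).
Local Notation Y1 := (der E1 phi).
Local Notation Y2 := (der E2 phi).
Local Notation nu q := (eps *: phi q).
Implicit Types (p q : M).

Let sE1 : smooth_field E1 := frame_smooth1 hframe.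
Let sE2 : smooth_field E2 := frame_smooth2 hframe.
Let ortho := frame_orthonormal hframe.
Let sphi : smooth_on_surface phi := smooth_phi himm.
Let sf : smooth_on_surface f := smooth_meanf himm hcmc hframe.
Let sal : smooth_on_surface alpha := smooth_alpha himm hcmc hframe.
Let sa2 : smooth_on_surface a2 := smooth_a2 himm hcmc hframe.
Let f0 q : f q != 0. Proof. by rewrite gt_eqF // (meanf_gt0 hcmc). Qed.

(** The E2 component of the biconservative equation. It starts a chain in which every
   invariant of the surface turns out to be constant along E2. *)
Lemma derE2_meanf q : der E2 f q = 0.
Proof.
have [_] := biconservative_frame himm hcmc hframe q bc.
rewrite k20 b20 add0r !mulr0 subr0 => /eqP; rewrite mulf_eq0 (negPf (f0 q)) /=.
by move/eqP.
Qed.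

Lemma alpha_b1 q : alpha q * b1 q = - (3 * der E1 f q).
Proof.
have [+ _] := biconservative_frame himm hcmc hframe q bc.
rewrite k1E; move: (f q) (f0 q) (der E1 f q) (alpha q * b1 q) => g g0 g1 x h.
apply: (mulfI g0); apply/eqP; rewrite -subr_eq0 -[X in _ == X]h; apply/eqP.
ring.
Qed.

Let der_ext X (u v : M -> R) q : (forall p, u p = v p) -> der X u q = der X v q.
Proof. by move=> /funext ->. Qed.

Let derZ X (u : M -> R) c q : smooth_on_surface u ->
  der X (fun p => c * u p) q = c * der X u q.
Proof.
by move=> su; rewrite /der (DsurfM _ _ (msmooth_cst c) su) Dsurf_cst mul0r add0r.
Qed.

Lemma a1_eq0 q : a1 q = 0.
Proof.
have := codazzi13 himm hcmc hframe q.
rewrite (der_ext _ _ k1E) (derZ _ _ _ sf) derE2_meanf b20 k20 k1E.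
rewrite !mulr0 subr0 oppr0 addr0 => /esym/eqP.
by rewrite mulf_eq0 mulf_eq0 (negPf (f0 q)) pnatr_eq0 !orbF => /eqP.
Qed.

Lemma derE2_alpha q : der E2 alpha q = 0.
Proof.
have := codazzi14 himm hcmc hframe q.
by rewrite b20 a1_eq0 !mulr0 mul0r addr0.
Qed.

Lemma a2_meanf q : a2 q * f q = 3 / 2 * der E1 f q.
Proof.
have := codazzi23 himm hcmc hframe q.
rewrite (der_ext (v := fun=> 0) _ _ k20) /der Dsurf_cst -/(der E1 f q) add0r.
rewrite alpha_b1 k20 k1E subr0; move: (a2 q) (f q) (der E1 f q) => x y z.
move=> h; have -> : x * y = - 2^-1 * (- x * (2 * y)) by field.
by rewrite -h; field.
Qed.

Lemma derE1_alpha q : der E1 alpha q = 2 * a2 q * alpha q.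
Proof. by rewrite (codazzi24 himm hcmc hframe q) k20 mul0r addr0. Qed.

Lemma derE1_a2 q : der E1 a2 q = a2 q ^+ 2 - alpha q ^+ 2 + eps.
Proof. by rewrite (gauss_frame himm hcmc hframe q a1_eq0) k20 mulr0 addr0. Qed.

Let sf1 : smooth_on_surface (der E1 f) := msmooth_der sE1 sf.

Lemma derE2_derE1_meanf q : der E2 (der E1 f) q = 0.
Proof.
have := frame_commutator himm hcmc hframe q sf.
rewrite (der_ext (v := fun=> 0) E1 q derE2_meanf) {1}/der Dsurf_cst.
rewrite a1_eq0 derE2_meanf mul0r mulr0 addr0 sub0r => /eqP.
by rewrite oppr_eq0 => /eqP.
Qed.

Let der_a2_meanf X q :
  der X a2 q * f q + a2 q * der X f q = 3 / 2 * der X (der E1 f) q.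
Proof.
have h1 : der X (fun p => a2 p * f p) q = der X a2 q * f q + a2 q * der X f q.
  exact: DsurfM _ _ sa2 sf.
have h2 : der X (fun p => a2 p * f p) q = der X (fun p => 3 / 2 * der E1 f p) q.
  exact: der_ext a2_meanf.
have h3 : der X (fun p => 3 / 2 * der E1 f p) q = 3 / 2 * der X (der E1 f) q.
  exact: derZ sf1.
by rewrite -h1 h2 h3.
Qed.

Lemma derE2_a2 q : der E2 a2 q = 0.
Proof.
have := der_a2_meanf E2 q; rewrite derE2_derE1_meanf derE2_meanf !mulr0 addr0.
by move/eqP; rewrite mulf_eq0 (negPf (f0 q)) orbF => /eqP.
Qed.

(** By a2 f = 3/2 E1 f, the Gauss equation for E1 a2 is a second-order equation for f. *)
Lemma meanf_ode q : der E1 (der E1 f) q * f q - 5 / 2 * der E1 f q ^+ 2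
  - 2 / 3 * eps * f q ^+ 2 + 2 / 3 * (alpha q ^+ 2 * f q ^+ 2) = 0.
Proof.
exact: second_derivative_ode (f0 q) (a2_meanf q) (derE1_a2 q) (der_a2_meanf E1 q).
Qed.

Let sf3 : smooth_on_surface (fun q => f q ^+ 3) := msmoothX 3 sf.

Lemma Dsurf_cube (u : M -> R) q v : smooth_on_surface u ->
  Dsurf (fun p => u p ^+ 3) q v = 3 * u q ^+ 2 * Dsurf u q v.
Proof.
move=> su; have s2 := msmoothM su su.
have -> : (fun p => u p ^+ 3) = (fun p => u p * (u p * u p)).
  by apply/funext => p; rewrite !exprS expr0 mulr1.
rewrite (DsurfM _ _ su s2) (DsurfM _ _ su su).
by move: (u q) (Dsurf u q v) => x y; ring.
Qed.

Lemma Dsurf_inv (u : M -> R) q v : (forall p, u p != 0) -> smooth_on_surface u ->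
  Dsurf (fun p => (u p)^-1) q v = - u q ^- 2 * Dsurf u q v.
Proof.
move=> u0 su; have d : derivable (loc q u) (pt q) v.
  exact/diff_derivable/smooth_loc_diff.
have := deriveV (x := pt q) (u0 _ : loc q u (pt q) != 0) d.
by rewrite {2}/loc /= cinvK.
Qed.

(** By a2 f = 3/2 E1 f, the function f^3 satisfies the same first-order system as u,
   so that u / f^3 has zero derivative. *)
Lemma proportional_cube (u : M -> R) (p : M) : smooth_on_surface u ->
  (forall q, der E1 u q = 2 * a2 q * u q) -> (forall q, der E2 u q = 0) ->
  forall q, u q = u p * (f p ^+ 3)^-1 * f q ^+ 3.
Proof.
move=> su u1 u2 q.
have f30 r : f r ^+ 3 != 0 by rewrite expf_neq0.
have sV : smooth_on_surface (fun r => (f r ^+ 3)^-1) by exact: msmoothV.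
have sg := msmoothM su sV.
have Dg r v : Dsurf (fun r => u r * (f r ^+ 3)^-1) r v =
    Dsurf u r v * (f r ^+ 3)^-1 + u r * (- (f r ^+ 3) ^- 2 * (3 * f r ^+ 2 * Dsurf f r v)).
  rewrite (DsurfM _ _ su sV) (Dsurf_inv _ _ f30 sf3) (Dsurf_cube _ _ sf).
  by [].
have g1 r : der E1 (fun r => u r * (f r ^+ 3)^-1) r = 0.
  apply: etrans (Dg r (E1 r)) _.
  exact: ratio_derivative (f0 r) (a2_meanf r) (u1 r).
have g2 r : der E2 (fun r => u r * (f r ^+ 3)^-1) r = 0.
  apply: etrans (Dg r (E2 r)) _; rewrite -/(der E2 u r) -/(der E2 f r) u2.
  by rewrite derE2_meanf !mulr0 mul0r addr0.
have D0 r v : Dsurf (fun r => u r * (f r ^+ 3)^-1) r v = 0.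
  apply: etrans (Dsurf_frame himm ortho r v sg) _.
  by rewrite g1 g2 !scaler0 addr0.
have := Dsurf0_constant p sg D0 q => /= <-.
by rewrite mulfVK.
Qed.

Lemma alpha_cube p q : alpha q = alpha p * (f p ^+ 3)^-1 * f q ^+ 3.
Proof. exact: proportional_cube sal derE1_alpha derE2_alpha q. Qed.

(** The square norm of E2 Y2 = a2 Y1 - alpha E4 - eps phi. *)
Definition curvature2 q : R := a2 q ^+ 2 + alpha q ^+ 2 + eps.
Local Notation K := curvature2.

Let DsurfX2 (u : M -> R) q v : smooth_on_surface u ->
  Dsurf (fun p => u p ^+ 2) q v = 2 * u q * Dsurf u q v.
Proof.
move=> su; have -> : (fun p => u p ^+ 2) = (fun p => u p * u p).
  by apply/funext => p; rewrite expr2.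
rewrite (DsurfM _ _ su su).
by move: (u q) (Dsurf u q v) => x y; ring.
Qed.

Let sK : smooth_on_surface K.
Proof.
by apply: msmoothD; [apply: msmoothD; exact: msmoothX|exact: msmooth_cst].
Qed.

Let DK q v : Dsurf K q v = 2 * a2 q * Dsurf a2 q v + 2 * alpha q * Dsurf alpha q v.
Proof.
have s2 := msmoothX 2 sa2; have s4 := msmoothX 2 sal.
have s24 := msmoothD s2 s4.
apply: etrans (DsurfD q v s24 (msmooth_cst eps)) _.
rewrite Dsurf_cst addr0; apply: etrans (DsurfD q v s2 s4) _.
by rewrite !DsurfX2.
Qed.

Let K1 q : der E1 K q = 2 * a2 q * K q.
Proof.
rewrite {1}/der DK -/(der E1 a2 q) -/(der E1 alpha q) derE1_a2 derE1_alpha /K.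
by move: (a2 q) (alpha q) => x y; ring.
Qed.

Let K2 q : der E2 K q = 0.
Proof.
rewrite {1}/der DK -/(der E2 a2 q) -/(der E2 alpha q) derE2_a2 derE2_alpha.
by rewrite !mulr0 addr0.
Qed.

Lemma curvature2_cube p q : K q = K p * (f p ^+ 3)^-1 * f q ^+ 3.
Proof. exact: proportional_cube sK K1 K2 q. Qed.

(** A first integral of the equation of f, obtained from the constancy of curvature2 / f^3
   instead of an integration. It makes E1 f a function of f alone. *)
Lemma derE1_meanf_sqr p q : der E1 f q ^+ 2 =
  4 / 9 * (K p * (f p ^+ 3)^-1 * f q ^+ 5 - (alpha p * (f p ^+ 3)^-1) ^+ 2 * f q ^+ 8
    - eps * f q ^+ 2).
Proof.
exact: first_integral (a2_meanf q) (alpha_cube p q) (curvature2_cube p q).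
Qed.

(** The derivative of Y2 along E1 vanishes, and with N = E2 Y2 one has E2 N = - K Y2. The
   component of Y2 in a fixed direction B is therefore constant along E1 and solves an
   autonomous equation along E2, which makes it a source of the coordinate t. *)
Section Height.
Context (B : 'rV[R]_5).
Definition height q : R := << Y2 q, B >>.
Definition height' q : R := << der E2 Y2 q, B >>.

Let sY1 : smooth_on_surface Y1 := smooth_Y1 himm sE1.
Let sY2 : smooth_on_surface Y2 := smooth_Y2 himm sE2.
Let sN : smooth_on_surface (der E2 Y2) := msmooth_der_row sE2 sY2.
Let sB : smooth_on_surface (fun _ : M => B) := msmooth_cst B.

Lemma smooth_height : smooth_on_surface height. Proof. exact: msmooth_dot. Qed.
Lemma smooth_height' : smooth_on_surface height'. Proof. exact: msmooth_dot. Qed.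

Let DdotB (Z : M -> 'rV[R]_5) q v : smooth_on_surface Z ->
  Dsurf (fun p => << Z p, B >>) q v = << Dsurf Z q v, B >>.
Proof. by move=> sZ; rewrite (Dsurf_dot _ _ _ sZ sB) Dsurf_cst dot0r addr0. Qed.

Let E1Y2 q : der E1 Y2 q = 0.
Proof.
apply: etrans (structure12 himm hcmc hframe q) _.
by rewrite a1_eq0 /frame_comb !scale0r !addr0.
Qed.

Lemma derE1_height q : der E1 height q = 0.
Proof. by apply: etrans (DdotB _ _ sY2) _; rewrite -/(der E1 Y2 q) E1Y2 dot0l. Qed.

Lemma derE2_height q : der E2 height q = height' q.
Proof. exact: DdotB. Qed.

Lemma derE1_height' q : der E1 height' q = a2 q * height' q.
Proof.
have E : der E1 (der E2 Y2) q = a2 q *: der E2 Y2 q.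
  have e0 : der E1 Y2 = (fun=> 0) by apply/funext => p; exact: E1Y2.
  have z : der E2 (der E1 Y2) q = 0.
    by rewrite e0; exact: Dsurf_cst.
  have drop (u v w x : 'rV[R]_5) c d : v = 0 -> c = 0 ->
    u - v = c *: w + d *: x -> u = d *: x.
    by move=> -> ->; rewrite subr0 scale0r add0r.
  exact: drop z (a1_eq0 q) (frame_commutator_row himm hcmc hframe q sY2).
by apply: etrans (DdotB _ _ sN) _; rewrite -/(der E1 _ q) E dotZl.
Qed.

Lemma derE2_height' q : der E2 height' q = - (K q * height q).
Proof.
have s4 : smooth_on_surface E4 := frame_smooth4 hframe.
have s1 : smooth_on_surface (fun p => << Y1 p, B >>) by exact: msmooth_dot.
have sE : smooth_on_surface (fun p => << E4 p, B >>) by exact: msmooth_dot.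
have sp : smooth_on_surface (fun p => << phi p, B >>) by exact: msmooth_dot.
have e p : height' p = a2 p * << Y1 p, B >> + (- 1 * (alpha p * << E4 p, B >>)
    + - eps * << phi p, B >>).
  apply: etrans (congr1 (dot eps ^~ B) (structure22 himm hcmc hframe p)) _.
  rewrite /frame_comb k20 scale0r; move: (Y1 p) (Y2 p) (E4 p) (phi p) => u v w z.
  by rewrite !dotDl !dotZl dot0l; ring.
have D1 : Dsurf (fun p => << Y1 p, B >>) q (E2 q) = - (a2 q * height q).
  apply: etrans (DdotB _ _ sY1) _.
  apply: etrans (congr1 (dot eps ^~ B) (structure21 himm hcmc hframe q)) _.
  by rewrite /frame_comb !scale0r !addr0 add0r dotZl mulNr.
have D4 : Dsurf (fun p => << E4 p, B >>) q (E2 q) = alpha q * height q.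
  apply: etrans (DdotB _ _ s4) _.
  apply: etrans (congr1 (dot eps ^~ B) (structure24 himm hcmc hframe q)) _.
  by rewrite /frame_comb b20 oppr0 !scale0r !addr0 add0r dotZl.
have Dp : Dsurf (fun p => << phi p, B >>) q (E2 q) = height q by exact: DdotB.
have t1 := msmoothM sa2 s1; have t4 := msmoothM sal sE.
have t4' := msmoothM (msmooth_cst (- 1 : R)) t4.
have tp := msmoothM (msmooth_cst (- eps : R)) sp.
apply: etrans (der_ext E2 q e) _.
apply: etrans (DsurfD _ _ t1 (msmoothD t4' tp)) _.
apply: etrans (congr2 (fun x y => x + y) (DsurfM _ _ sa2 s1) (DsurfD _ _ t4' tp)) _.
rewrite (DsurfM _ _ (msmooth_cst _) t4) (DsurfM _ _ (msmooth_cst _) sp).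
rewrite (DsurfM _ _ sal sE) !Dsurf_cst D1 D4 Dp.
rewrite -/(der E2 a2 q) -/(der E2 alpha q) derE2_a2 derE2_alpha /K.
by move: (a2 q) (alpha q) (height q) => x y z; ring.
Qed.

(** Along E2 the height satisfies h'' + K h = 0 with constant K; this is its energy. *)
Lemma height_energy p q : height' q ^+ 2 + K q * height q ^+ 2 =
  (height' p ^+ 2 + K p * height p ^+ 2) * (f p ^+ 3)^-1 * f q ^+ 3.
Proof.
have s1 := msmoothX 2 smooth_height'; have s2 := msmoothX 2 smooth_height.
have s3 := msmoothM sK s2.
have DE X q' : der X (fun q => height' q ^+ 2 + K q * height q ^+ 2) q' =
    2 * height' q' * der X height' q' +
    (der X K q' * height q' ^+ 2 + K q' * (2 * height q' * der X height q')).
  apply: etrans (DsurfD _ _ s1 s3) _.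
  by rewrite (DsurfX2 _ _ smooth_height') (DsurfM _ _ sK s2) (DsurfX2 _ _ smooth_height).
apply: (proportional_cube (u := fun q => height' q ^+ 2 + K q * height q ^+ 2)).
- exact: msmoothD.
- move=> q'; rewrite DE derE1_height' K1 derE1_height.
  by move: (height' q') (height q') (K q') (a2 q') => x y z w; ring.
- move=> q'; rewrite DE derE2_height' K2 derE2_height.
  by move: (height' q') (height q') (K q') => x y z; ring.
Qed.

End Height.

End Reduced.

(** * Coordinates by quadratures *)

Section Antiderivative.
Context {R : realType}.

(** For a solution u of u' = sqrt (h u), the composite S u is the time parameter up to a
   constant. *)
Lemma inv_sqrt_antiderivative (h : R -> R) x0 : continuous h -> 0 < h x0 ->
  exists S d, 0 < d /\
    forall x, `|x - x0| < d -> 0 < h x /\ is_derive x 1 S (Num.sqrt (h x))^-1.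
Proof.
move=> ch h0.
have nh : \forall x \near x0, 0 < h x.
  have h2 : 0 < h x0 / 2 by rewrite divr_gt0.
  apply: filterS (cts_dist (ch x0) h2) => x; rewrite ler_norml => /andP[_].
  by move: (h x0) (h x) h2 => u w; lra.
have [e /= e0 eP] := (nbhs_ballP _ _).1 nh.
pose g x := (Num.sqrt (h x))^-1.
have near_x0 x : `|x - x0| < e -> 0 < h x.
  by move=> xe; apply: eP; rewrite -ball_normE /= distrC.
have cg x : `|x - x0| < e -> {for x, continuous g}.
  move=> /near_x0 hx; apply: continuousV; first by rewrite gt_eqF // sqrtr_gt0.
  by apply: continuous_comp; [exact: ch|exact: sqrt_continuous].
pose a := x0 - e / 2; pose b := x0 + e / 2.
have ab_near x : x \in `[a, b] -> `|x - x0| < e.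
  rewrite in_itv /= /a /b => /andP[h1 h2]; rewrite ltr_norml; apply/andP; split; lra.
have ig : lebesgue_measure.-integrable `[a, b] (EFin \o g).
  apply: continuous_compact_integrable; first exact: segment_compact.
  by apply: continuous_in_subspaceT => x; rewrite inE => /ab_near/cg.
exists (fun x => \int[lebesgue_measure]_(t in `[a, x]) g t)%R, (e / 2); split.
  by rewrite divr_gt0.
move=> x; rewrite ltr_norml => /andP[x1 x2].
have xe : `|x - x0| < e by rewrite ltr_norml; apply/andP; split; lra.
split; first exact: near_x0.
have xb : x < b by rewrite /b; lra.
have ax : a < x by rewrite /a; lra.
have [d1 d2] := continuous_FTC1_closed xb ig ax (cg x xe).
by rewrite derive1E in d2; split.
Qed.

Lemma row_norm_lt n (v : 'rV[R]_n) e :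
  0 < e -> (`|v| < e) <-> forall j, `|v 0 j| < e.
Proof.
move=> e0; split=> [ve j|ve]; first exact: le_lt_trans (norm_coord v j) ve.
rewrite /Num.Def.normr/= mx_normrE; apply: bigmax_lt => // -[i j] _ /=.
by rewrite (ord1 i); exact: ve.
Qed.

Lemma dot_nondegenerate (eps : R) (u : 'rV[R]_5) : u != 0 -> exists w, 0 < dot eps u w.
Proof.
move=> u0; pose s (i : 'I_5) : R := if (eps < 0) && (i == 0) then -1 else 1.
have ss i : s i * s i = 1 by rewrite /s; case: ifP; rewrite ?mulrNN mulr1.
exists (\row_i (s i * u 0 i)).
have -> : dot eps u (\row_i (s i * u 0 i)) = \sum_i u 0 i ^+ 2.
  apply: eq_bigr => i _; rewrite -/(s i) mxE expr2.
  by rewrite mulrCA [s i * (s i * _)]mulrA ss mul1r.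
rewrite lt_neqAle sumr_ge0 ?andbT => [|i _]; last exact: sqr_ge0.
apply: contra u0 => /eqP/esym su; apply/eqP/rowP => i; rewrite mxE.
apply/eqP; rewrite -sqrf_eq0; apply/eqP.
by have /psumr_eq0P := su; apply => // j _; exact: sqr_ge0.
Qed.

Lemma cube_root (k : R) : 0 < k -> exists2 c : R, 0 < c & c ^- 3 = k.
Proof.
move=> k0; exists ((k `^ 3^-1)^-1); first by rewrite invr_gt0 powR_gt0.
rewrite exprVn invrK -powR_mulrn ?powR_ge0 // -powRrM mulVf ?pnatr_eq0 //.
by rewrite powRr1 // ltW.
Qed.

End Antiderivative.

Section ChartOfFrame.
Context {R : realType} {M : surface R}.
Implicit Types (p q : M).

Lemma differentiable_cmap (c : chart R M) q : in_max_atlas c -> cdom c q ->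
  differentiable (loc q (cmap c)) (pt q).
Proof.
move=> [cc comp] cq; have [s _] := comp q; apply: smooth_diff s _.
by exists q => //; split => //; exact: mem_chart_at.
Qed.

Lemma ord2P (i : 'I_2) : i = 0 \/ i = 1.
Proof. by case: i => -[|[|//]] ?; [left|right]; exact: val_inj. Qed.

(** The map (s, t) carries E1 and E2 / m to the coordinate basis, so that its Jacobian is
   invertible. *)
Lemma chart_of_coordinates (E1 E2 : M -> 'rV[R]_2) p (A : set 'rV[R]_2)
    (s t : 'rV[R]_2 -> R) (m : M -> R) :
  let a y := loc p (components (chart_at p) E1) y in
  let b y := loc p (components (chart_at p) E2) y in
  open A -> A (pt p) -> A `<=` cimg (chart_at p) -> smooth A s -> smooth A t ->
  (forall q, m q != 0) ->
  (forall y, A y -> [/\ 'D_(a y) s y = 1, 'D_(a y) t y = 0, 'D_(b y) s y = 0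
     & 'D_(b y) t y = m (cinv (chart_at p) y)]) ->
  exists x y0 r, [/\ in_max_atlas x, cdom x p, cimg x = ball y0 r &
    forall q, cdom x q -> components x E1 q = e_ 0 /\ components x E2 q = m q *: e_ 1].
Proof.
move=> a b oA Ap Ac ss st m0 D.
pose Phi y : 'rV[R]_2 := \row_j (if j == 0 then s y else t y).
have Phi0 : (fun y => Phi y 0 0) = s by apply/funext => y; rewrite mxE eqxx.
have Phi1 : (fun y => Phi y 0 1) = t by apply/funext => y; rewrite mxE.
have sPhi : smooth A Phi.
  apply/(smooth_rowP oA) => j; case: (ord2P j) => ->.
    by rewrite Phi0.
  by rewrite Phi1.
have dPhi y : A y -> differentiable Phi y by exact: smooth_diff.
have DPhi v y : A y -> 'D_v Phi y = 'D_v s y *: e_ 0 + 'D_v t y *: e_ 1.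
  move=> Ay; apply/rowP => j; apply: etrans (derive_row v j (dPhi y Ay)) _.
  case: (ord2P j) => ->; rewrite ?Phi0 ?Phi1 !mxE /=.
    by rewrite mulr1 mulr0 addr0.
  by rewrite mulr1 mulr0 add0r.
have Da y : A y -> 'D_(a y) Phi y = e_ 0.
  move=> Ay; have [s1 t1 _ _] := D y Ay; apply: etrans (DPhi _ _ Ay) _.
  by rewrite s1 t1 scale1r scale0r addr0.
have Db y : A y -> 'D_(b y) Phi y = m (cinv (chart_at p) y) *: e_ 1.
  move=> Ay; have [_ _ s1 t1] := D y Ay; apply: etrans (DPhi _ _ Ay) _.
  by rewrite s1 t1 scale0r add0r.
have uPhi y : A y -> 'J Phi y \in unitmx.
  move=> Ay; pose L : 'M[R]_2 := \matrix_i
    (if i == 0 then a y else (m (cinv (chart_at p) y))^-1 *: b y).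
  suff /mulmx1_unit[] : L *m 'J Phi y = 1%:M by [].
  apply/row_matrixP => i; rewrite row_mul rowK rowE mulmx1.
  case: (ord2P i) => -> /=.
    exact: etrans (esym (deriveEjacobian (a y) (dPhi y Ay))) (Da y Ay).
  rewrite -scalemxAl.
  have := etrans (esym (deriveEjacobian (b y) (dPhi y Ay))) (Db y Ay) => ->.
  by rewrite scalerA mulVf ?scale1r.
have [x [ax xp xE [r xr] xc]] := chart_of_map oA Ap Ac sPhi uPhi.
exists x, (Phi (pt p)), r; split=> // q xq.
have [cq Aq] := xc q xq.
have [cc _] := max_atlas_chart_at p.
have [_ _ _ _ cK] := cc; have cKq := cK q cq.
have DX X : 'D_(components (chart_at p) X q) Phi (cmap (chart_at p) q) = components x X q.
  apply: etrans; last exact: (Dsurf_chart (max_atlas_chart_at p) cq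
    (differentiable_cmap ax xq) (X q)).
  apply: near_eq_derive.
  apply: open_near_eq (open_cimg p) _ _; last by exists q.
  by move=> y cy /=; rewrite xE /= (chart_cancel cc cy).2.
have aE X : loc p (components (chart_at p) X) (cmap (chart_at p) q)
    = components (chart_at p) X q by rewrite /loc /= cKq.
split.
  apply: etrans (esym (DX E1)) _; rewrite -aE; exact: Da.
apply: etrans (esym (DX E2)) _; rewrite -aE; apply: etrans (Db _ Aq) _.
by rewrite cKq.
Qed.

End ChartOfFrame.

Section Quadratures.
Context {R : realType} {M : surface R}.
Implicit Types (p q : M).

(** The equations E1 u = sqrt (h1 u) and E2 v = m sqrt (h2 v) separate: antiderivatives of
   1 / sqrt h1 and 1 / sqrt h2, composed with u and v, have derivative 1 along E1 and m
   along E2. *)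
Lemma chart_of_quadratures (E1 E2 : M -> 'rV[R]_2) (u v m : M -> R) (h1 h2 : R -> R) p :
  smooth_field E1 -> smooth_field E2 ->
  smooth_on_surface u -> smooth_on_surface v -> smooth_on_surface m ->
  (forall q, 0 < m q) -> (forall q, 0 < der E1 u q) -> (forall q, der E2 u q = 0) ->
  (forall q, der E1 v q = 0) -> 0 < der E2 v p ->
  continuous h1 -> continuous h2 ->
  (forall q, h1 (u q) = der E1 u q ^+ 2) ->
  (forall q, h2 (v q) * m q ^+ 2 = der E2 v q ^+ 2) ->
  exists x y0 r, [/\ in_max_atlas x, cdom x p, cimg x = ball y0 r &
    forall q, cdom x q -> components x E1 q = e_ 0 /\ components x E2 q = m q *: e_ 1].
Proof.
move=> sE1 sE2 su sv sm m0 u1 u2 v1 v2 ch1 ch2 h1E h2E.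
have h1p : 0 < h1 (u p) by rewrite h1E exprn_gt0.
have h2p : 0 < h2 (v p).
  have : 0 < h2 (v p) * m p ^+ 2 by rewrite h2E exprn_gt0.
  by rewrite pmulr_lgt0 // exprn_gt0.
have [S [d1 [d10 SP]]] := inv_sqrt_antiderivative ch1 h1p.
have [T [d2 [d20 TP]]] := inv_sqrt_antiderivative ch2 h2p.
pose lu := loc p u; pose lv := loc p v; pose lm := loc p m.
pose lu1 := loc p (der E1 u); pose lv2 := loc p (der E2 v).
have slu : smooth (cimg (chart_at p)) lu := su p.
have slv : smooth (cimg (chart_at p)) lv := sv p.
have slm : smooth (cimg (chart_at p)) lm := sm p.
have slu1 : smooth (cimg (chart_at p)) lu1 := msmooth_der sE1 su p.
have slv2 : smooth (cimg (chart_at p)) lv2 := msmooth_der sE2 sv p.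
have lup : lu (pt p) = u p by rewrite /lu /loc /= cinvK.
have lvp : lv (pt p) = v p by rewrite /lv /loc /= cinvK.
have lv2p : lv2 (pt p) = der E2 v p by rewrite /lv2 /loc /= cinvK.
pose W := [set y | [/\ cimg (chart_at p) y, `|lu y - u p| < d1, `|lv y - v p| < d2
  & 0 < lv2 y]].
have Wnear (w : 'rV[R]_2 -> R) c d : smooth (cimg (chart_at p)) w -> w (pt p) = c ->
    0 < d -> \forall y \near pt p, `|w y - c| < d.
  move=> sw wc d0; have dd : 0 < d / 2 by rewrite divr_gt0.
  apply: filterS (cts_dist (smooth_cts sw (pt_cimg p)) dd) => y.
  rewrite wc distrC => h; apply: le_lt_trans h _.
  by rewrite ltr_pdivrMr // ltr_pMr // ltr1n.
have WP : nbhs (pt p) W.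
  have n0 := open_nbhs_nbhs (conj (open_cimg p) (pt_cimg p)).
  have n1 := Wnear _ _ _ slu lup d10.
  have n2 := Wnear _ _ _ slv lvp d20.
  have n3 := Wnear _ _ _ slv2 lv2p v2.
  apply: filterS (filterI n0 (filterI n1 (filterI n2 n3))) => y [cy [y1 [y2 y3]]].
  split=> //; move: y3; rewrite ltr_norml => /andP[+ _].
  by move: (lv2 y) (der E2 v p) => a b; lra.
pose A := interior W.
have oA : open A := open_interior W.
have Ap : A (pt p) := WP.
have AW : A `<=` W := @interior_subset _ W.
have Ac : A `<=` cimg (chart_at p) by move=> y /AW [].
have slu' := smooth_sub Ac slu; have slv' := smooth_sub Ac slv.
have u10 y : A y -> lu1 y != 0 by move=> _; rewrite gt_eqF //; exact: u1.
have v20 y : A y -> lv2 y != 0 by move=> /AW [_ _ _ h]; rewrite gt_eqF.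
have [sS dS] : smooth A (S \o lu) /\
    forall y w, A y -> 'D_w (S \o lu) y = 'D_w lu y * (lu1 y)^-1.
  apply: (smooth_comp1 oA slu').
    exact: smoothV u10 (smooth_sub Ac slu1).
  move=> y /AW [_ y1 _ _]; have [_] := SP _ y1; congr (is_derive _ _ _ _).
  by rewrite /lu /loc /= h1E sqrtr_sqr gtr0_norm.
have [sT dT] : smooth A (T \o lv) /\
    forall y w, A y -> 'D_w (T \o lv) y = 'D_w lv y * (lm y * (lv2 y)^-1).
  apply: (smooth_comp1 oA slv').
    apply: (smoothM oA (smooth_sub Ac slm)).
    exact: smoothV v20 (smooth_sub Ac slv2).
  move=> y /AW [_ _ y2 y3]; have [h0] := TP _ y2; congr (is_derive _ _ _ _).
  have hE : h2 (lv y) = (lv2 y / lm y) ^+ 2.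
    by rewrite expr_div_n -[lv2 y ^+ 2]h2E mulfK // expf_neq0 // gt_eqF //; exact: m0.
  rewrite hE sqrtr_sqr gtr0_norm ?invf_div // divr_gt0 //; exact: m0.
apply: (@chart_of_coordinates R M E1 E2 p A _ _ m oA Ap Ac sS sT).
  by move=> q; rewrite gt_eqF.
move=> y Ay; have cy := Ac y Ay.
have Du1 := loc_der E1 su cy; have Du2 := loc_der E2 su cy.
have Dv1 := loc_der E1 sv cy; have Dv2 := loc_der E2 sv cy.
split.
- apply: etrans (dS _ _ Ay) _; rewrite -[X in X * _]Du1; exact: divff (u10 y Ay).
- apply: etrans (dT _ _ Ay) _; rewrite -[X in X * _]Dv1 {1}/loc /= v1; exact: mul0r.
- apply: etrans (dS _ _ Ay) _; rewrite -[X in X * _]Du2 {1}/loc /= u2; exact: mul0r.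
- apply: etrans (dT _ _ Ay) _; rewrite -[X in X * _]Dv2 mulrCA divff ?mulr1 //.
  exact: v20.
Qed.

End Quadratures.

(** * Functions of the first coordinate *)

Section Slices.
Context {R : realType} {M : surface R} (E1 E2 : M -> 'rV[R]_2) (m : M -> R).
Context (x : chart R M) (y0 : 'rV[R]_2) (r : R).
Hypotheses (ax : in_max_atlas x) (xE : cimg x = ball y0 r) (m0 : forall q, 0 < m q).
Hypothesis xc : forall q, cdom x q ->
  components x E1 q = e_ 0 /\ components x E2 q = m q *: e_ 1.
Implicit Types (p q : M) (u : M -> R).

Let cx : is_chart x. Proof. by case: ax. Qed.

Lemma der_coord0 {V : normedModType R} (u : M -> V) q :
  smooth_on_surface u -> cdom x q ->
  'D_(e_ 0) (u \o cinv x) (cmap x q) = der E1 u q.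
Proof.
move=> su xq; have [<- _] := xc xq.
exact: (Dsurf_chart ax xq (smooth_loc_diff q su) (E1 q)).
Qed.

Lemma diff_coord {V : normedModType R} (u : M -> V) q :
  smooth_on_surface u -> cdom x q -> differentiable (u \o cinv x) (cmap x q).
Proof. by move=> su xq; exact: (differentiable_chart ax xq (smooth_loc_diff q su)). Qed.

Lemma der_coord1 {V : normedModType R} (u : M -> V) q :
  smooth_on_surface u -> cdom x q ->
  'D_(e_ 1) (u \o cinv x) (cmap x q) = (m q)^-1 *: der E2 u q.
Proof.
move=> su xq; have [_ c2] := xc xq.
have h := Dsurf_chart ax xq (smooth_loc_diff q su) (E2 q).
apply: (@scalerI _ _ (m q)); first by rewrite gt_eqF.
rewrite scalerA divff ?gt_eqF // scale1r.
have <- := deriveZvar (e_ 1) (m q) (diff_coord su xq).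
by rewrite -c2; exact: h.
Qed.

Definition slice_pt (s : R) : 'rV[R]_2 := y0 0 1 *: e_ 1 + s *: e_ 0.
Definition slice u (s : R) := u (cinv x (slice_pt s)).

Let in_box (y : 'rV[R]_2) : cimg x y <-> (0 < r) /\ forall j, `|y0 0 j - y 0 j| < r.
Proof.
rewrite xE -ball_normE /=; split=> [h|[r0 h]].
  have r0 : 0 < r := le_lt_trans (normr_ge0 _) h.
  by split=> // j; have := (row_norm_lt (y0 - y) r0).1 h j; rewrite !mxE.
by apply/(row_norm_lt _ r0) => j; rewrite !mxE.
Qed.

Let slice_pt0 s : slice_pt s 0 0 = s. Proof. by rewrite !mxE /= mulr1 mulr0 add0r. Qed.
Let slice_pt1 s : slice_pt s 0 1 = y0 0 1.
Proof. by rewrite !mxE /= mulr1 mulr0 addr0. Qed.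

Lemma slice_pt_cimg y : cimg x y -> cimg x (slice_pt (y 0 0)).
Proof.
move=> /in_box[r0 yb]; apply/in_box; split=> // j.
case: (ord2P j) => ->; first by rewrite slice_pt0.
by rewrite slice_pt1 subrr normr0.
Qed.

(** The image of the chart is a ball for the maximum norm, hence contains the segments
   along which the second coordinate varies, and u has derivative 0 along them. *)
Lemma slice_eq u q : smooth_on_surface u -> (forall p, der E2 u p = 0) -> cdom x q ->
  u q = slice u (cmap x q 0 0).
Proof.
move=> su u2 xq; set y := cmap x q.
have yc : cimg x y by exists q.
have [r0 yb] := (in_box y).1 yc.
pose c := y 0 1 - y0 0 1.
have yE : y = slice_pt (y 0 0) + c *: e_ 1.
  apply/rowP => j; case: (ord2P j) => ->.
    by rewrite [RHS]mxE slice_pt0 !mxE /= mulr0 addr0.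
  by rewrite [RHS]mxE slice_pt1 !mxE /= mulr1 /c addrC subrK.
have seg t : 0 <= t <= 1 -> cimg x (slice_pt (y 0 0) + t *: (c *: e_ 1)).
  move=> /andP[t0 t1]; apply/in_box; split=> // j; case: (ord2P j) => ->.
    by rewrite [X in _ - X]mxE slice_pt0 !mxE /= !mulr0 addr0.
  rewrite [X in _ - X]mxE slice_pt1 !mxE /= mulr1 opprD addrA subrr add0r normrN normrM.
  rewrite ger0_norm //; apply: le_lt_trans (ler_piMl (normr_ge0 _) t1) _.
  by rewrite /c distrC.
have dseg t : 0 <= t <= 1 ->
    differentiable (u \o cinv x) (slice_pt (y 0 0) + t *: (c *: e_ 1)).
  by move=> /seg h; have [h1 <-] := chart_cancel cx h; exact: diff_coord.
have [t t01 ] := MVT_line dseg.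
have [h1 h2] := chart_cancel cx (seg t t01).
rewrite -yE -h2 deriveZvar; last exact: diff_coord.
rewrite (der_coord1 su h1) u2 !scaler0 => /eqP; rewrite subr_eq0 => /eqP /=.
have [_ _ _ _ cK] := cx.
by rewrite /y cK.
Qed.

Lemma slice_derive u s : smooth_on_surface u -> cimg x (slice_pt s) ->
  is_derive s 1 (slice u) (slice (der E1 u) s).
Proof.
move=> su ys; have [h1 h2] := chart_cancel cx ys.
have du : differentiable (u \o cinv x) (slice_pt s) by rewrite -h2; exact: diff_coord.
have := is_derive_line du; congr (is_derive _ _ _ _).
by rewrite -/(slice_pt s) -{1}h2 (der_coord0 su h1).
Qed.

Lemma slice_derive1 u s : smooth_on_surface u -> cimg x (slice_pt s) ->
  derive1 (slice u) s = slice (der E1 u) s.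
Proof. by move=> su ys; rewrite derive1E; apply: derive_val; exact: slice_derive. Qed.

Lemma slice_derive2 u s : smooth_field E1 -> smooth_on_surface u ->
  cimg x (slice_pt s) -> derive1n 2 (slice u) s = slice (der E1 (der E1 u)) s.
Proof.
move=> sE1 su ys.
have n : \forall z \near s, cimg x (slice_pt z).
  have [_ oc _ _ _] := cx.
  have cs : {for s, continuous slice_pt}.
    by apply: differentiable_continuous.
  exact: cs (open_nbhs_nbhs (conj oc ys)).
rewrite derive1nS derive1E -(slice_derive1 (msmooth_der sE1 su) ys) derive1E.
apply: near_eq_derive; apply: filterS n => z; exact: slice_derive1.
Qed.

End Slices.

(** * The coordinates s and t *)

Section CoordinateAlgebra.
Context {R : realType}.
Implicit Types (f al b c : R).

Lemma connection_coefficient f f1 al b c : c != 0 -> f != 0 ->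
  al * b = - (3 * f1) -> al = c ^- 3 * f ^+ 3 -> b = - (3 * c ^+ 3 * f1 / f ^+ 3).
Proof.
move=> c0 f0 h alE; have al0 : al != 0 by rewrite alE mulf_neq0 ?invr_neq0 ?expf_neq0.
have -> : f1 = - (al * b) / 3 by rewrite h; field.
by rewrite alE; field; rewrite c0 f0.
Qed.

Lemma ode_constant f f1 f11 al eps c : c != 0 -> al = c ^- 3 * f ^+ 3 ->
  f11 * f - 5 / 2 * f1 ^+ 2 - 2 / 3 * eps * f ^+ 2 + 2 / 3 * (al ^+ 2 * f ^+ 2) = 0 ->
  f11 * f - 5 / 2 * f1 ^+ 2 - 2 / 3 * eps * f ^+ 2 + 2 / 3 * c ^- 6 * f ^+ 8 = 0.
Proof.
move=> c0 -> <-; congr (_ + _).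
by field.
Qed.

Lemma energy_quadrature h h' u K D C :
  h' ^+ 2 + K * h ^+ 2 = D * u -> K = C * u -> (D - C * h ^+ 2) * u = h' ^+ 2 :> R.
Proof. by move=> e KE; rewrite mulrBl -e KE; ring. Qed.

Lemma sqrt_inv (u : R) : 0 < u -> Num.sqrt u = (Num.sqrt u^-1)^-1.
Proof. by move=> u0; rewrite sqrtrV ?invrK // ltW. Qed.

End CoordinateAlgebra.

Section Coordinates.
Context {R : realType} (eps : R) {M : surface R} (phi : M -> 'rV[R]_5).
Context (E1 E2 : M -> 'rV[R]_2) (E4 : M -> 'rV[R]_5)
  (k1 k2 alpha a1 a2 b1 b2 : M -> R).
Hypothesis himm : immersion_in_N4 eps phi.
Hypothesis hcmc : forall p, exists v,
  shapeA eps phi p (E3 eps phi p) v != meanf eps phi p *: v.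
Hypothesis hframe : adapted_frame eps phi E1 E2 E4 k1 k2 alpha a1 a2 b1 b2.
Local Notation f := (meanf eps phi).
Hypothesis bc : biconservative eps phi.
Hypotheses (b20 : forall p, b2 p = 0) (k1E : forall p, k1 p = 2 * f p)
  (k20 : forall p, k2 p = 0).
Hypothesis f1_gt0 : forall p, 0 < der E1 f p.
Local Notation "<< u , v >>" := (dot eps u v).
Local Notation Y1 := (der E1 phi).
Local Notation Y2 := (der E2 phi).
Implicit Types (p q : M).

Let sE1 : smooth_field E1 := frame_smooth1 hframe.
Let sE2 : smooth_field E2 := frame_smooth2 hframe.
Let sphi : smooth_on_surface phi := smooth_phi himm.
Let sf : smooth_on_surface f := smooth_meanf himm hcmc hframe.
Let fp q : 0 < f q := meanf_gt0 hcmc q.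
Let f3p q : 0 < f q ^+ 3. Proof. by rewrite exprn_gt0 // fp. Qed.
Let f2E q : der E2 f q = 0 := derE2_meanf himm hcmc hframe bc b20 k20 q.

(** This is 1 / sqrt g22. *)
Definition t_density q := Num.sqrt (f q ^+ 3).

(** Its component along Y1 is a2 = 3/2 E1 f / f. *)
Lemma curvature_vector_neq0 p : der E2 Y2 p != 0.
Proof.
have d1 := comb_dot1 (adapted_moving_frame himm hcmc hframe p).
have h : << der E2 Y2 p, Y1 p >> = a2 p.
  apply: etrans (congr1 (fun z => << z, Y1 p >>) (structure22 himm hcmc hframe p)) _.
  exact: d1.
apply: contraTneq (f1_gt0 p) => N0.
have := a2_meanf himm hcmc hframe bc k1E k20 p.
rewrite -h N0 dot0l mul0r => /esym/eqP; rewrite mulf_eq0 => /orP[|/eqP ->].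
  by rewrite mulf_eq0 invr_eq0 !pnatr_eq0.
by rewrite ltxx.
Qed.

(** The first integral expresses E1 f in terms of f, and the energy expresses E2 v in
   terms of v and f for the height v; the direction B is chosen so that v is
   noncritical along E2 at p. *)
Lemma st_chart p : exists x y0 r, [/\ in_max_atlas x, cdom x p, cimg x = ball y0 r &
  forall q, cdom x q ->
    components x E1 q = e_ 0 /\ components x E2 q = t_density q *: e_ 1].
Proof.
have [B hB] := dot_nondegenerate eps (curvature_vector_neq0 p).
pose C := curvature2 eps alpha a2 p * (f p ^+ 3)^-1.
pose c0 := alpha p * (f p ^+ 3)^-1.
pose D := (height' eps phi E2 B p ^+ 2 +
           curvature2 eps alpha a2 p * height eps phi E2 B p ^+ 2) * (f p ^+ 3)^-1.
pose h1 z := 4 / 9 * (C * z ^+ 5 - c0 ^+ 2 * z ^+ 8 - eps * z ^+ 2).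
pose h2 z := D - C * z ^+ 2.
have vE q : der E2 (height eps phi E2 B) q = height' eps phi E2 B q.
  exact: (derE2_height himm hframe B q).
have sm : smooth_on_surface t_density := msmooth_sqrt f3p (msmoothX 3 sf).
apply: (@chart_of_quadratures R M E1 E2 f (height eps phi E2 B) t_density h1 h2 p sE1 sE2
  sf (smooth_height himm hframe B) sm _ f1_gt0 f2E).
- by move=> q; rewrite sqrtr_gt0.
- exact: (derE1_height himm hcmc hframe bc b20 k1E k20 B).
- by rewrite vE.
- move=> z; rewrite /h1; apply: cvgM; first exact: cvg_cst.
  apply: cvgB; [apply: cvgB|]; apply: cvgM; try exact: cvg_cst; exact: exprn_continuous.
- move=> z; rewrite /h2; apply: cvgB; first exact: cvg_cst.
  by apply: cvgM; [exact: cvg_cst|exact: exprn_continuous].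
- move=> q; exact: esym (derE1_meanf_sqr himm hcmc hframe bc b20 k1E k20 p q).
- move=> q; rewrite vE sqr_sqrtr; last exact: ltW.
  have e := height_energy himm hcmc hframe bc b20 k1E k20 B p q.
  have k := curvature2_cube himm hcmc hframe bc b20 k1E k20 p q.
  exact: energy_quadrature e k.
Qed.

Lemma first_form_st (x : chart R M) : in_max_atlas x ->
  (forall q, cdom x q ->
    components x E1 q = e_ 0 /\ components x E2 q = t_density q *: e_ 1) ->
  forall q, cdom x q -> first_form eps (phi \o cinv x) (cmap x q) =
    diag_mx (e_ 0 + (f q ^+ 3)^-1 *: e_ 1).
Proof.
move=> ax xc q xq.
have m0 p : 0 < t_density p by rewrite sqrtr_gt0.
have [Y11 Y22 Y12] := Y_orthonormal himm (frame_orthonormal hframe) q.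
have D0 := der_coord0 ax xc sphi xq; have D1 := der_coord1 ax m0 xc sphi xq.
have mm : (t_density q)^-1 * (t_density q)^-1 = (f q ^+ 3)^-1.
  by rewrite -invfM -expr2 sqr_sqrtr // ltW.
have dE i j : diag_mx (e_ 0 + (f q ^+ 3)^-1 *: e_ 1) i j =
    ((i == 0)%:R + (f q ^+ 3)^-1 * (i == 1)%:R) *+ (i == j) by rewrite !mxE.
apply/matrixP => i j; rewrite [LHS]mxE dE.
case: (ord2P i) (ord2P j) => -> [->|->].
- apply: etrans (congr2 (dot eps) D0 D0) _; apply: etrans Y11 _.
  by rewrite mulr0 addr0.
- apply: etrans (congr2 (dot eps) D0 D1) _; apply: etrans (dotZr _ _ _ _) _.
  by apply: etrans (congr1 _ Y12) _; exact: mulr0.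
- apply: etrans (congr2 (dot eps) D1 D0) _; apply: etrans (dotZl _ _ _ _) _.
  by apply: etrans (congr1 _ (etrans (dotC _ _ _) Y12)) _; exact: mulr0.
- apply: etrans (congr2 (dot eps) D1 D1) _; apply: etrans (dotZl _ _ _ _) _.
  apply: etrans (congr1 _ (dotZr _ _ _ _)) _; apply: etrans (mulrA _ _ _) _.
  apply: etrans (congr2 ( *%R) mm Y22) _.
  by rewrite add0r.
Qed.

(** The functions f and E1 f are constant along E2, so that they are functions of s, and
   the second is the derivative of the first. *)
Lemma st_chart_solution c : 0 < c -> (forall q, alpha q = c ^- 3 * f q ^+ 3) ->
  forall p, exists (x : chart R M) (F : R -> R),
      [/\ cdom x p,
          st_coordinates eps phi E1 E2 k1 k2 alpha a2 b1 x &
          forall q, cdom x q ->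
            let s := cmap x q 0 0 in
            [/\ meanf eps phi q = F s,
                [/\ b1 q = - (3 * c ^+ 3 * derive1 F s / F s ^+ 3),
                    a2 q = 3 / 2 * (derive1 F s / F s),
                    alpha q = c ^- 3 * F s ^+ 3 &
                    k2 q = 0] &
                [/\ 0 < F s, 0 < derive1 F s &
                    derive1n 2 F s * F s - 5 / 2 * derive1 F s ^+ 2
                    - 2 / 3 * eps * F s ^+ 2 + 2 / 3 * c ^- 6 * F s ^+ 8 = 0]]].
Proof.
move=> c0 alE p; have [x [y0 [r [ax xp xE xc]]]] := st_chart p.
have cn0 : c != 0 by rewrite gt_eqF.
have f0 q : f q != 0 by rewrite gt_eqF // fp.
have m0 q : 0 < t_density q by rewrite sqrtr_gt0.
have sf1 : smooth_on_surface (der E1 f) := msmooth_der sE1 sf.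
pose F := slice x y0 f.
have FE q : cdom x q -> f q = F (cmap x q 0 0).
  by move=> xq; exact: (slice_eq ax xE m0 xc sf f2E xq).
have on_slice q : cdom x q -> cimg x (slice_pt y0 (cmap x q 0 0)).
  by move=> xq; apply: (slice_pt_cimg xE); exists q.
have F1E q : cdom x q -> der E1 f q = derive1 F (cmap x q 0 0).
  move=> xq; rewrite (slice_derive1 ax xc sf (on_slice q xq)).
  apply: (slice_eq ax xE m0 xc sf1 _ xq).
  exact: (derE2_derE1_meanf himm hcmc hframe bc b20 k1E k20).
have b1E q : b1 q = - (3 * c ^+ 3 * der E1 f q / f q ^+ 3).
  exact: connection_coefficient cn0 (f0 q) (alpha_b1 himm hcmc hframe bc k1E q) (alE q).
have a2E q : a2 q = 3 / 2 * (der E1 f q / f q).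
  apply: (mulIf (f0 q)); rewrite (a2_meanf himm hcmc hframe bc k1E k20 q).
  by rewrite -!mulrA mulVf ?mulr1.
have KE q : gaussK eps phi q = - (c ^- 3 * f q ^+ 3) ^+ 2 + eps.
  by rewrite (gaussK_frame himm hcmc hframe q) k20 mulr0 sub0r alE.
exists x, F; split; first exact: xp.
  split; first exact: ax.
  - exists (fun s => (F s ^+ 3)^-1) => q xq /=.
    have [c1 c2] := xc q xq; have fs := FE q xq.
    split.
    - by rewrite -fs invr_gt0.
    - rewrite -fs; exact: first_form_st ax xc q xq.
    - exact: c1.
    - rewrite -fs; exact: etrans c2 (congr1 (fun z => z *: e_ 1) (sqrt_inv (f3p q))).
  - split.
    + by exists F.
    + by exists (fun s => 2 * F s) => q xq; rewrite k1E (FE q xq).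
    + by exists (fun=> 0) => q xq; exact: k20.
  - split.
    + by exists (fun s => c ^- 3 * F s ^+ 3) => q xq; rewrite alE (FE q xq).
    + exists (fun s => 3 / 2 * (derive1 F s / F s)) => q xq.
      by rewrite a2E (F1E q xq) (FE q xq).
    + exists (fun s => - (3 * c ^+ 3 * derive1 F s / F s ^+ 3)) => q xq.
      by rewrite b1E (F1E q xq) (FE q xq).
    + by exists (fun s => - (c ^- 3 * F s ^+ 3) ^+ 2 + eps) => q xq; rewrite KE (FE q xq).
move=> q xq s; (* The point on the coordinate line along which F is defined; the derivatives of F
   are those of f there. *)
pose q' := cinv x (slice_pt y0 s).
have Fs : f q = F s := FE q xq.
have F1s : der E1 f q = derive1 F s := F1E q xq.
have F1' : derive1 F s = der E1 f q'.
  exact: (slice_derive1 ax xc sf (on_slice q xq)).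
have F2' : derive1n 2 F s = der E1 (der E1 f) q'.
  exact: (slice_derive2 ax xc sE1 sf (on_slice q xq)).
have F' : F s = f q' := erefl.
split; first exact: Fs.
  split; last exact: k20.
  - by rewrite b1E F1s Fs.
  - by rewrite a2E F1s Fs.
  - by rewrite alE Fs.
split; first by rewrite F'; exact: fp.
  by rewrite -F1s; exact: f1_gt0.
rewrite F2' F1' F'.
exact: ode_constant cn0 (alE q') (meanf_ode himm hcmc hframe bc b20 k1E k20 q').
Qed.

End Coordinates.

(** * The gradient as an eigenvector of A_3 *)

Section EigenGradient.
Context {R : realType} (eps : R) {M : surface R} (phi : M -> 'rV[R]_5).
Context (E1 E2 : M -> 'rV[R]_2) (E4 : M -> 'rV[R]_5)
  (k1 k2 alpha a1 a2 b1 b2 : M -> R).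
Hypothesis himm : immersion_in_N4 eps phi.
Hypothesis hcmc : forall p, exists v,
  shapeA eps phi p (E3 eps phi p) v != meanf eps phi p *: v.
Hypothesis hframe : adapted_frame eps phi E1 E2 E4 k1 k2 alpha a1 a2 b1 b2.
Local Notation f := (meanf eps phi).
Implicit Types (p q : M).

Let ortho := frame_orthonormal hframe.

Lemma secondB_linear q a v b w z : secondB eps phi q (a *: v + b *: w) z =
  a *: secondB eps phi q v z + b *: secondB eps phi q w z.
Proof.
have S u := secondB_suml himm ortho q u z.
rewrite (S v) (S w) (S (a *: v + b *: w)) !scaler_sumr -big_split.
apply: eq_bigr => i _; rewrite !scalerA; apply: etrans (scalerDl _ _ _).
apply: (congr1 (fun r => r *: _)); rewrite [LHS]mxE.
by congr (_ + _); rewrite mxE.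
Qed.

Lemma shapeA_linear q eta a v b w : shapeA eps phi q eta (a *: v + b *: w) =
  a *: shapeA eps phi q eta v + b *: shapeA eps phi q eta w.
Proof.
rewrite /shapeA /shape_op !scalemxAl -mulmxDl; apply: (congr1 (mulmx^~ _)).
apply/rowP => j; rewrite [LHS]mxE.
apply: etrans (congr1 (fun z => dot eps z eta) (secondB_linear q a v b w (e_ j))) _.
apply: etrans (dotDl _ _ _ _) _.
apply: etrans (congr2 +%R (dotZl _ _ _ _) (dotZl _ _ _ _)) _.
rewrite [RHS]mxE; apply: congr2; rewrite [RHS]mxE [X in _ = _ * X]mxE; exact: erefl.
Qed.

Lemma inner_linear q a v b w z :
  inner eps phi q (a *: v + b *: w) z = a * inner eps phi q v z + b * inner eps phi q w z.
Proof.
rewrite /inner !mulmxDl -!scalemxAl [LHS]mxE.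
by apply: congr2; rewrite mxE.
Qed.

Lemma shapeA_gradM q : shapeA eps phi q (E3 eps phi q) (gradM eps phi f q) =
  (der E1 f q * k1 q) *: E1 q + (der E2 f q * k2 q) *: E2 q.
Proof.
have sf := smooth_meanf himm hcmc hframe.
have -> := gradM_frame himm ortho q sf.
apply: etrans (shapeA_linear q _ _ _ _ _) _.
apply: (congr2 +%R).
  exact: etrans (congr1 ( *:%R (der E1 f q)) (frame_k1 hframe q)) (scalerA _ _ _).
exact: etrans (congr1 ( *:%R (der E2 f q)) (frame_k2 hframe q)) (scalerA _ _ _).
Qed.

(** Since E1 f is not 0, the E1 component gives k1 = 2 f, and the trace gives k2 = 0. *)
Lemma gradM_eigenvector q : der E1 f q != 0 ->
  shapeA eps phi q (E3 eps phi q) (gradM eps phi f q) = (2 * f q) *: gradM eps phi f q ->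
  k1 q = 2 * f q /\ k2 q = 0.
Proof.
move=> f10; rewrite shapeA_gradM.
have sf := smooth_meanf himm hcmc hframe.
have -> := gradM_frame himm ortho q sf.
rewrite scalerDr !scalerA => h.
have [i1 _ i12] := ortho q.
have i21 : inner eps phi q (E2 q) (E1 q) = 0.
  exact: etrans (innerE himm _ _ _) (etrans (dotC _ _ _)
    (etrans (esym (innerE himm _ _ _)) i12)).
have k1E : k1 q = 2 * f q.
  have lE a b : inner eps phi q (a *: E1 q + b *: E2 q) (E1 q) = a.
    apply: etrans (inner_linear _ _ _ _ _ _) _.
    by rewrite i1 i21 mulr0 addr0 mulr1.
  apply: (mulfI f10); rewrite [RHS]mulrC.
  exact: etrans (esym (lE _ _)) (etrans (congr1 (fun v => inner eps phi q v (E1 q)) h) (lE _ _)).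
split; first exact: k1E.
apply: (addrI (k1 q)); rewrite addr0; exact: etrans (trace_A3 himm hcmc hframe q) (esym k1E).
Qed.

(** For k2 = b2 = 0 the biconservative equation says that grad f is a multiple of E1, the
   eigenvalue of which is k1 = 2 f by the trace. *)
Lemma gradM_eigenvector_of_k2 q : biconservative eps phi -> (forall p, b2 p = 0) ->
  (forall p, k2 p = 0) ->
  shapeA eps phi q (E3 eps phi q) (gradM eps phi f q) = (2 * f q) *: gradM eps phi f q.
Proof.
move=> bc b20 k20; rewrite shapeA_gradM.
have sf := smooth_meanf himm hcmc hframe.
have -> := gradM_frame himm ortho q sf.
have f2 := derE2_meanf himm hcmc hframe bc b20 k20 q.
have := trace_A3 himm hcmc hframe q; rewrite k20 addr0 => ->.
rewrite f2 mul0r !scale0r !addr0 scalerA.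
by apply: (congr1 (fun r => r *: _)); exact: mulrC.
Qed.

End EigenGradient.

Theorem theorem3p13 (R : realType) (eps : R) (M : surface R)
    (phi : M -> 'rV[R]_5)
    (himm : immersion_in_N4 eps phi)
    (hbic : non_CMC_biconservative eps phi)
    (hW : W_surface eps phi)
    (hflat : flat_normal_bundle eps phi)
    (E1 E2 : M -> 'rV[R]_2) (E4 : M -> 'rV[R]_5)
    (k1 k2 alpha a1 a2 b1 b2 : M -> R)
    (hframe : adapted_frame eps phi E1 E2 E4 k1 k2 alpha a1 a2 b1 b2)
    (hlabel : frame_labelling b1 b2)
    (hsigns : frame_signs eps phi E1 alpha)
    (hK : forall p, 3 * meanf eps phi p ^+ 2 + gaussK eps phi p - eps != 0)
    (hE3 : forall p, exists v, nabla_perp eps phi (E3 eps phi) p v != 0)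
    (hA4 : forall p, exists v, shapeA eps phi p (E4 p) v != 0)
    (hE2 : forall p, nabla eps phi E2 p (E2 p) != 0) :
  (forall p, shapeA eps phi p (E3 eps phi p) (gradM eps phi (meanf eps phi) p)
             = (2 * meanf eps phi p) *: gradM eps phi (meanf eps phi) p)
  <->
  (exists c : R, 0 < c /\
    forall p : M, exists (x : chart R M) (F : R -> R),
      [/\ cdom x p,
          st_coordinates eps phi E1 E2 k1 k2 alpha a2 b1 x &
          forall q, cdom x q ->
            let s := cmap x q 0 0 in
            [/\ meanf eps phi q = F s,
                [/\ b1 q = - (3 * c ^+ 3 * derive1 F s / F s ^+ 3),
                    a2 q = 3 / 2 * (derive1 F s / F s),
                    alpha q = c ^- 3 * F s ^+ 3 &
                    k2 q = 0] &
                [/\ 0 < F s, 0 < derive1 F s &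
                    derive1n 2 F s * F s - 5 / 2 * derive1 F s ^+ 2
                    - 2 / 3 * eps * F s ^+ 2 + 2 / 3 * c ^- 6 * F s ^+ 8 = 0]]]).
Proof.
have hcmc p : exists v, shapeA eps phi p (E3 eps phi p) v != meanf eps phi p *: v.
  by have [_ _] := hbic.2 p.
have bc := hbic.1.
have b20 p : b2 p = 0 := (hlabel p).2.
have f1_gt0 p : 0 < der E1 (meanf eps phi) p := (hsigns p).1.
split=> [eig | [c [c0 charts]] p].
- have k12 p : k1 p = 2 * meanf eps phi p /\ k2 p = 0.
    by apply: (gradM_eigenvector himm hcmc hframe _ (eig p)); rewrite gt_eqF.
  have k1E p := (k12 p).1; have k20 p := (k12 p).2.
  (* The constant c is read off at one point, if there is any. *)
  have [[p0 _]|M0] := pselect (exists p : M, True); last first.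
    by exists 1; split=> // p; case: M0; exists p.
  have al0 : 0 < alpha p0 / meanf eps phi p0 ^+ 3.
    by rewrite divr_gt0 ?(hsigns p0).2 // exprn_gt0 // (meanf_gt0 hcmc).
  have [c c0 cE] := cube_root al0.
  exists c; split=> // p.
  apply: (st_chart_solution himm hcmc hframe bc b20 k1E k20 f1_gt0 c0) => q.
  by rewrite cE; exact: (alpha_cube himm hcmc hframe bc b20 k1E k20).
- apply: (gradM_eigenvector_of_k2 himm hcmc hframe p bc b20) => q.
  have [x [F [xq _ /(_ q xq) [_ [_ _ _ +] _]]]] := charts q.
  exact.
Qed.
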